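(* Let $X$ be the limit curve (almost sure uniform limit of $X_n(t)=\mathrm{LI}(u_1T_nu_2)(\bar\alpha^nt)$ for a consistent sequence $(T_n)$ of uniform spanning trees), $\bar\alpha=\frac43+\frac1{15}\sqrt{205}$, $\gamma_\ell=\log2/\log\bar\alpha$, $\gamma_r=\log3/\log\bar\alpha$. Then: (a) for every $p>0$ there are constants $C_9(p),C_{10}(p)>0$ such that for all $s\in[0,\infty)$ and $t\in[0,1]$, \[C_9(p)\,t^{p\gamma_\ell}\le\mathbb E\|X(t)\|_2^p\qquad\text{and}\qquad\mathbb E\|X(s+t)-X(s)\|_2^p\le C_{10}(p)\,t^{p\gamma_\ell};\] (b) there are constants $C_{11},C_{12}>0$ such that for every $s\in[0,\infty)$, almost surely \[\limsup_{t\searrow0}\frac{\|X(s+t)-X(s)\|_2}{t^{\gamma_\ell}(\log\log(1/t))^{1-\gamma_\ell}}\le C_{11},\qquad \liminf_{t\searrow0}\frac{\|X(t)\|_2}{t^{\gamma_\ell}(\log\log(1/t))^{-\gamma_\ell(1-1/\gamma_r)}}\ge C_{12}.\]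
   Context: Let $u_1=(0,0)$, $u_2=(1,0)$, $u_3=(\tfrac12,\tfrac{\sqrt3}2)$ in $\mathbb R^2$ and $\psi_i(x)=\tfrac12(x-u_i)+u_i$ for $i\in\{1,2,3\}$. The Sierpiński gasket $K$ is the unique nonempty compact set with $K=\psi_1(K)\cup\psi_2(K)\cup\psi_3(K)$. The Sierpiński graphs $G_n$ (embedded in the plane, all edges as straight segments lie in $K$) are defined recursively: $G_0$ has vertex set $VG_0=\{u_1,u_2,u_3\}$ and edge set $\{\{u_1,u_2\},\{u_2,u_3\},\{u_3,u_1\}\}$; $G_{n+1}$ has vertex set $\psi_1(VG_n)\cup\psi_2(VG_n)\cup\psi_3(VG_n)$ and edge set $\psi_1(EG_n)\cup\psi_2(EG_n)\cup\psi_3(EG_n)$ (edges mapped vertexwise). For a word $w=w_1\cdots w_k\in\{1,2,3\}^k$ put $\psi_w=\psi_{w_1}\circ\cdots\circ\psi_{w_k}$; then $G_n=\bigcup_{w\in\{1,2,3\}^k}\psi_w(G_{n-k})$. For a spanning subgraph $H\subseteq G_n$ and $w\in\{1,2,3\}^k$, $\pi_w(H)=\psi_w^{-1}(H\cap\psi_w(G_{n-k}))$. $\mathcal T_n$ denotes the set of spanning trees of $G_n$; $\mathcal S_n^i$ the set of spanning forests of $G_n$ with two components, one containing $u_i$ and the other containing $\{u_1,u_2,u_3\}\setminus\{u_i\}$; $\mathcal R_n$ the set of spanning forests with three components each containing exactly one of $u_1,u_2,u_3$; $\mathcal Q_n=\mathcal T_n\cup\mathcal S_n^1\cup\mathcal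 S_n^2\cup\mathcal S_n^3\cup\mathcal R_n$. For $g\in\mathcal Q_1$, $\mathrm{Tr}\,g$ is the spanning subgraph of $G_0$ equal to: the two edges at $u_i$ if $g$ is a spanning tree of $G_1$ in which for both $j\neq i$ the path from $u_i$ to $u_j$ lies in $\psi_i(G_0)\cup\psi_j(G_0)$ (every spanning tree of $G_1$ satisfies this for exactly one $i$); the single edge not containing $u_i$ if $g\in\mathcal S_1^i$; the edgeless graph if $g\in\mathcal R_1$. For $f\in\mathcal Q_{n+1}$, $\mathrm{Tr}\,f=\bigcup_{w\in\{1,2,3\}^n}\psi_w(\mathrm{Tr}\,\pi_w(f))$; Tr maps spanning trees of $G_{n+1}$ to spanning trees of $G_n$. A consistent sequence of uniform spanning trees is a sequence $(T_n)_{n\ge0}$ of random spanning trees defined on a common probability space such that $T_n$ is uniformly distributed on $\mathcal T_n$ and $\mathrm{Tr}\,T_{n+1}=T_n$ for all $n$. For a tree $t$ and vertices $x,y$, $xty$ denotes the unique self-avoiding walk in $t$ from $x$ to $y$. For a walk $x=(x_0,\dots,x_r)$, $\mathrm{LI}(x):[0,\infty]\to K$ is the linear interpolation $\mathrm{LI}(x)(t)=(k+1-t)x_k+(t-k)x_{k+1}$ for $k\le t<k+1$, $k<r$, and $\mathrm{LI}(x)(t)=x_r$ for $t\ge r$. It is known that $X_n$ converges almost surely uniformly to a continuous curve $X$ with $X(0)=u_1$. $\|\cdot\|_2$ is the Euclidean norm (note $u_1$ is the origin). *)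

(* Defs.v *)
From HB Require Import structures.
From mathcomp Require Import all_boot all_order all_algebra.
From mathcomp Require Import all_classical all_reals all_analysis.
Set Implicit Arguments. Unset Strict Implicit. Unset Printing Implicit Defensive.
Import Order.TTheory GRing.Theory Num.Theory.
Local Open Scope classical_set_scope.
Local Open Scope ring_scope.

(* A vertex of G_n is encoded by (a,b) : nat * nat, standing for the      *)
(* point  (a/2^n) u_2 + (b/2^n) u_3  of the plane (see [emb] below).       *)
(* The index i : 'I_3 stands for 1,2,3 via 0,1,2.                          *)

Definition pt := (nat * nat)%type.

Definition corner (n : nat) (i : 'I_3) : pt :=
  match val i with
  | 0 => (0, 0)
  | 1 => (2 ^ n, 0)
  | _ => (0, 2 ^ n)
  end%N.

Definition psi (m : nat) (i : 'I_3) (p : pt) : pt :=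
  match val i with
  | 0 => p
  | 1 => (p.1 + 2 ^ m, p.2)
  | _ => (p.1, p.2 + 2 ^ m)
  end%N.

Definition psie (m : nat) (i : 'I_3) (e : pt * pt) : pt * pt :=
  (psi m i e.1, psi m i e.2).

Fixpoint VG (n : nat) : set pt :=
  match n with
  | 0 => [set corner 0 i | i in [set: 'I_3]]
  | n'.+1 => \bigcup_(i in [set: 'I_3]) (psi n' i @` VG n')
  end.

Fixpoint EG (n : nat) : set (pt * pt) :=
  match n with
  | 0 => [set e | exists i j : 'I_3, i != j /\ e = (corner 0 i, corner 0 j)]
  | n'.+1 => \bigcup_(i in [set: 'I_3]) (psie n' i @` EG n')
  end.

Fixpoint psiw (m : nat) (w : seq 'I_3) (p : pt) : pt :=
  match w with
  | [::] => p
  | i :: w' => psi (m + size w') i (psiw m w' p)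
  end.

Definition psiwe (m : nat) (w : seq 'I_3) (e : pt * pt) : pt * pt :=
  (psiw m w e.1, psiw m w e.2).

Definition emb (R : realType) (n : nat) (p : pt) : R * R :=
  ((p.1%:R + p.2%:R / 2) / 2 ^+ n, (p.2%:R * Num.sqrt 3 / 2) / 2 ^+ n).

(* A spanning subgraph H of G_n is given by its (symmetric) edge set.     *)

Definition subgraph (n : nat) (H : set (pt * pt)) : Prop :=
  H `<=` EG n /\ (forall x y, H (x, y) -> H (y, x)).

Definition adj (H : set (pt * pt)) : rel pt := fun x y => `[< H (x, y) >].

Definition reach (H : set (pt * pt)) (x y : pt) : Prop :=
  exists s : seq pt, path (adj H) x s /\ last x s = y.

Definition acyclic (H : set (pt * pt)) : Prop :=
  ~ exists s : seq pt, [/\ (3 <= size s)%N, uniq s & cycle (adj H) s].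

Definition spanning_tree (n : nat) (H : set (pt * pt)) : Prop :=
  [/\ subgraph n H, acyclic H & forall x y, VG n x -> VG n y -> reach H x y].

Definition corner_covered (n : nat) (H : set (pt * pt)) : Prop :=
  forall x, VG n x -> exists i, reach H x (corner n i).

Definition forestS (n : nat) (i : 'I_3) (H : set (pt * pt)) : Prop :=
  [/\ subgraph n H, acyclic H, corner_covered n H,
      (forall j, j != i -> ~ reach H (corner n i) (corner n j))
    & (forall j k, j != i -> k != i -> reach H (corner n j) (corner n k))].

Definition forestR (n : nat) (H : set (pt * pt)) : Prop :=
  [/\ subgraph n H, acyclic H, corner_covered n H
    & forall j k, j != k -> ~ reach H (corner n j) (corner n k)].

(* the unique self-avoiding walk x t y (as the list of its vertices) *)
Definition saw (H : set (pt * pt)) (x y : pt) (s : seq pt) : Prop :=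
  [/\ path (adj H) x s, last x s = y & uniq (x :: s)].

Definition walk (H : set (pt * pt)) (x y : pt) : seq pt :=
  x :: xget [::] (saw H x y).

Definition star0 (i : 'I_3) : set (pt * pt) :=
  [set e | exists j, j != i /\ (e = (corner 0 i, corner 0 j) \/ e = (corner 0 j, corner 0 i))].

Definition opp0 (i : 'I_3) : set (pt * pt) :=
  [set e | exists j k, [/\ j != i, k != i, j != k & e = (corner 0 j, corner 0 k)]].

Definition path_in_two (g : set (pt * pt)) (i j : 'I_3) : Prop :=
  let s := walk g (corner 1 i) (corner 1 j) in
  forall k, (k.+1 < size s)%N ->
    let e := (nth (0,0)%N s k, nth (0,0)%N s k.+1) in
    (psie 0 i @` EG 0) e \/ (psie 0 j @` EG 0) e.

Definition tree_type (g : set (pt * pt)) (i : 'I_3) : Prop :=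
  forall j, j != i -> path_in_two g i j.

Definition Tr1 (g : set (pt * pt)) : set (pt * pt) :=
  if `[< spanning_tree 1 g >] then star0 (xget ord0 (tree_type g))
  else if `[< exists i, forestS 1 i g >] then opp0 (xget ord0 (fun i => forestS 1 i g))
  else set0.

Definition piw (w : seq 'I_3) (H : set (pt * pt)) : set (pt * pt) :=
  [set e | EG 1 e /\ H (psiwe 1 w e)].

Definition Tr (n : nat) (f : set (pt * pt)) : set (pt * pt) :=
  [set e | exists w : seq 'I_3, size w = n /\
             exists e0, Tr1 (piw w f) e0 /\ e = psiwe 0 w e0].

Definition norm2 (R : realType) (p : R * R) : R := Num.sqrt (p.1 ^+ 2 + p.2 ^+ 2).

Definition subp (R : realType) (p q : R * R) : R * R := (p.1 - q.1, p.2 - q.2).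

Definition LI (R : realType) (x : seq (R * R)) (t : R) : R * R :=
  let r := (size x).-1 in
  let k := Num.truncn t in
  let x0 := (0, 0) in
  if (k < r)%N then
    ((k.+1%:R - t) * (nth x0 x k).1 + (t - k%:R) * (nth x0 x k.+1).1,
     (k.+1%:R - t) * (nth x0 x k).2 + (t - k%:R) * (nth x0 x k.+1).2)
  else nth x0 x r.

Definition alpha_bar (R : realType) : R := 4 / 3 + Num.sqrt 205 / 15.
Definition gamma_l (R : realType) : R := ln 2 / ln (alpha_bar R).
Definition gamma_r (R : realType) : R := ln 3 / ln (alpha_bar R).

Definition Xn (R : realType) (n : nat) (Tn : set (pt * pt)) (t : R) : R * R :=
  LI (map (emb R n) (walk Tn (corner n ord0) (corner n (@Ordinal 3 1 isT))))
     (alpha_bar R ^+ n * t).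

(* Main.v *)
(** A spanning tree of G_n restricts to every cell of level k as a spanning forest whose
    type (the partition it induces on the corners of the cell) is one of five, and given
    the types the restrictions to the cells are independent and uniform.  The path from
    u_1 to u_2 crosses the cells of level k one after the other, so its generating
    function obeys a recursion in two variables, for cells crossed in a tree (T) or in a
    two-component forest (S):
      T' = (S T^2 + S T + T^2) / 3,
      S' = (3 T^2 + S^2 + 2 T S^2 + 4 T S) / 10;
    its linearisation at 1 has the dominant eigenvalue alpha_bar.  Hence the number L of
    steps across a cell of level n satisfies, for t > 0 and l <= n,
      P (L <= t alpha_bar^n) <= exp (t alpha_bar^l - c 2^l)
    because at least 2^l cells of generation l are crossed, and
      P (L >= t alpha_bar^n) <= exp (C 3^l - c t alpha_bar^l)
    because at most 3^l of them are.  A displacement larger than 2 / 2^k after time s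
    forces the first crossing of a cell of level k begun after s to be fast; a distance
    to the origin below sqrt 3 / 2^(k+1) at time t forces the first crossing of such a
    cell to be slow.  Optimising over l gives the moment bounds, and Borel-Cantelli along
    the times alpha_bar^-j the almost sure bounds. *)
Require Import Defs.
From HB Require Import structures.
From mathcomp Require Import all_boot all_order all_algebra.
From mathcomp Require Import all_classical all_reals all_analysis.
From mathcomp Require Import measurable_realfun.
From mathcomp Require Import zify ring lra.
Set Implicit Arguments. Unset Strict Implicit. Unset Printing Implicit Defensive.
Import Order.TTheory GRing.Theory Num.Theory.
Local Open Scope classical_set_scope.
Local Open Scope ring_scope.

(** * Forests and separating colourings *)

Notation edges := (set (pt * pt)).

Definition sym_edges (H : edges) := forall x y, H (x, y) -> H (y, x).
Definition loopless (H : edges) := forall x, ~ H (x, x).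
Definition constant_on (H : edges) (c : pt -> bool) :=
  forall u v, H (u, v) -> c u = c v.
(* Acyclicity is used in the form of separating 2-colourings, which are easy to glue. *)
Definition cuts_only (H : edges) (c : pt -> bool) (x y : pt) :=
  c x != c y /\
  forall u v, H (u, v) -> (u, v) <> (x, y) -> (u, v) <> (y, x) -> c u = c v.
Definition forest (H : edges) :=
  forall x y, H (x, y) -> exists c, cuts_only H c x y.

Lemma reach_refl H x : reach H x x.
Proof. by exists [::]. Qed.

Lemma reach_edge (H : edges) x y : H (x, y) -> reach H x y.
Proof. by move=> h; exists [:: y]; split=> //=; rewrite andbT; apply/asboolP. Qed.

Lemma reach_trans H x y z : reach H x y -> reach H y z -> reach H x z.
Proof.
move=> [s [ps ls]] [t [pt_ lt_]]; exists (s ++ t).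
by rewrite cat_path last_cat ls ps.
Qed.

Lemma reach_rec (H : edges) (Q : pt -> Prop) x y :
  (forall u v, Q u -> H (u, v) -> Q v) -> Q x -> reach H x y -> Q y.
Proof.
move=> hQ Qx [s [ps <-]]; elim: s x Qx ps => //= z s IH x Qx /andP[/asboolP h].
by apply: IH; apply: hQ h.
Qed.

Lemma reach_sym H x y : sym_edges H -> reach H x y -> reach H y x.
Proof.
move=> sH; apply: (@reach_rec H (fun z => reach H z x)); last exact: reach_refl.
by move=> u v hu huv; apply: reach_trans hu; apply/reach_edge/sH.
Qed.

Lemma reach_constant H c x y : constant_on H c -> reach H x y -> c x = c y.
Proof.
move=> hc; apply: (@reach_rec H (fun z => c x = c z)) => // u v -> /hc //.
Qed.

Lemma path_constant (H : edges) (c : pt -> bool) (x : pt) (s : seq pt) :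
  (forall u v, H (u, v) -> u \in x :: s -> v \in x :: s -> c u = c v) ->
  path (adj H) x s -> c x = c (last x s).
Proof.
elim: s x => //= y s IH x hc /andP[/asboolP hxy ps].
rewrite (hc x y hxy) ?inE ?eqxx ?orbT //; apply: IH ps => u v huv hu hv.
by apply: hc huv _ _; rewrite inE (hu, hv) orbT.
Qed.

Lemma acyclicP H : sym_edges H -> loopless H -> acyclic H <-> forest H.
Proof.
move=> sH lH; split.
  move=> acH x y hxy.
  pose H' : edges := [set e | [/\ H e, e <> (x, y) & e <> (y, x)]].
  have sH' : sym_edges H'.
    move=> u v [h h1 h2]; split; first exact: sH.
      by move=> [? ?]; apply: h2; congr pair.
    by move=> [? ?]; apply: h1; congr pair.
  exists (fun z => `[< reach H' x z >]); split.
    have -> : `[< reach H' x x >] = true by apply/asboolP; exact: reach_refl.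
    rewrite eq_sym eqb_id; apply/asboolP => -[s [ps ls]]; apply: acH.
    case/shortenP: ps ls => s' ps' us' _ ls'.
    exists (x :: s'); split=> //.
    - case: s' ps' ls' {us'} => [|z [|z' s']] //=.
        by move=> _ e; move: hxy; rewrite -e => /lH.
      by rewrite andbT => /asboolP[_ h _] e; case: h; rewrite e.
    - rewrite /= rcons_path; apply/andP; split.
        by apply: sub_path ps' => u v /asboolP[? _ _]; apply/asboolP.
      by rewrite ls'; apply/asboolP; exact: sH.
  move=> u v huv n1 n2; apply/asboolP/asboolP => h; apply: reach_trans h _;
    apply: reach_edge; first by split.
  by apply: sH'; split.
move=> fH [[|x [|y s]]]; [by case | by case |].
move=> [/= sz us]; rewrite rcons_path => /andP[/asboolP hxy /andP[ps /asboolP hl]].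
have [c [cxy hc]] := fH _ _ hxy; case/negP: cxy; apply/eqP.
case: s sz us ps hl => [//|z s] _ us ps hl.
have lsx : last y (z :: s) != x.
  apply: contraTneq us => e; have := mem_last y (z :: s).
  by rewrite e cons_uniq => ->.
have lsy : last y (z :: s) != y.
  apply: contraTneq us => e; have := mem_last z s.
  by rewrite -[last z s]/(last y (z :: s)) e !cons_uniq => ->; rewrite andbF.
have -> : c y = c (last y (z :: s)).
  apply: path_constant ps => u v huv hu hv; apply: hc => // -[e1 e2].
    by move: us; rewrite cons_uniq -e1 hu.
  by move: us; rewrite cons_uniq -e2 hv.
rewrite -(hc _ _ hl) //; first by move=> [e _]; move/eqP: lsx.
by move=> [e]; move/eqP: lsy.
Qed.

Lemma forest_first_edge H x z s c : uniq (x :: z :: s) ->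
  path (adj H) z s -> cuts_only H c x z -> c x != c (last z s).
Proof.
move=> us ps [cxz hc]; rewrite -(@path_constant H c z s) // => u v huv hu hv.
apply: hc => // -[e1 e2]; first by move: us; rewrite cons_uniq -e1 hu.
by move: us; rewrite cons_uniq -e2 hv.
Qed.

Lemma saw_unique H x y s s' : forest H -> saw H x y s -> saw H x y s' -> s = s'.
Proof.
move=> fH; elim: s s' x => [|z s IH] [|z' s'] x //=.
- by move=> [_ /= <- _] [_ /= l]; have := mem_last z' s'; rewrite l => ->.
- by move=> [_ /= l u] [_ /= e _]; move: u; have := mem_last z s; rewrite l -e => ->.
move=> [/= /andP[/asboolP hz ps] ls us] [/= /andP[/asboolP hz' ps'] ls' us'].
have [ezz|nzz] := eqVneq z z'.
  subst z'; congr cons; apply: (IH _ z); split=> //.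
    by case/andP: us.
  by case/andP: us'.
have [c hc] := fH _ _ hz.
have h1 := forest_first_edge us ps hc.
case/negP: h1; rewrite ls -ls'; apply/eqP.
case: hc => _ hc.
have -> : c x = c z'.
  apply: hc hz' _ _ => -[e1]; first by rewrite e1 eqxx in nzz.
  by move=> _; rewrite e1 inE eqxx in us.
apply: path_constant ps' => u v huv hu hv.
apply: hc => // -[e1 e2]; first by move: us'; rewrite -e1 hu.
by move: us'; rewrite -e2 hv.
Qed.

Lemma forest_separates H x y : forest H -> reach H x y -> x != y ->
  exists2 z, H (x, z) & forall c, cuts_only H c x z -> c x != c y.
Proof.
move=> fH [s [ps ls]] nxy; case/shortenP: ps ls => -[|z s'] /=.
  by move=> _ _ _ e; rewrite e eqxx in nxy.
move=> /andP[/asboolP hz ps] us _ ls; exists z => // c hc.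
by rewrite -ls; exact: forest_first_edge hc.
Qed.

(** * Encoding of subgraphs by their cells *)

Definition o0 : 'I_3 := ord0.
Definition o1 : 'I_3 := @Ordinal 3 1 isT.
Definition o2 : 'I_3 := @Ordinal 3 2 isT.

Lemma I3_ind (Q : 'I_3 -> Prop) : Q o0 -> Q o1 -> Q o2 -> forall i, Q i.
Proof.
move=> h0 h1 h2 [[|[|[|//]]] h].
- by rewrite (_ : Ordinal h = o0)//; apply: val_inj.
- by rewrite (_ : Ordinal h = o1)//; apply: val_inj.
- by rewrite (_ : Ordinal h = o2)//; apply: val_inj.
Qed.

Definition third (i j : 'I_3) : 'I_3 :=
  match val i, val j with
  | 0, 1 | 1, 0 => o2
  | 0, 2 | 2, 0 => o1
  | _, _ => o0
  end%N.

Lemma thirdC i j : third i j = third j i.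
Proof. by elim/I3_ind: i; elim/I3_ind: j. Qed.

Lemma third_neq i j : i != j -> (third i j != i) && (third i j != j).
Proof. by elim/I3_ind: i; elim/I3_ind: j. Qed.

Lemma thirdK i j : i != j -> third i (third i j) = j.
Proof. by elim/I3_ind: i; elim/I3_ind: j. Qed.

(* Bit [k] of a code of level 0 stands for the edge opposite to the corner [k]. *)
Fixpoint sg (n : nat) : finType :=
  if n is m.+1 then ({ffun 'I_3 -> sg m} : finType) else ({ffun 'I_3 -> bool} : finType).

Fixpoint dec (n : nat) : sg n -> edges :=
  match n return sg n -> edges with
  | 0 => fun c : {ffun 'I_3 -> bool} =>
     [set e | exists i j, [/\ i != j, c (third i j) & e = (corner 0 i, corner 0 j)]]
  | m.+1 => fun c : {ffun 'I_3 -> sg m} =>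
     [set e | exists i e', dec (c i) e' /\ e = psie m i e']
  end.

Definition inV (n : nat) (p : pt) := (p.1 + p.2 <= 2 ^ n)%N.

Lemma inV_corner n i : inV n (corner n i).
Proof. by rewrite /inV; elim/I3_ind: i => /=; rewrite ?addn0 ?add0n ?expn_gt0. Qed.

Lemma inV_psi n i p : inV n p -> inV n.+1 (psi n i p).
Proof.
rewrite /inV expnS mul2n -addnn; elim/I3_ind: i; rewrite /psi /= => h.
- exact: leq_trans h (leq_addr _ _).
- by rewrite addnAC leq_add2r.
- by rewrite addnA leq_add2r.
Qed.

Lemma psi_inj n i p q : psi n i p = psi n i q -> p = q.
Proof.
case: p q => [a b] [c d]; elim/I3_ind: i => //= -[].
  by move=> /addIn -> ->.
by move=> -> /addIn ->.
Qed.

Lemma psi_corner n i : psi n i (corner n i) = corner n.+1 i.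
Proof.
by elim/I3_ind: i => //=; rewrite /psi /corner /= addnn -mul2n expnS.
Qed.

Lemma psi_mid n i j : psi n i (corner n j) = psi n j (corner n i).
Proof. by elim/I3_ind: i; elim/I3_ind: j. Qed.

Lemma psi_meet n i j p q : inV n p -> inV n q -> psi n i p = psi n j q ->
  [\/ i = j /\ p = q | [/\ i != j, p = corner n j & q = corner n i]].
Proof.
have [<-|nij] := eqVneq i j; first by move=> _ _ /psi_inj ->; left.
move=> hp hq h; right; split=> //; move: h hp hq nij; case: p q => [a b] [c d];
by rewrite /inV /=; elim/I3_ind: i; elim/I3_ind: j => //; rewrite /psi /corner /= => -[??] ? ? _;
  congr pair; lia.
Qed.

Lemma corner_inj n : injective (corner n).
Proof.
have h : (2 ^ n)%N != 0%N by rewrite -lt0n expn_gt0.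
move=> i j; elim/I3_ind: i; elim/I3_ind: j => //; rewrite /corner /= => -[e];
 by [rewrite e in h | rewrite -e in h | move=> e'; rewrite e' in h | move=> e'; rewrite -e' in h].
Qed.

Lemma dec_inV n (c : sg n) x y : dec c (x, y) -> inV n x /\ inV n y.
Proof.
elim: n c x y => [|n IH] c x y /=.
  by move=> [i [j [_ _ [-> ->]]]]; split; exact: inV_corner.
move=> [i [[x' y'] [/IH [hx hy] [-> ->]]]].
by split; exact: inV_psi.
Qed.

Lemma dec_sym n (c : sg n) : sym_edges (dec c).
Proof.
elim: n c => [|n IH] c x y /=.
  move=> [i [j [nij cij [-> ->]]]]; exists j, i; split=> //; first by rewrite eq_sym.
  by rewrite thirdC.
move=> [i [[x' y'] [h [-> ->]]]]; exists i, (y', x'); split=> //; exact: IH.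
Qed.

Lemma dec_loopless n (c : sg n) : loopless (dec c).
Proof.
elim: n c => [|n IH] c x /=.
  by move=> [i [j [nij _ [-> /corner_inj e]]]]; rewrite e eqxx in nij.
by move=> [i [[x' y'] [h [-> /psi_inj e]]]]; apply: (IH (c i) x'); rewrite [in X in (_, X)]e.
Qed.

Lemma dec_psi n (c : sg n.+1) i x y : dec (c i) (x, y) ->
  dec c (psi n i x, psi n i y).
Proof. by move=> h; exists i, (x, y). Qed.

Lemma reach_psi n (c : sg n.+1) i x y : reach (dec (c i)) x y ->
  reach (dec c) (psi n i x) (psi n i y).
Proof.
apply: (@reach_rec (dec (c i)) (fun z => reach (dec c) (psi n i x) (psi n i z)));
  last exact: reach_refl.
move=> u v h huv; apply: reach_trans h _; exact/reach_edge/dec_psi.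
Qed.

Lemma dec_psiE n (c : sg n.+1) i x y : inV n x -> inV n y ->
  dec c (psi n i x, psi n i y) -> dec (c i) (x, y).
Proof.
move=> hx hy [j [[x' y'] [h [e1 e2]]]]; have [hx' hy'] := dec_inV h.
case: (psi_meet hx hx' e1) => [[eij ->]|[nij _ ex]].
  by move: e2; rewrite -eij => /psi_inj ->; rewrite eij.
case: (psi_meet hy hy' e2) => [[eij]|[_ _ ey]]; first by rewrite eij eqxx in nij.
by move: h; rewrite ex ey => /dec_loopless.
Qed.

Lemma dec_injective n : injective (@dec n).
Proof.
elim: n => [|n IH] c c' e.
  apply/ffunP => k.
  suff H (a b : sg 0) : dec a = dec b -> (a : {ffun 'I_3 -> bool}) k -> (b : {ffun 'I_3 -> bool}) k.
    by apply/idP/idP; apply: H.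
  move=> eab ak.
  have [i [j [nij tij]]] : exists i j, i != j /\ third i j = k.
    by elim/I3_ind: k {ak}; [exists o1, o2 | exists o0, o2 | exists o0, o1].
  have : dec a (corner 0 i, corner 0 j) by exists i, j; split=> //; rewrite tij.
  rewrite eab => -[i' [j' [_ h [/corner_inj ei /corner_inj ej]]]].
  by rewrite -tij ei ej.
apply/ffunP => i; apply: IH; apply/seteqP.
suff H (a b : sg n.+1) : dec a = dec b -> dec (a i) `<=` dec (b i).
  by split; apply: H.
move=> eab [x y] h; have [hx hy] := dec_inV h.
by apply: dec_psiE => //; rewrite -eab; exact: dec_psi.
Qed.

Lemma dec_subgraph n (c : sg n) : subgraph n (dec c).
Proof.
split; last exact: dec_sym.
elim: n c => [|n IH] c /=.
  by move=> e [i [j [nij _ ->]]]; exists i, j.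
move=> e [i [e' [h ->]]]; exists i => //; exists e' => //; exact: IH h.
Qed.

Lemma dec_surj n H : subgraph n H -> exists c : sg n, dec c = H.
Proof.
elim: n H => [|n IH] H [hE hs].
  exists ([ffun k => `[< exists i j, [/\ i != j, third i j = k & H (corner 0 i, corner 0 j)] >]] : {ffun 'I_3 -> bool}).
  apply/seteqP; split=> [e [i [j [nij]]]|[x y] h].
    rewrite ffunE => /asboolP[i' [j' [nij' e' h]]] ->.
    have [[<- <-]//|[<- <-]] : (i' = i /\ j' = j) \/ (i' = j /\ j' = i).
    move: {h} nij nij' e'; elim/I3_ind: i; elim/I3_ind: j; elim/I3_ind: i'; elim/I3_ind: j';
      by [|left|right].
    exact: hs.
  have [i [j [nij [ex ey]]]] := hE _ h.
  by exists i, j; split; rewrite ?ffunE ?ex ?ey //; apply/asboolP; exists i, j; rewrite -ex -ey.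
have P i : exists c : sg n, dec c = [set e | EG n e /\ H (psie n i e)].
  apply: IH; split=> [e []//|x y [h1 h2]]; split; last exact: hs.
  suff : forall m x y, EG m (x, y) -> EG m (y, x) by apply.
  elim=> [|m IHm] u v /=.
    by move=> [a [b [nab [-> ->]]]]; exists b, a; rewrite eq_sym.
  by move=> [a _ [[u' v'] /IHm h [<- <-]]]; exists a => //; exists (v', u').
exists ([ffun i => projT1 (cid (P i))] : {ffun 'I_3 -> sg n}).
apply/seteqP; split=> [e [i [e' [h ->]]]|e h].
  have {h} : dec (projT1 (cid (P i))) e' by move: h; rewrite ffunE.
  by case: (cid (P i)) => /= c -> [].
have [i _ [e' he' ee]] := hE _ h; exists i, e'; split=> //.
suff : dec (projT1 (cid (P i))) e' by rewrite ffunE.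
by case: (cid (P i)) => /= c ->; rewrite /= ee.
Qed.

(** * Types of forests and gluing *)

(* Component [k] of a type tells whether the two corners other than [k] are connected. *)
Definition ctype := (bool * bool * bool)%type.

Definition tri (T : Type) (e : T * T * T) (k : 'I_3) : T :=
  match val k with 0 => e.1.1 | 1 => e.1.2 | _ => e.2 end%N.

Definition cn (e : ctype) (i j : 'I_3) := tri e (third i j).

(* The corner [j] of the cell [i] is the midpoint of the outer corners [i] and [j], so two
   outer corners are joined either through their own two cells or through all three. *)
Definition direct (e : ctype * ctype * ctype) i j :=
  cn (tri e i) i j && cn (tri e j) i j.
Definition detour (e : ctype * ctype * ctype) i j :=
  let k := third i j in [&& cn (tri e i) i k, cn (tri e k) i j & cn (tri e j) k j].
Definition cyclic3 (e : ctype * ctype * ctype) :=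
  [&& cn (tri e o0) o1 o2, cn (tri e o1) o0 o2 & cn (tri e o2) o0 o1].
Definition mid_covered (e : ctype * ctype * ctype) i j :=
  let k := third i j in
  [|| cn (tri e i) i j, cn (tri e j) i j,
      cn (tri e i) j k && (cn (tri e k) i k || cn (tri e k) i j && cn (tri e j) j k) |
      cn (tri e j) i k && (cn (tri e k) j k || cn (tri e k) i j && cn (tri e i) i k)].

Definition comb (e : ctype * ctype * ctype) : option ctype :=
  let f i j := direct e i j || detour e i j in
  if [&& ~~ cyclic3 e, mid_covered e o0 o1, mid_covered e o0 o2 & mid_covered e o1 o2]
  then Some (f o1 o2, f o0 o2, f o0 o1) else None.

Fixpoint ty (n : nat) : sg n -> option ctype :=
  match n return sg n -> option ctype with
  | 0 => fun c : {ffun 'I_3 -> bool} =>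
     if [&& c o0, c o1 & c o2] then None else
     Some (c o0 || c o1 && c o2, c o1 || c o0 && c o2, c o2 || c o0 && c o1)
  | m.+1 => fun c : {ffun 'I_3 -> sg m} =>
     match ty (c o0), ty (c o1), ty (c o2) with
     | Some a, Some b, Some d => comb (a, b, d)
     | _, _, _ => None
     end
  end.

Record sem n (c : sg n) (e : ctype) : Prop := Sem {
  sem_forest : forest (dec c);
  sem_cn : forall i j, i != j ->
    reach (dec c) (corner n i) (corner n j) <-> cn e i j;
  sem_cover : forall x, VG n x -> exists i, reach (dec c) x (corner n i) }.

Definition valid (e : ctype) := [&& e.1.1 && e.1.2 ==> e.2, e.1.1 && e.2 ==> e.1.2
  & e.1.2 && e.2 ==> e.1.1].

Lemma sem_valid n (c : sg n) e : sem c e -> valid e.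
Proof.
case=> _ h _; have s := @dec_sym _ c.
have h01 : reach (dec c) (corner n o0) (corner n o1) <-> e.2 by exact: h.
have h02 : reach (dec c) (corner n o0) (corner n o2) <-> e.1.2 by exact: h.
have h12 : reach (dec c) (corner n o1) (corner n o2) <-> e.1.1 by exact: h.
apply/and3P; split; apply/implyP => /andP[].
- move=> /h12 r1 /h02 r2; apply/h01; apply: reach_trans r2 _; exact: reach_sym.
- move=> /h12 r1 /h01 r2; apply/h02; exact: reach_trans r1.
- move=> /h02 r1 /h01 r2; apply/h12; apply: reach_trans r1; exact: reach_sym.
Qed.

(* A colouring of the six vertices of G_1: [x] on the outer corners and [y] on the
   midpoints, the midpoint of [i] and [j] carrying the index [third i j]. *)
Definition kap (x y : ctype) (i j : 'I_3) := if i == j then tri x i else tri y (third i j).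

Definition I3s := [:: o0; o1; o2].
Definition respects (e : ctype * ctype * ctype) x y :=
  all (fun i => all (fun p => all (fun q =>
    (p != q) && cn (tri e i) p q ==> (kap x y i p == kap x y i q)) I3s) I3s) I3s.

Definition ctypes : seq ctype :=
  [seq (p, b) | p <- [seq (a, b) | a <- [:: true; false], b <- [:: true; false]],
                b <- [:: true; false]].

Lemma mem_ctypes (e : ctype) : e \in ctypes.
Proof. by move: e => [[[] []] []]. Qed.

Lemma ctypes3P (Q : pred (ctype * ctype * ctype)) :
  all (fun a => all (fun b => all (fun d => Q (a, b, d)) ctypes) ctypes) ctypes ->
  forall e, Q e.
Proof.
move=> /allP h [[a b] d].
by move: (h a (mem_ctypes a)) => /allP/(_ b (mem_ctypes b))/allP/(_ d (mem_ctypes d)).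
Qed.

Definition valid3 (e : ctype * ctype * ctype) := [&& valid e.1.1, valid e.1.2 & valid e.2].

(* [has] evaluates both arguments of [||] under call by value; this variant stops early. *)
Fixpoint search (A : Type) (a : pred A) (s : seq A) :=
  if s is x :: s' then if a x then true else search a s' else false.

Lemma searchE (A : Type) (a : pred A) s : search a s = has a s.
Proof. by elim: s => //= x s ->; case: (a x). Qed.

Lemma mem_I3s i : i \in I3s.
Proof. by elim/I3_ind: i. Qed.

Lemma comb_separates e f i j : valid3 e -> comb e = Some f -> i != j -> ~~ cn f i j ->
  exists x y, respects e x y /\ tri x i != tri x j.
Proof.
pose Q e := if valid3 e then if comb e is Some f then
    all (fun i => all (fun j => if (i != j) && ~~ cn f i j then
      search (fun x => if tri x i != tri x j then search (respects e x) ctypes else false) ctypes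
    else true) I3s) I3s else true else true.
have /(_ e) : forall e, Q e by apply: ctypes3P; vm_compute.
rewrite /Q => + v cf nij nf; rewrite v cf.
move=> /allP/(_ i (mem_I3s i))/allP/(_ j (mem_I3s j)); rewrite nij nf searchE.
move=> /hasP [x _]; case: ifP => // nx; rewrite searchE => /hasP [y _ hy].
by exists x, y.
Qed.

Lemma uncovered_separates e i j : valid3 e -> i != j -> ~~ mid_covered e i j ->
  exists y, respects e (false, false, false) y /\ tri y (third i j).
Proof.
pose Q e := if valid3 e then
    all (fun i => all (fun j => if (i != j) && ~~ mid_covered e i j then
      search (fun y => if tri y (third i j) then respects e (false, false, false) y else false) ctypes
    else true) I3s) I3s else true.
have /(_ e) : forall e, Q e by apply: ctypes3P; vm_compute.
rewrite /Q => + v nij nm; rewrite v.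
move=> /allP/(_ i (mem_I3s i))/allP/(_ j (mem_I3s j)); rewrite nij nm searchE.
by move=> /hasP [y _]; case: ifP => // hy hr; exists y.
Qed.

Lemma glue_colourings n (chi : 'I_3 -> pt -> bool) :
  (forall i j, chi i (corner n j) = chi j (corner n i)) ->
  exists c, forall i p, inV n p -> c (psi n i p) = chi i p.
Proof.
move=> h; exists (fun z => `[< exists i x, [/\ inV n x, z = psi n i x & chi i x] >]).
move=> i p hp; apply/asboolP/idP => [[j [x [hx e cx]]]|cp]; last by exists i, p.
case: (psi_meet hp hx e) => [[-> ->]//|[nij -> ex]].
by rewrite h -ex.
Qed.

Lemma constant_psi n (c : sg n.+1) chi : (forall i, constant_on (dec (c i)) (fun p => chi (psi n i p))) ->
  constant_on (dec c) chi.
Proof. by move=> h u v [i [[u' v'] [huv [-> ->]]]]; exact: h huv. Qed.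

Lemma cell_colouring n (c : sg n) e (k : 'I_3 -> bool) : sem c e ->
  (forall i j, i != j -> cn e i j -> k i = k j) ->
  exists chi, constant_on (dec c) chi /\ forall i, chi (corner n i) = k i.
Proof.
move=> [_ hcn _] hk.
exists (fun z => `[< exists2 a, k a & reach (dec c) (corner n a) z >]); split.
  move=> u v huv; apply/asboolP/asboolP => -[a ka h]; exists a => //; apply: reach_trans h _;
  apply: reach_edge => //; exact: dec_sym.
move=> i; apply/asboolP/idP => [[a ka h]|ki]; last by exists i => //; exact: reach_refl.
have [<-//|nai] := eqVneq a i; rewrite -(hk a i) //; exact/hcn.
Qed.

Lemma colouring_ext n (c : sg n.+1) (e : ctype * ctype * ctype) x y :
  (forall i, sem (c i) (tri e i)) -> respects e x y ->
  exists chi, constant_on (dec c) chi /\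
    forall i j, chi (psi n i (corner n j)) = kap x y i j.
Proof.
move=> hs hr.
have P i : exists chi, constant_on (dec (c i)) chi /\ forall j, chi (corner n j) = kap x y i j.
  apply: cell_colouring (hs i) _ => p q npq hpq.
  move: hr => /allP/(_ i (mem_I3s i))/allP/(_ p (mem_I3s p))/allP/(_ q (mem_I3s q)).
  by rewrite npq hpq => /eqP.
have [chi hchi] := choice P.
have [cc hcc] : exists c, forall i p, inV n p -> c (psi n i p) = chi i p.
  apply: glue_colourings => i j; rewrite (hchi i).2 (hchi j).2 /kap eq_sym.
  by case: eqVneq => [->//|_]; rewrite thirdC.
exists cc; split.
  apply: constant_psi => i u v huv; have [hu hv] := dec_inV huv.
  by rewrite !hcc //; apply: (hchi i).1.
by move=> i j; rewrite hcc ?(hchi i).2 //; exact: inV_corner.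
Qed.

Lemma VG_psi n x : VG n.+1 x -> exists i x', VG n x' /\ x = psi n i x'.
Proof. by move=> [i _ [x' hx' <-]]; exists i, x'. Qed.

Lemma VG_inV n x : VG n x -> inV n x.
Proof.
elim: n x => [|n IH] x; first by move=> [i _ <-]; exact: inV_corner.
by move=> /VG_psi[i [x' [/IH h ->]]]; exact: inV_psi.
Qed.

Lemma VG_psiI n i x : VG n x -> VG n.+1 (psi n i x).
Proof. by move=> h; exists i => //; exists x. Qed.

Lemma VG_corner n i : VG n (corner n i).
Proof.
elim: n => [|n IH]; first by exists i.
by rewrite -psi_corner; exact: VG_psiI.
Qed.

Lemma constant_reach (H : edges) x : sym_edges H ->
  constant_on H (fun z => `[< reach H x z >]).
Proof.
move=> sH u v huv; apply/asboolP/asboolP => h; apply: reach_trans h _;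
  apply: reach_edge => //; exact: sH.
Qed.

Lemma sem_level0 (c : sg 0) e : ty c = Some e -> sem c e.
Proof.
pose b : {ffun 'I_3 -> bool} := c.
have bE i j : i != j -> b (third i j) -> dec c (corner 0 i, corner 0 j).
  by move=> nij h; exists i, j.
have nc : ty c = Some e -> ~~ [&& b o0, b o1 & b o2].
  by rewrite /= -/b; case: ifP.
have Ee : ty c = Some e -> e = (b o0 || b o1 && b o2, b o1 || b o0 && b o2, b o2 || b o0 && b o1).
  by rewrite /= -/b; case: ifP => // _ [<-].
move=> te; have {Ee} := Ee te; have {nc te} nc := nc te => ee.
have cnE i j : i != j -> cn e i j = b (third i j) || b i && b j.
  rewrite ee; elim/I3_ind: i; elim/I3_ind: j => //= _; rewrite /cn /get /third /=;
  by case: (b o0); case: (b o1); case: (b o2).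
have corn (i j : 'I_3) : (corner 0 i == corner 0 j) = (i == j).
  by apply/eqP/eqP => [/corner_inj|->].
pose colb (i j p : 'I_3) := (p == i) || (p == third i j) && b j.
pose col (i j : 'I_3) (z : pt) := (z == corner 0 i) || (z == corner 0 (third i j)) && b j.
have colE i j p : col i j (corner 0 p) = colb i j p by rewrite /col !corn.
have colij i j : i != j -> colb i j i != colb i j j.
  by elim/I3_ind: i; elim/I3_ind: j => //= _; rewrite /colb /third /=.
have cut i j p q : i != j -> b (third i j) -> p != q -> b (third p q) ->
    (p, q) != (i, j) -> (p, q) != (j, i) -> colb i j p = colb i j q.
  move: nc; elim/I3_ind: i; elim/I3_ind: j => //=; elim/I3_ind: p; elim/I3_ind: q => //=;
  by rewrite /colb /third /=; case: (b o0); case: (b o1); case: (b o2).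
have sepa i j p q : i != j -> ~~ (b (third i j) || b i && b j) -> p != q -> b (third p q) ->
    colb i j p = colb i j q.
  elim/I3_ind: i; elim/I3_ind: j => //=; elim/I3_ind: p; elim/I3_ind: q => //=;
  by rewrite /colb /third /=; case: (b o0); case: (b o1); case: (b o2).
split.
- move=> x y [i [j [nij bk [-> ->]]]]; exists (col i j); split.
    by rewrite !colE; exact: colij.
  move=> u v [p [q [npq bpq [-> ->]]]] n1 n2; rewrite !colE; apply: cut => //.
    by apply/eqP => -[e1 e2]; apply: n1; rewrite e1 e2.
  by apply/eqP => -[e1 e2]; apply: n2; rewrite e1 e2.
- move=> i j nij; rewrite cnE //; split=> [r|/orP[h|/andP[h1 h2]]].
  + apply/negP => /negP nb; have : constant_on (dec c) (col i j).
      by move=> u v [p [q [npq bpq [-> ->]]]]; rewrite !colE; exact: sepa.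
    by move=> /reach_constant /(_ r) /eqP; rewrite !colE (negPf (colij _ _ nij)).
  + exact/reach_edge/bE.
  + case/andP: (third_neq nij) => n1 n2.
    apply: (@reach_trans _ _ (corner 0 (third i j))); apply/reach_edge/bE => //.
    * by rewrite eq_sym.
    * by rewrite thirdK.
    * by rewrite thirdC (thirdC i) thirdK // eq_sym.
- by move=> x [i _ <-]; exists i; exact: reach_refl.
Qed.

Lemma tyS n (c : sg n.+1) : ty c =
  match ty ((c : {ffun 'I_3 -> sg n}) o0), ty ((c : {ffun 'I_3 -> sg n}) o1),
        ty ((c : {ffun 'I_3 -> sg n}) o2) with
  | Some a, Some b, Some d => comb (a, b, d)
  | _, _, _ => None
  end.
Proof. by []. Qed.

Lemma ty_comb n (c : sg n.+1) f : ty c = Some f ->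
  exists e : ctype * ctype * ctype, (forall i, ty ((c : {ffun 'I_3 -> sg n}) i) = Some (tri e i)) /\ comb e = Some f.
Proof.
rewrite tyS; case e0 : (ty _) => [a|//]; case e1 : (ty _) => [b|//].
case e2 : (ty _) => [d|//] h; exists (a, b, d); split=> // i.
by elim/I3_ind: i.
Qed.

Lemma reach_direct n (c : sg n.+1) (e : ctype * ctype * ctype) i j : (forall i, sem (c i) (tri e i)) -> i != j ->
  direct e i j -> reach (dec c) (corner n.+1 i) (corner n.+1 j).
Proof.
move=> hs nij /andP[h1 h2]; rewrite -!psi_corner.
apply: (@reach_trans _ _ (psi n i (corner n j))).
  by apply: reach_psi; apply/(sem_cn (hs i)).
by rewrite psi_mid; apply: reach_psi; apply/(sem_cn (hs j)).
Qed.

Lemma reach_detour n (c : sg n.+1) (e : ctype * ctype * ctype) i j : (forall i, sem (c i) (tri e i)) -> i != j ->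
  detour e i j -> reach (dec c) (corner n.+1 i) (corner n.+1 j).
Proof.
move=> hs nij; case/andP: (third_neq nij); rewrite /detour; set k := third i j => nki nkj.
move=> /and3P[h1 h2 h3]; rewrite -!psi_corner.
apply: (@reach_trans _ _ (psi n i (corner n k))).
  by apply: reach_psi; apply/(sem_cn (hs i)); rewrite // eq_sym.
rewrite psi_mid; apply: (@reach_trans _ _ (psi n k (corner n j))).
  by apply: reach_psi; apply/(sem_cn (hs k)).
by rewrite psi_mid; apply: reach_psi; apply/(sem_cn (hs j)).
Qed.

Lemma cn_comb e f i j : i != j -> comb e = Some f -> cn f i j = direct e i j || detour e i j.
Proof.
rewrite /comb; case: ifP => // _ nij [<-].
have dC a b : direct e a b = direct e b a.
  by rewrite /direct /cn (thirdC b) andbC.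
have eC a b : detour e a b = detour e b a.
  by rewrite /detour /cn (thirdC b); set k := third a b; rewrite ![third _ k]thirdC;
    rewrite (thirdC b a); case: (tri _ (third k a)); case: (tri _ (third k b)); rewrite ?andbT ?andbF //.
move: nij; elim/I3_ind: i; elim/I3_ind: j => //= _; rewrite /cn /tri /third /=; by [|rewrite dC eC].
Qed.

Lemma comb_facts e f : comb e = Some f ->
  ~~ cyclic3 e /\ forall i j, i != j -> mid_covered e i j.
Proof.
rewrite /comb; case: ifP => // /and4P[h1 h2 h3 h4] _; split=> //.
have mC a b : a != b -> mid_covered e a b = mid_covered e b a.
  elim/I3_ind: a; elim/I3_ind: b => // _; rewrite /mid_covered /cn /third /=;
  move: e {h1 h2 h3 h4} => [[[[x1 x2] x3] [[y1 y2] y3]] [[z1 z2] z3]]; rewrite /tri /=;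
  by case: x1; case: x2; case: x3; case: y1; case: y2; case: y3; rewrite ?orbT ?andbT ?orbF ?andbF //=;
  case: z1; case: z2; case: z3.
by move=> i j; elim/I3_ind: i; elim/I3_ind: j => //= _; rewrite // mC.
Qed.

Lemma covered_reach n (c : sg n.+1) (e : ctype * ctype * ctype) i j : (forall i, sem (c i) (tri e i)) -> i != j ->
  mid_covered e i j -> exists l, reach (dec c) (psi n i (corner n j)) (corner n.+1 l).
Proof.
move=> hs nij; case/andP: (third_neq nij); rewrite /mid_covered; set k := third i j => nki nkj.
have nik : i != k by rewrite eq_sym.
have njk : j != k by rewrite eq_sym.
have nji : j != i by rewrite eq_sym.
have cC x a b : cn x a b = cn x b a by rewrite /cn thirdC.
have step a b d : b != d -> cn (tri e a) b d -> reach (dec c) (psi n a (corner n b)) (psi n a (corner n d)).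
  by move=> nbd h; apply: reach_psi; apply/(sem_cn (hs a)).
case/or4P => [h|h|/andP[h1 /orP[h2|/andP[h2 h3]]]|/andP[h1 /orP[h2|/andP[h2 h3]]]].
- by exists i; rewrite -psi_corner; apply: step; rewrite // cC.
- by exists j; rewrite psi_mid -psi_corner; apply: step.
- exists k; apply: (reach_trans (step _ _ _ njk h1)); rewrite psi_mid -psi_corner.
  by apply: step.
- exists j; apply: (reach_trans (step _ _ _ njk h1)); rewrite psi_mid.
  apply: (reach_trans (step _ _ _ nij h2)); rewrite psi_mid -psi_corner.
  by apply: step; rewrite // cC.
- exists k; rewrite psi_mid; apply: (reach_trans (step _ _ _ nik h1)); rewrite psi_mid -psi_corner.
  by apply: step.
- exists i; rewrite psi_mid; apply: (reach_trans (step _ _ _ nik h1)); rewrite psi_mid.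
  rewrite cC in h2; apply: (reach_trans (step _ _ _ nji h2)); rewrite psi_mid -psi_corner.
  by apply: step; rewrite // cC.
Qed.

Lemma cyclic3_sym (e : ctype * ctype * ctype) i j : i != j -> let k := third i j in
  cn (tri e i) j k -> cn (tri e j) i k -> cn (tri e k) i j -> cyclic3 e.
Proof.
by elim/I3_ind: i; elim/I3_ind: j => //= _; rewrite /cyclic3 /cn /third /= => -> -> ->.
Qed.

Lemma forest_glue n (c : sg n.+1) (e : ctype * ctype * ctype) : (forall i, sem (c i) (tri e i)) -> ~~ cyclic3 e ->
  forest (dec c).
Proof.
move=> hs nc x y [i [[x' y'] [hxy [-> ->]]]].
have [chi [cxy hchi]] := sem_forest (hs i) hxy.
have [hx hy] := dec_inV hxy.
suff [xi [xii xic xia]] : exists xi : 'I_3 -> pt -> bool,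
   [/\ cuts_only (dec (c i)) (xi i) x' y', forall j, j != i -> constant_on (dec (c j)) (xi j)
     & forall a b, xi a (corner n b) = xi b (corner n a)].
  have [cc hcc] := glue_colourings xia; case: xii => xiii xii.
  exists cc; split; first by rewrite !hcc.
  move=> u v [j [[u' v'] [huv [-> ->]]]] n1 n2; have [hu hv] := dec_inV huv.
  rewrite !hcc //; have [eji|nji] := eqVneq j i; last exact: xic huv.
  subst j; apply: xii => // -[e1 e2]; first by apply: n1; rewrite e1 e2.
  by apply: n2; rewrite e1 e2.
pose j := if i == o0 then o1 else o0.
have nij : i != j by rewrite /j; elim/I3_ind: i {hxy hchi j}.
case/andP: (third_neq nij); set k := third i j => nki nkj.
have nik : i != k by rewrite eq_sym.
have njk : j != k by rewrite eq_sym.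
have dist l : [\/ l = i, l = j | l = k].
  by rewrite /k; move: (j) nij; clear; move=> j; elim/I3_ind: i; elim/I3_ind: j;
   elim/I3_ind: l => //= _; rewrite /third /=; by [constructor 1|constructor 2|constructor 3].
have build (xi xj xk : pt -> bool) :
    cuts_only (dec (c i)) xi x' y' -> constant_on (dec (c j)) xj -> constant_on (dec (c k)) xk ->
    xi (corner n j) = xj (corner n i) -> xi (corner n k) = xk (corner n i) ->
    xj (corner n k) = xk (corner n j) -> exists xi : 'I_3 -> pt -> bool,
   [/\ cuts_only (dec (c i)) (xi i) x' y', forall j, j != i -> constant_on (dec (c j)) (xi j)
     & forall a b, xi a (corner n b) = xi b (corner n a)].
  move=> h1 h2 h3 h4 h5 h6.
  exists (fun l => if l == i then xi else if l == j then xj else xk).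
  rewrite !eqxx; split=> // [l nl|a b].
    rewrite (negPf nl); case: (dist l) => e1; subst l; first by rewrite eqxx in nl.
      by rewrite eqxx.
    by rewrite (negPf nkj).
  by case: (dist a) => ->; case: (dist b) => ->;
    rewrite ?eqxx ?(negPf nij) ?(negPf nik) ?(negPf njk) ?(negPf nki) ?(negPf nkj) ?[j == i]eq_sym ?(negPf nij).
have sj := @dec_sym _ (c j); have sk := @dec_sym _ (c k); have si := @dec_sym _ (c i).
have bT (P : Prop) : P -> `[< P >] = true by move=> ?; apply/asboolP.
have bF (P : Prop) : ~ P -> `[< P >] = false by move=> ?; apply/asboolP.
case hjj : (cn (tri e j) i k); last first.
  pose xj z := if `[< reach (dec (c j)) (corner n i) z >] then chi (corner n j) else chi (corner n k).
  apply: (@build chi xj (fun=> chi (corner n k))) => //.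
  - by move=> u v /(constant_reach (corner n i) sj) h; rewrite /xj h.
  - by rewrite /xj bT //; exact: reach_refl.
  - rewrite /xj bF // => /(sem_cn (hs j) nik); by rewrite hjj.
case hkk : (cn (tri e k) i j); last first.
  pose xk z := if `[< reach (dec (c k)) (corner n i) z >] then chi (corner n k) else chi (corner n j).
  apply: (@build chi (fun=> chi (corner n j)) xk) => //.
  - by move=> u v /(constant_reach (corner n i) sk) h; rewrite /xk h.
  - by rewrite /xk bT //; exact: reach_refl.
  - rewrite /xk bF // => /(sem_cn (hs k) nij); by rewrite hkk.
have hii : ~ reach (dec (c i)) (corner n j) (corner n k).
  by move=> /(sem_cn (hs i) njk) hi; move: nc; rewrite (cyclic3_sym nij hi).
have rxy : reach (dec (c i)) x' y' by exact: reach_edge.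
have mod d : cuts_only (dec (c i))
    (fun z => if `[< reach (dec (c i)) x' z >] then chi z else d) x' y'.
  split; first by rewrite !bT //; exact: reach_refl.
  move=> u v huv n1 n2; rewrite (constant_reach x' si huv).
  by case: ifP => // _; exact: hchi.
have [rj|rj] := pselect (reach (dec (c i)) x' (corner n j)).
  apply: (build _ (fun=> chi (corner n j)) (fun=> chi (corner n j)) (mod (chi (corner n j)))) => //.
    by rewrite (bT _ rj).
  rewrite bF // => rk; apply: hii; apply: reach_trans rk; exact: reach_sym.
apply: (build _ (fun=> chi (corner n k)) (fun=> chi (corner n k)) (mod (chi (corner n k)))) => //.
  by rewrite (bF _ rj).
by case: ifP.
Qed.

Lemma ty_sem n (c : sg n) e : ty c = Some e -> sem c e.
Proof.
elim: n c e => [|n IH] c f; first exact: sem_level0.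
move=> /ty_comb[e [hty cf]].
have hs i : sem ((c : {ffun 'I_3 -> sg n}) i) (tri e i) by apply: IH.
have [nc hcov] := comb_facts cf.
split; first exact: forest_glue nc.
- move=> i j nij; split=> [r|].
    apply/negP => /negP nf.
    have v3 : valid3 e by apply/and3P; split; [apply: (sem_valid (hs o0))|
      apply: (sem_valid (hs o1))|apply: (sem_valid (hs o2))].
    have [x [y [hr nxx]]] := comb_separates v3 cf nij nf.
    have [chi [hc hchi]] := colouring_ext hs hr.
    have kk l : chi (corner n.+1 l) = tri x l by rewrite -psi_corner hchi /kap eqxx.
    by move: nxx; rewrite -!kk (reach_constant hc r) eqxx.
  rewrite (cn_comb nij cf) => /orP[]; [exact: reach_direct | exact: reach_detour].
- move=> x /VG_psi[i [x' [hx ->]]]; have [j rj] := sem_cover (hs i) hx.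
  have r' := @reach_psi _ c _ _ _ rj.
  have [eij|nij] := eqVneq i j; first by exists i; rewrite -psi_corner {3}eij.
  have [l hl] := covered_reach hs nij (hcov _ _ nij); exists l; exact: reach_trans r' hl.
Qed.

Lemma sem_ty n (c : sg n) : forest (dec c) ->
  (forall x, VG n x -> exists i, reach (dec c) x (corner n i)) -> exists e, ty c = Some e.
Proof.
elim: n c => [|n IH] c hf hcov.
  pose b : {ffun 'I_3 -> bool} := c.
  rewrite /= -/b; case: ifP => [/and3P[b0 b1 b2]|]; last by eexists.
  have bE i j : i != j -> b (third i j) -> dec c (corner 0 i, corner 0 j).
    by move=> nij h; exists i, j.
  have [chi [hchi hc]] := hf _ _ (bE o0 o1 isT b2); case/negP: hchi.
  rewrite (hc _ _ (bE o0 o2 isT b1)) ?(hc _ _ (bE o2 o1 isT b0)) // => -[];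
   by do ?[move=> /corner_inj // | move=> _].
pose c' : {ffun 'I_3 -> sg n} := c.
have hfi i : forest (dec (c' i)).
  move=> x y hxy; have [chi [h1 h2]] := hf _ _ (@dec_psi _ c i _ _ hxy).
  exists (fun z => chi (psi n i z)); split=> // u v huv n1 n2.
  apply: h2; first exact: (@dec_psi _ c i _ _ huv).
    by move=> [/psi_inj e1 /psi_inj e2]; apply: n1; rewrite e1 e2.
  by move=> [/psi_inj e1 /psi_inj e2]; apply: n2; rewrite e1 e2.
have hci i x : VG n x -> exists j, reach (dec (c' i)) x (corner n j).
  move=> hx; apply/not_existsP => nr.
  have [j rj] := hcov _ (VG_psiI i hx).
  have hreg z : reach (dec c) (psi n i x) z -> exists y, [/\ inV n y, z = psi n i y & reach (dec (c' i)) x y].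
    apply: (@reach_rec (dec c) (fun z => exists y, [/\ inV n y, z = psi n i y & reach (dec (c' i)) x y])); last by exists x; split; [exact: VG_inV| |exact: reach_refl].
    move=> _ v [y [hy -> ry]] [l [[u' v'] [huv [eu ev]]]].
    have [hu hv] := dec_inV huv.
    case: (psi_meet hy hu eu) => [[eil eyu]|[_ ey _]]; last by case: (nr l); rewrite -ey.
    exists v'; split=> //=; first by rewrite ev eil.
    by apply: (reach_trans ry); apply: reach_edge; rewrite eyu eil.
  have [y [hy ey ry]] := hreg _ rj.
  move: ey; rewrite -psi_corner => ey.
  case: (psi_meet (inV_corner n j) hy ey) => [[_ e]|[_ _ e]]; last by case: (nr j); rewrite -e.
  by case: (nr j); rewrite e.
have P i : exists e, ty (c' i) = Some e := IH _ (hfi i) (hci i).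
have [e0 h0] := P o0; have [e1 h1] := P o1; have [e2 h2] := P o2.
pose e := (e0, e1, e2).
have hs i : sem (c' i) (tri e i).
  by apply: ty_sem; elim/I3_ind: i.
have v3 : valid3 e by apply/and3P; split; [apply: (sem_valid (hs o0))|
      apply: (sem_valid (hs o1))|apply: (sem_valid (hs o2))].
have cov i j : i != j -> mid_covered e i j.
  move=> nij; apply/negP => /negP nm.
  have [y [hr hy]] := uncovered_separates v3 nij nm.
  have [chi [hc hchi]] := @colouring_ext _ c _ _ _ hs hr.
  have [l rl] := hcov _ (VG_psiI i (VG_corner n j)).
  move: (reach_constant hc rl); rewrite hchi -psi_corner hchi /kap eqxx (negPf nij) hy.
  by elim/I3_ind: l {rl}.
have nc : ~~ cyclic3 e.
  apply/negP => /and3P[k0 k1 k2].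
  have r0 : reach (dec (c' o0)) (corner n o1) (corner n o2) by apply/(sem_cn (hs o0)).
  have [|z hz hsep] := forest_separates (hfi o0) r0.
    by apply/eqP => /corner_inj.
  have [chi [cxz hchi]] := hf _ _ (@dec_psi _ c o0 _ _ hz).
  have hzV := (dec_inV hz).2.
  have cellc l u v : l != o0 -> reach (dec (c' l)) u v -> chi (psi n l u) = chi (psi n l v).
    move=> nl; apply: (reach_constant (c := fun p => chi (psi n l p))) => {}u {}v huv.
    have [hu hv] := dec_inV huv.
    apply: hchi; first exact: (@dec_psi _ c l _ _ huv).
      move=> [e1' e2']; case: (psi_meet hu (inV_corner n o1) e1') => [[el]|[_ eu _]].
        by rewrite el eqxx in nl.
      case: (psi_meet hv hzV e2') => [[el]|[_ ev _]]; first by rewrite el eqxx in nl.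
      by move: huv; rewrite eu ev => /dec_loopless.
    move=> [e1' e2']; case: (psi_meet hv (inV_corner n o1) e2') => [[el]|[_ eu _]].
      by rewrite el eqxx in nl.
    case: (psi_meet hu hzV e1') => [[el]|[_ ev _]]; first by rewrite el eqxx in nl.
    by move: huv; rewrite eu ev => /dec_loopless.
  have cut0 : cuts_only (dec (c' o0)) (fun p => chi (psi n o0 p)) (corner n o1) z.
    split=> // u v huv n1 n2; apply: hchi; first exact: (@dec_psi _ c o0 _ _ huv).
      by move=> [/psi_inj e1' /psi_inj e2']; apply: n1; rewrite e1' e2'.
    by move=> [/psi_inj e1' /psi_inj e2']; apply: n2; rewrite e1' e2'.
  case/negP: (hsep _ cut0); rewrite psi_mid (psi_mid n o0 o2).
  have r1 : reach (dec (c' o1)) (corner n o0) (corner n o2) by apply/(sem_cn (hs o1)).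
  have r2 : reach (dec (c' o2)) (corner n o0) (corner n o1) by apply/(sem_cn (hs o2)).
  by rewrite (cellc o1 _ _ isT r1) (cellc o2 _ _ isT r2) (psi_mid n o1 o2).
by eexists; rewrite tyS -/c' h0 h1 h2 /comb nc !cov.
Qed.

(** * Paths in trees *)

Definition TT : ctype := (true, true, true).

Lemma spanning_treeP n H :
  spanning_tree n H <-> exists2 c : sg n, ty c = Some TT & dec c = H.
Proof.
split=> [[sub acH con]|[c tc <-]].
  have [c hc] := dec_surj sub; exists c => //.
  have sH := @dec_sym _ c; have lH := @dec_loopless _ c.
  rewrite -hc in acH con; move/(acyclicP sH lH): acH => fH.
  have [e te] : exists e, ty c = Some e.
    by apply: sem_ty => // x hx; exists o0; apply: con => //; exact: VG_corner.
  rewrite te; congr Some.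
  have h i j : i != j -> cn e i j.
    by move=> nij; apply/(sem_cn (ty_sem te)) => //; apply: con; exact: VG_corner.
  move: (h o0 o1 isT) (h o0 o2 isT) (h o1 o2 isT); rewrite /cn /third /tri /=.
  by case: e {te h} => [[? ?] ?] /= -> -> ->.
have sH := @dec_sym _ c; have lH := @dec_loopless _ c.
have [fH hcn cov] := ty_sem tc; split; [exact: dec_subgraph|exact/acyclicP|].
move=> x y /cov[i ri] /cov[j rj].
apply: (reach_trans ri); apply: reach_trans (reach_sym sH rj).
have [->|nij] := eqVneq i j; first exact: reach_refl.
apply/hcn => //; rewrite /cn /TT; by elim/I3_ind: i {ri nij}; elim/I3_ind: j {rj}.
Qed.

Definition cnc n (c : sg n) i j := if ty c is Some e then cn e i j else false.
Definition dirc n (c : {ffun 'I_3 -> sg n}) i j := cnc (c i) i j && cnc (c j) i j.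

Fixpoint wk (n : nat) : sg n -> 'I_3 -> 'I_3 -> seq pt :=
  match n return sg n -> 'I_3 -> 'I_3 -> seq pt with
  | 0 => fun (c : {ffun 'I_3 -> bool}) i j =>
    if c (third i j) then [:: corner 0 j] else [:: corner 0 (third i j); corner 0 j]
  | m.+1 => fun (c : {ffun 'I_3 -> sg m}) i j =>
    let k := third i j in
    if dirc c i j then map (psi m i) (wk (c i) i j) ++ map (psi m j) (wk (c j) i j)
    else map (psi m i) (wk (c i) i k) ++ map (psi m k) (wk (c k) i j)
           ++ map (psi m j) (wk (c j) k j)
  end.

Lemma path_psi n (c : sg n.+1) i x s :
  path (adj (dec ((c : {ffun 'I_3 -> sg n}) i))) x s ->
  path (adj (dec c)) (psi n i x) (map (psi n i) s).
Proof.
elim: s x => //= y s IH x /andP[/asboolP h /IH ->]; rewrite andbT.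
by apply/asboolP; exact: (@dec_psi _ c).
Qed.

Lemma path_dec_inV n (c : sg n) x s y : inV n x -> path (adj (dec c)) x s ->
  y \in x :: s -> inV n y.
Proof.
elim: s x => [|z s IH] x hx /=; first by rewrite inE => _ /eqP ->.
move=> /andP[/asboolP h ps]; rewrite inE => /predU1P[->//|].
by apply: IH => //; have [] := dec_inV h.
Qed.

Lemma path_reach H x s y : path (adj H) x s -> y \in x :: s ->
  reach H x y /\ reach H y (last x s).
Proof.
elim: s x => [|z s IH] x /=; first by rewrite inE => _ /eqP ->; split; exact: reach_refl.
move=> /andP[/asboolP h ps]; rewrite inE => /predU1P[->|/(IH _ ps)[h1 h2]].
  by split; [exact: reach_refl | exists (z :: s); rewrite /= ps andbT; split=> //; apply/asboolP].
by split=> //; apply: reach_trans h1; exact: reach_edge.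
Qed.

Lemma wk_saw n (c : sg n) e i j : ty c = Some e -> i != j -> cn e i j ->
  saw (dec c) (corner n i) (corner n j) (wk c i j).
Proof.
elim: n c e i j => [|n IH] c e i j tc nij cij.
  pose b : {ffun 'I_3 -> bool} := c.
  have bE p q : p != q -> b (third p q) -> adj (dec c) (corner 0 p) (corner 0 q).
    by move=> npq h; apply/asboolP; exists p, q.
  case/andP: (third_neq nij) => n1 n2.
  have nc p q : p != q -> corner 0 p != corner 0 q.
    by apply: contra => /eqP /corner_inj ->.
  rewrite /= -/b; case: ifP => h.
    by split=> //=; rewrite ?andbT ?bE // inE nc.
  have [bi bj] : b i /\ b j.
    move: tc; rewrite /= -/b; case: ifP => // _ [ee]; move: cij; rewrite -ee /cn.
    by move: nij h; elim/I3_ind: i {n1 n2}; elim/I3_ind: j; rewrite //= /third /tri /= => _ ->;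
      case: (b o0) => //; case: (b o1) => //; case: (b o2).
  split=> //=.
    rewrite !bE //= ?thirdK //; first by rewrite thirdC (thirdC i) thirdK // eq_sym.
    by rewrite eq_sym.
  by rewrite !inE !negb_or /= !nc // eq_sym.
have [t [ht ct]] := ty_comb tc.
pose c' : {ffun 'I_3 -> sg n} := c.
have cncE l p q : cnc (c' l) p q = cn (tri t l) p q by rewrite /cnc ht.
have {}IH l p q : p != q -> cnc (c' l) p q ->
   saw (dec (c' l)) (corner n p) (corner n q) (wk (c' l) p q).
  by move=> npq; rewrite cncE; apply: IH.
have hd : dirc c' i j = direct t i j by rewrite /dirc !cncE.
have nap l p q r : p != q -> cnc (c' l) p q -> r \in wk (c' l) p q -> inV n r /\ r != corner n p.
  move=> npq /(IH _ _ _ npq)[h1 _ /= /andP[h2 _]] hr; split.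
    by apply: path_dec_inV (inV_corner n p) h1 _; rewrite inE hr orbT.
  by apply: contra h2 => /eqP <-.
have nap' l p q r : p != q -> cnc (c' l) p q -> r \in corner n p :: wk (c' l) p q -> inV n r.
  by move=> npq h; rewrite inE => /predU1P[->|/(nap _ _ _ _ npq h)[]//]; exact: inV_corner.
have uu (x : pt) s : uniq (x :: s) -> uniq s by case/andP.
rewrite /= -/c'; case: ifP => [/andP[d1 d2]|nd].
  have [p1 l1 u1] := IH _ _ _ nij d1; have [p2 l2 u2] := IH _ _ _ nij d2.
  rewrite -!psi_corner; split.
  - by rewrite cat_path (@path_psi _ c _ _ _ p1) last_map l1 psi_mid (@path_psi _ c _ _ _ p2).
  - by rewrite last_cat last_map l1 psi_mid last_map l2.
  - rewrite -cat_cons -map_cons cat_uniq !(map_inj_uniq (@psi_inj _ _)) u1 (uu _ _ u2) andbT andTb.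
    apply/hasPn => _ /mapP[q hq ->]; apply/negP => /mapP[p hp e'].
    have [hqV nq] := nap _ _ _ _ nij d2 hq.
    case: (psi_meet hqV (nap' _ _ _ _ nij d1 hp) e') => [[eji]|[_ eq _]].
      by rewrite eji eqxx in nij.
    by rewrite eq eqxx in nq.
move: cij; rewrite (cn_comb nij ct) -hd nd /= => /and3P.
case/andP: (third_neq nij); set k := third i j => nki nkj.
have nik : i != k by rewrite eq_sym.
have njk : j != k by rewrite eq_sym.
rewrite -!cncE => -[d1 d2 d3].
have [p1 l1 u1] := IH _ _ _ nik d1; have [p2 l2 u2] := IH _ _ _ nij d2.
have [p3 l3 u3] := IH _ _ _ nkj d3.
rewrite -!psi_corner; split.
- rewrite cat_path (@path_psi _ c _ _ _ p1) last_map l1 psi_mid cat_path (@path_psi _ c _ _ _ p2).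
  by rewrite last_map l2 psi_mid (@path_psi _ c _ _ _ p3).
- by rewrite !last_cat last_map l1 psi_mid last_map l2 psi_mid last_map l3.
- rewrite -cat_cons -map_cons cat_uniq (cat_uniq (map _ (wk _ _ _))) !(map_inj_uniq (@psi_inj _ _)).
  rewrite u1 (uu _ _ u2) (uu _ _ u3) !andbT !andTb.
  apply/andP; split; last first.
    apply/hasPn => _ /mapP[q hq ->]; apply/negP => /mapP[p hp e'].
    have [hqV nq] := nap _ _ _ _ nkj d3 hq.
    case: (psi_meet hqV (nap _ _ _ _ nij d2 hp).1 e') => [[ejk]|[_ eq _]].
      by rewrite ejk eqxx in njk.
    by rewrite eq eqxx in nq.
  apply/hasPn => q0; rewrite mem_cat => /orP[/mapP[q hq ->]|/mapP[q hq ->]]; apply/negP => /mapP[p hp e'].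
    have [hqV nq] := nap _ _ _ _ nij d2 hq.
    case: (psi_meet hqV (nap' _ _ _ _ nik d1 hp) e') => [[eki]|[_ eq _]].
      by rewrite eki eqxx in nki.
    by rewrite eq eqxx in nq.
  have [hqV nq] := nap _ _ _ _ nkj d3 hq.
  case: (psi_meet hqV (nap' _ _ _ _ nik d1 hp) e') => [[eji]|[_ eq ep]].
    by rewrite eji eqxx in nij.
  have [r1 _] := path_reach p1 hp.
  have hq' : q \in corner n k :: wk (c' j) k j by rewrite inE hq orbT.
  have [_ r2] := path_reach p3 hq'; rewrite l3 eq in r2; rewrite ep in r1.
  have s l := ty_sem (ht l).
  move: nd; rewrite hd /direct.
  by move/(sem_cn (s i) nij): r1 => ->; move/(sem_cn (s j) nij): r2 => ->.
Qed.

Lemma walk_tree n (c : sg n) : ty c = Some TT ->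
  walk (dec c) (corner n o0) (corner n o1) = corner n o0 :: wk c o0 o1.
Proof.
move=> tc; rewrite /walk; congr cons.
have h : saw (dec c) (corner n o0) (corner n o1) (wk c o0 o1) by exact: wk_saw tc _ _.
by case: xgetP => [s _ hs|/(_ _ h)//]; apply: saw_unique hs h; exact: sem_forest (ty_sem tc).
Qed.

(** * Counting *)

Lemma sum_ffun3 (R : realType) (A : finType) i j (F : A -> A -> A -> R) : i != j ->
  \sum_(c : {ffun 'I_3 -> A}) F (c i) (c (third i j)) (c j) =
  \sum_x \sum_y \sum_z F x y z.
Proof.
move=> nij; case/andP: (third_neq nij); set k := third i j => nki nkj.
pose h (p : A * (A * A)) : {ffun 'I_3 -> A} :=
  [ffun l => if l == i then p.1 else if l == j then p.2.2 else p.2.1].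
rewrite (reindex h) /=; last first.
  apply: onW_bij; exists (fun c : {ffun 'I_3 -> A} => (c i, (c k, c j))).
    move=> [x [y z]]; rewrite /h !ffunE /= !eqxx (negPf nki) (negPf nkj).
    by rewrite eq_sym (negPf nij).
  move=> c; apply/ffunP => l; rewrite ffunE /=.
  case: eqVneq => [->//|nli]; case: eqVneq => [->//|nlj].
  congr (c _); rewrite /k; move: nij nli nlj; clear; elim/I3_ind: i; elim/I3_ind: j => //= _;
  by elim/I3_ind: l.
rewrite -(pair_bigA _ (fun x (p : A * A) => F (h (x, p) i) (h (x, p) k) (h (x, p) j))) /=.
apply: eq_bigr => x _.
rewrite -(pair_bigA _ (fun y z => F (h (x, (y, z)) i) (h (x, (y, z)) k) (h (x, (y, z)) j))) /=.
apply: eq_bigr => y _; apply: eq_bigr => z _; rewrite /h !ffunE /= !eqxx (negPf nki) (negPf nkj).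
by rewrite eq_sym (negPf nij).
Qed.

Definition Ex (R : realType) n e (phi : sg n -> R) := \sum_(c : sg n | ty c == Some e) phi c.

Definition vtypes : seq ctype := [seq e <- ctypes | valid e].
Definition configs (f : ctype) : seq (ctype * ctype * ctype) :=
  [seq t <- [seq (p, b) | p <- [seq (a, b) | a <- vtypes, b <- vtypes], b <- vtypes]
   | comb t == Some f].

Lemma configsP f t : t \in configs f = (comb t == Some f) && valid3 t.
Proof.
rewrite mem_filter; congr andb; case: t => [[a b] d].
rewrite -[valid3 _]/([&& valid a, valid b & valid d]); apply/idP/idP.
  case/allpairsP=> -[p u] [hp hu [ep eu]].
  have {}hp : p \in [seq (a, b) | a <- vtypes, b <- vtypes] by [].
  have {}hu : u \in vtypes by [].
  case/allpairsP: hp => -[v w] [hv hw e].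
  have {}hv : v \in vtypes by []. have {}hw : w \in vtypes by [].
  have [-> -> ->] : [/\ a = v, b = w & d = u].
    by move: ep; rewrite /= e => -[-> ->]; rewrite eu.
  by move: hv hw hu; rewrite !mem_filter => /andP[-> _] /andP[-> _] /andP[-> _].
have mem e : valid e -> e \in vtypes by rewrite mem_filter mem_ctypes andbT.
move=> /and3P[/mem ha /mem hb /mem hd]; apply/allpairsP; exists ((a, b), d).
by split=> //; apply/allpairsP; exists (a, b).
Qed.

Lemma configs_uniq f : uniq (configs f).
Proof. by apply: filter_uniq; vm_compute. Qed.

Lemma ExE (R : realType) n e (phi : sg n -> R) :
  Ex e phi = \sum_(c : sg n) (if ty c == Some e then phi c else 0).
Proof. by rewrite /Ex big_mkcond. Qed.

Lemma Ex_split (R : realType) n f i j (phi : sg n.+1 -> R) (F : sg n -> sg n -> sg n -> R) :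
  i != j ->
  (forall c : {ffun 'I_3 -> sg n}, phi c = F (c i) (c (third i j)) (c j)) ->
  Ex f phi = \sum_(t <- configs f) Ex (tri t i) (fun x => Ex (tri t (third i j)) (fun y =>
     Ex (tri t j) (fun z => F x y z))).
Proof.
move=> nij hphi; set k := third i j.
pose tyt (c : sg n.+1) : ctype * ctype * ctype :=
  let c' : {ffun 'I_3 -> sg n} := c in
  (odflt TT (ty (c' o0)), odflt TT (ty (c' o1)), odflt TT (ty (c' o2))).
have tytE (c : sg n.+1) : ty c == Some f -> forall l, ty ((c : {ffun 'I_3 -> sg n}) l) = Some (tri (tyt c) l).
  by move=> /eqP /ty_comb[e [h _]] l; elim/I3_ind: l; rewrite /tyt /tri /= h.
rewrite /Ex (partition_big tyt (fun t => t \in configs f)); last first.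
  move=> c hc; have h := tytE _ hc; rewrite configsP; apply/andP; split.
    by move: hc; rewrite tyS (h o0) (h o1) (h o2).
  by apply/and3P; split; [apply: (sem_valid (ty_sem (h o0)))|
      apply: (sem_valid (ty_sem (h o1)))|apply: (sem_valid (ty_sem (h o2)))].
rewrite [RHS](big_uniq _ (configs_uniq f)).
apply: eq_bigr => t; rewrite configsP => /andP[/eqP ct _].
transitivity (\sum_(c : {ffun 'I_3 -> sg n})
   (if ty (c i) == Some (tri t i) then if ty (c k) == Some (tri t k) then
     if ty (c j) == Some (tri t j) then F (c i) (c k) (c j) else 0 else 0 else 0)).
  rewrite big_mkcond; apply: eq_bigr => c _; rewrite hphi -/k.
  have -> : (ty (c : sg n.+1) == Some f) && (tyt c == t) =
    [&& ty (c i) == Some (tri t i), ty (c k) == Some (tri t k) & ty (c j) == Some (tri t j)].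
    apply/andP/and3P => [[h1 /eqP <-]|[/eqP h1 /eqP h2 /eqP h3]].
      by rewrite !(tytE _ h1).
    have h l : ty (c l) = Some (tri t l).
      have [->|->|->] // : [\/ l = i, l = j | l = k].
      rewrite /k; move: nij; clear; elim/I3_ind: i; elim/I3_ind: j;
       elim/I3_ind: l => //= _; rewrite /third /=; by [constructor 1|constructor 2|constructor 3].
    rewrite tyS !h -ct /=; split; first by case: t {ct h1 h2 h3 h} => [[]].
    by rewrite /tyt !h; case: t {ct h1 h2 h3 h} => [[]].
  by case: (ty (c i) == _) => //=; case: (ty (c k) == _).
rewrite (@sum_ffun3 R _ i j (fun x y z => if ty x == Some (tri t i) then if ty y == Some (tri t k) then
     if ty z == Some (tri t j) then F x y z else 0 else 0 else 0)) //.
rewrite [RHS]big_mkcond; apply: eq_bigr => x _; case: ifP => _; last by rewrite big1 // => ? _; rewrite big1.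
rewrite [RHS]big_mkcond; apply: eq_bigr => y _; case: ifP => _; last by rewrite big1.
by rewrite [RHS]big_mkcond.
Qed.

Lemma eq_Ex (R : realType) n e (phi psi : sg n -> R) :
  (forall c, ty c = Some e -> phi c = psi c) -> Ex e phi = Ex e psi.
Proof. by move=> h; apply: eq_bigr => c /eqP /h. Qed.

Lemma ler_Ex (R : realType) n e (phi psi : sg n -> R) :
  (forall c, ty c = Some e -> phi c <= psi c) -> Ex e phi <= Ex e psi.
Proof. by move=> h; apply: ler_sum => c /eqP /h. Qed.

Lemma Ex_ge0 (R : realType) n e (phi : sg n -> R) :
  (forall c, ty c = Some e -> 0 <= phi c) -> 0 <= Ex e phi.
Proof. by move=> h; apply: sumr_ge0 => c /eqP /h. Qed.

Lemma ExMl (R : realType) n e (phi : sg n -> R) a : Ex e (fun c => a * phi c) = a * Ex e phi.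
Proof. by rewrite /Ex mulr_sumr. Qed.

Lemma ExMr (R : realType) n e (phi : sg n -> R) a : Ex e (fun c => phi c * a) = Ex e phi * a.
Proof. by rewrite /Ex mulr_suml. Qed.

Definition Nn (R : realType) n e : R := Ex (n := n) e (fun=> 1).

Fixpoint trn (R : realType) (n : nat) : R * R * R :=
  if n is m.+1 then
    let: (t, s, r) := trn R m in
    (6 * t ^+ 2 * s, 7 * t * s ^+ 2 + t ^+ 2 * r, 14 * s ^+ 3 + 12 * t * s * r)
  else (3, 1, 1).
Definition tau (R : realType) n : R := (trn R n).1.1.
Definition sig (R : realType) n : R := (trn R n).1.2.
Definition rho (R : realType) n : R := (trn R n).2.
Arguments tau : clear implicits. Arguments sig : clear implicits. Arguments rho : clear implicits.

Lemma trn_rel (R : realType) n :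
  [/\ 0 < tau R n, 0 < sig R n, 0 < rho R n & tau R n * rho R n = 3 * sig R n ^+ 2].
Proof.
rewrite /tau /sig /rho; elim: n => [|n [/=]]; first by rewrite /=; split; lra.
case: (trn R n) => [[t s] r] /= t0 s0 r0 h; split.
- by rewrite !mulr_gt0 // exprn_gt0.
- by rewrite addr_gt0 // !mulr_gt0 // exprn_gt0.
- by rewrite addr_gt0 // !mulr_gt0 // exprn_gt0.
- have -> : 6 * t ^+ 2 * s * (14 * s ^+ 3 + 12 * t * s * r) =
     84 * t ^+ 2 * s ^+ 4 + 72 * t ^+ 2 * s ^+ 2 * (t * r) by ring.
  have -> : 7 * t * s ^+ 2 + t ^+ 2 * r = 7 * t * s ^+ 2 + t * (t * r) by ring.
  by rewrite h; ring.
Qed.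

Lemma trnS (R : realType) n : [/\ tau R n.+1 = 6 * tau R n ^+ 2 * sig R n,
  sig R n.+1 = 10 * tau R n * sig R n ^+ 2,
  sig R n.+1 = 7 * tau R n * sig R n ^+ 2 + tau R n ^+ 2 * rho R n
  & rho R n.+1 = 14 * sig R n ^+ 3 + 12 * tau R n * sig R n * rho R n].
Proof.
have [_ _ _] := trn_rel R n.
rewrite /tau /sig /rho /=; case: (trn R n) => [[t s] r] /= h; split=> //.
have -> : t ^+ 2 * r = t * (t * r) by ring.
by rewrite h; ring.
Qed.

Definition byt (R : Type) (e : ctype) (t s r : R) :=
  if e == TT then t else if e == (false, false, false) then r else s.

Ltac expand_configs := match goal with |- context [configs ?f] =>
  let l := eval vm_compute in (configs f) in change (configs f) with l end;
  rewrite !big_cons big_nil /=.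

Lemma Ex0 (R : realType) e (phi : sg 0 -> R) (F : bool -> bool -> bool -> R) :
  (forall c : {ffun 'I_3 -> bool}, (if ty (c : sg 0) == Some e then phi c else 0) = F (c o0) (c o1) (c o2)) ->
  Ex e phi = \sum_x \sum_y \sum_z F x y z.
Proof.
move=> h; rewrite ExE -(@sum_ffun3 R _ o0 o2 F isT).
by apply: eq_bigr => c _; rewrite -h.
Qed.

Lemma Ex_const (R : realType) n e (a : R) : Ex (n := n) e (fun=> a) = Nn R n e * a.
Proof. by rewrite /Nn -ExMr; apply: eq_Ex => c _; rewrite mul1r. Qed.

Lemma NnE (R : realType) n e : valid e -> Nn R n e = byt e (tau R n) (sig R n) (rho R n).
Proof.
elim: n e => [|n IH] e ve.
  rewrite /Nn (@Ex0 _ _ _ (fun a b d =>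
    if (if [&& a, b & d] then None else Some (a || b && d, b || a && d, d || a && b)) == Some e
    then 1 else 0)) //.
  rewrite /byt /tau /sig /rho /=; rewrite !big_bool /=.
  by move: e ve => [[[] []] []] //= _; rewrite /eq_op /= /eq_op /= /eq_op /=; ring.
rewrite {1}/Nn (@Ex_split _ _ _ o0 o2 _ (fun _ _ _ => 1)) //.
have [h1 _ h2 h3] := trnS R n.
rewrite (eq_big_seq (fun t : ctype * ctype * ctype =>
   byt (tri t o0) (tau R n) (sig R n) (rho R n) * byt (tri t o1) (tau R n) (sig R n) (rho R n) *
   byt (tri t o2) (tau R n) (sig R n) (rho R n))); last first.
  move=> t; rewrite configsP => /andP[_ /and3P[v0 v1 v2]].
  by rewrite -!IH // !Ex_const mulr1 mulrA.
by move: e ve => [[[] []] []] // _; expand_configs; rewrite /byt /tri /= ?h1 ?h2 ?h3;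
 rewrite /eq_op /= /eq_op /= /eq_op /=; ring.
Qed.

(** * Generating function of the path length *)

Definition mgf (R : realType) (x : R) n e i j := Ex (n := n) e (fun c => x ^+ size (wk c i j)).

Lemma eq_configs (R : realType) f (F G : ctype * ctype * ctype -> R) :
  (forall t, comb t = Some f -> valid3 t -> F t = G t) ->
  \sum_(t <- configs f) F t = \sum_(t <- configs f) G t.
Proof. by move=> h; apply: eq_big_seq => t; rewrite configsP => /andP[/eqP ? ?]; exact: h. Qed.

Lemma le_configs (R : realType) f (F G : ctype * ctype * ctype -> R) :
  (forall t, comb t = Some f -> valid3 t -> F t <= G t) ->
  \sum_(t <- configs f) F t <= \sum_(t <- configs f) G t.
Proof.
move=> h; rewrite big_seq [leRHS]big_seq; apply: ler_sum => t.
by rewrite configsP => /andP[/eqP ? ?]; exact: h.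
Qed.

Lemma Ex3_prod (R : realType) n e1 e2 e3 (a b d : sg n -> R) :
  Ex e1 (fun x => Ex e2 (fun y => Ex e3 (fun z => a x * b y * d z))) = Ex e1 a * Ex e2 b * Ex e3 d.
Proof.
rewrite -!ExMr; apply: eq_Ex => x _.
by rewrite -[a x * Ex e2 b]ExMl -ExMr; apply: eq_Ex => y _; rewrite ExMl.
Qed.

Lemma mgfS (R : realType) (x : R) n f i j : i != j -> mgf x n.+1 f i j =
  \sum_(t <- configs f) if direct t i j
    then mgf x n (tri t i) i j * Nn R n (tri t (third i j)) * mgf x n (tri t j) i j
    else mgf x n (tri t i) i (third i j) * mgf x n (tri t (third i j)) i j
           * mgf x n (tri t j) (third i j) j.
Proof.
move=> nij; set k := third i j.
rewrite /mgf (@Ex_split _ _ _ i j _ (fun a b d => if cnc a i j && cnc d i j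
  then x ^+ size (wk a i j) * 1 * x ^+ size (wk d i j)
  else x ^+ size (wk a i k) * x ^+ size (wk b i j) * x ^+ size (wk d k j))) //; last first.
  move=> c /=; rewrite /dirc; case: ifP => _.
    by rewrite size_cat !size_map exprD mulr1.
  by rewrite !size_cat !size_map !exprD mulrA.
apply: eq_configs => t _ _; rewrite -/k.
transitivity (Ex (tri t i) (fun a : sg n => Ex (tri t k) (fun b : sg n => Ex (tri t j) (fun d : sg n =>
  if direct t i j then x ^+ size (wk a i j) * 1 * x ^+ size (wk d i j)
  else x ^+ size (wk a i k) * x ^+ size (wk b i j) * x ^+ size (wk d k j))))).
  apply: eq_Ex => a ha; apply: eq_Ex => b hb; apply: eq_Ex => d hd.
  by rewrite /cnc ha hd /direct.
by case: (direct t i j); rewrite Ex3_prod.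
Qed.

Definition mgf_bound (R : realType) (x : R) n (X Y : R) := forall e i j,
  i != j -> valid e -> cn e i j -> mgf x n e i j <= Nn R n e * (if e == TT then X else Y).

Lemma mgf_bound0 (R : realType) (x X Y : R) : 0 < x ->
  2 * x + x ^+ 2 <= 3 * X -> x <= Y -> mgf_bound x 0 X Y.
Proof.
move=> x0 h0 h0' e i j nij ve cij.
rewrite NnE // /mgf (@Ex0 _ _ _ (fun a b d =>
  if (if [&& a, b & d] then None else Some (a || b && d, b || a && d, d || a && b)) == Some e
  then x ^+ (if tri (a, b, d) (third i j) then 1 else 2) else 0)).
rewrite /byt /tau /sig /rho /=; rewrite !big_bool /=.
move: nij cij.
  by elim/I3_ind: i; elim/I3_ind: j => // _; move: e ve => [[[] []] []] //=;
    rewrite /cn /third /tri /= => _ // _; rewrite /eq_op /= /eq_op /= /eq_op /=; lra.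
move=> c /=; case: ifP => // _; congr (_ ^+ _).
by rewrite /tri; elim/I3_ind: (third i j) => /=; case: ifP.
Qed.

Lemma mgf_boundS (R : realType) (x X Y X' Y' : R) n : 0 < x -> 0 <= X -> 0 <= Y ->
  Y * X ^+ 2 + Y * X + X ^+ 2 <= 3 * X' ->
  3 * X ^+ 2 + Y ^+ 2 + 2 * X * Y ^+ 2 + 4 * X * Y <= 10 * Y' ->
  mgf_bound x n X Y -> mgf_bound x n.+1 X' Y'.
Proof.
move=> x0 X0 Y0 hX hY IH e i j nij ve cij.
have [t1 s1 r1 _] := trn_rel R n.
rewrite mgfS //; set k := third i j; case/andP: (third_neq nij); rewrite -/k => nki nkj.
have nik : i != k by rewrite eq_sym.
pose Z e := if e == TT then X else Y.
have Z0 e' : 0 <= Z e' by rewrite /Z; case: ifP.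
have N0 e' : 0 <= Nn R n e' by apply: Ex_ge0.
have M0 e' a b : 0 <= mgf x n e' a b by apply: Ex_ge0 => c _; rewrite exprn_ge0 // ltW.
apply: (@le_trans _ _ (\sum_(t <- configs e)
   Nn R n (tri t i) * Nn R n (tri t k) * Nn R n (tri t j) *
   (if direct t i j then Z (tri t i) * Z (tri t j)
    else Z (tri t i) * Z (tri t k) * Z (tri t j)))).
  apply: le_configs => t ct /and3P[v0 v1 v2].
  have vt l : valid (tri t l) by elim/I3_ind: l.
  case: ifP => hd.
    have /andP[d1 d2] := hd.
    rewrite [leRHS](_ : _ = Nn R n (tri t i) * Z (tri t i) * Nn R n (tri t k) * (Nn R n (tri t j) * Z (tri t j))); last by ring.
    by rewrite !ler_pM ?mulr_ge0 ?IH.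
  move: cij; rewrite (cn_comb nij ct) hd /= => /and3P[d1 d2 d3].
  rewrite [leRHS](_ : _ = Nn R n (tri t i) * Z (tri t i) * (Nn R n (tri t k) * Z (tri t k)) * (Nn R n (tri t j) * Z (tri t j))); last by ring.
  by rewrite !ler_pM ?mulr_ge0 ?IH.
rewrite (@eq_configs _ _ _ (fun t => byt (tri t i) (tau R n) (sig R n) (rho R n) *
   byt (tri t k) (tau R n) (sig R n) (rho R n) * byt (tri t j) (tau R n) (sig R n) (rho R n) *
   (if direct t i j then Z (tri t i) * Z (tri t j)
    else Z (tri t i) * Z (tri t k) * Z (tri t j)))); last first.
  move=> t _ /and3P[v0 v1 v2]; have vt l : valid (tri t l) by elim/I3_ind: l.
  by rewrite !NnE.
have [q1 q2 q3 _] := trnS R n; have [_ _ _ q4] := trn_rel R n.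
rewrite NnE //.
move: (tau R n) (sig R n) (rho R n) t1 s1 r1 q1 q2 q3 q4 => t s r t1 s1 r1 q1 q2 q3 q4.
have hX' := ler_wpM2l (mulr_ge0 (mulr_ge0 (ler0n R 2) (sqr_ge0 t)) (ltW s1)) hX.
have hY' := ler_wpM2l (mulr_ge0 (ltW t1) (sqr_ge0 s)) hY.
have q5 : t ^+ 2 * r = 3 * t * s ^+ 2 by rewrite expr2 -mulrA q4; ring.
have fT : 2 * t ^+ 2 * s * (Y * X ^+ 2 + Y * X + X ^+ 2) <= tau R n.+1 * X'.
  by rewrite q1; apply: le_trans hX' _; rewrite le_eqVlt; apply/orP; left; apply/eqP; ring.
have fS : t * s ^+ 2 * (Y ^+ 2 + 2 * X * Y ^+ 2 + 4 * X * Y) + t ^+ 2 * r * X ^+ 2 <= sig R n.+1 * Y'.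
  by rewrite q5 q2; apply: le_trans (le_trans hY' _); rewrite le_eqVlt; apply/orP; left; apply/eqP; ring.
move: nij cij; rewrite /k; elim/I3_ind: i {k nki nkj nik}; elim/I3_ind: j => // _;
move: e ve => [[[] []] []] //= _; rewrite /cn /third /tri /= => // _;
 expand_configs; rewrite /byt /Z /direct /detour /cn /tri /third /= /eq_op /= /eq_op /= /eq_op /=;
 (apply: le_trans fT || apply: le_trans fS); rewrite le_eqVlt; apply/orP; left; apply/eqP; ring.
Qed.

(** * Linearisation and tail bounds *)

Notation al R := (alpha_bar R).

Lemma alpha_facts (R : realType) :
  [/\ 34 / 15 < al R, al R < 7 / 3 & al R ^+ 2 = 8 / 3 * al R - 13 / 15].
Proof.
rewrite /alpha_bar; set q := Num.sqrt 205.
have q0 : 0 <= q by exact: sqrtr_ge0.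
have q2 : q ^+ 2 = 205 by rewrite sqr_sqrtr.
have h1 : 14 < q by rewrite -(@ltr_pXn2r _ 2) ?nnegrE // q2 -natrX ltr_nat.
have h2 : q < 15 by rewrite -(@ltr_pXn2r _ 2) ?nnegrE // q2 -natrX ltr_nat.
by split; lra.
Qed.

Lemma expR_le_quad (R : realType) (y : R) : y <= 1 / 2 -> expR y <= 1 + y + 2 * y ^+ 2.
Proof.
move=> hy; have h : 1 - y <= expR (- y) by rewrite -[X in X <= _]/(1 + - y) expR_ge1Dx.
have p : 0 < 1 - y by lra.
rewrite -[expR y]invrK -expRN; apply: (@le_trans _ _ ((1 - y)^-1)).
  by rewrite lef_pV2 // posrE ?expR_gt0.
rewrite -[leLHS]mul1r ler_pdivrMr //.
by have := sqr_ge0 y; nra.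
Qed.

(* (2, 3 alpha - 5) is the Perron eigenvector of the mean matrix [[5/3, 2/3], [6/5, 1]]. *)
Definition vS (R : realType) : R := 3 * al R - 5.

Lemma mgf_bound_eigen (R : realType) (x s s' : R) n : 0 < x -> `|s| <= 1 / 12 ->
  al R * s + 72 * s ^+ 2 <= s' ->
  mgf_bound x n (expR (2 * s)) (expR (vS R * s)) ->
  mgf_bound x n.+1 (expR (2 * s')) (expR (vS R * s')).
Proof.
move=> x0; rewrite ler_norml => /andP[s1 s2] hs'; have [a1 a2 a3] := alpha_facts R.
have v1 : 9 / 5 < vS R by rewrite /vS; lra.
have v2 : vS R < 2 by rewrite /vS; lra.
have ev : 12 / 10 * 2 + vS R = al R * vS R.
  by rewrite /vS mulrBr mulrCA -expr2 a3; lra.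
have eT : 5 / 3 * 2 + 2 / 3 * vS R = al R * 2 by rewrite /vS; lra.
have s20 := sqr_ge0 s.
have Q w : 0 <= w -> w <= 6 -> expR (w * s) <= 1 + w * s + 72 * s ^+ 2.
  move=> w0 w6; have h : 0 <= w * (1 / 12 - s) by rewrite mulr_ge0 //; lra.
  have h' : 0 <= (36 - w ^+ 2) * s ^+ 2 by rewrite mulr_ge0 //; nra.
  apply: (le_trans (expR_le_quad _)); first by lra.
  by rewrite exprMn; lra.
have E a b : 1 + a * (al R * s) + 72 * s ^+ 2 <= b -> 1 <= a ->
   1 + a * (al R * s) + 72 * s ^+ 2 <= expR (a * s').
  move=> _ ha; apply: le_trans (expR_ge1Dx _); rewrite -addrA lerD2l.
  apply: (@le_trans _ _ (a * (al R * s + 72 * s ^+ 2))); last by rewrite ler_wpM2l //; lra.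
  by rewrite mulrDr lerD2l; nra.
apply: mgf_boundS => //; try exact: expR_ge0.
- have -> : expR (vS R * s) * expR (2 * s) ^+ 2 = expR ((vS R + 4) * s).
    by rewrite -expRM_natl -expRD; congr expR; ring.
  have -> : expR (vS R * s) * expR (2 * s) = expR ((vS R + 2) * s).
    by rewrite -expRD; congr expR; ring.
  have -> : expR (2 * s) ^+ 2 = expR (4 * s).
    by rewrite -expRM_natl; congr expR; ring.
  have := @Q (vS R + 4) _ _; have := @Q (vS R + 2) _ _; have := @Q 4 _ _.
  have := @E 2 _ (lexx _) _; nra.
- have -> : expR (2 * s) ^+ 2 = expR (4 * s).
    by rewrite -expRM_natl; congr expR; ring.
  have -> : 2 * expR (2 * s) * expR (vS R * s) ^+ 2 = 2 * expR ((2 + 2 * vS R) * s).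
    by rewrite -expRM_natl -mulrA -expRD; congr (_ * expR _); ring.
  have -> : expR (vS R * s) ^+ 2 = expR (2 * vS R * s).
    by rewrite -expRM_natl; congr expR; ring.
  have -> : 4 * expR (2 * s) * expR (vS R * s) = 4 * expR ((2 + vS R) * s).
    by rewrite -mulrA -expRD; congr (_ * expR _); ring.
  have h1 := @Q 4 ltac:(lra) ltac:(lra). have h2 := @Q (2 + 2 * vS R) ltac:(lra) ltac:(lra).
  have h3 := @Q (2 * vS R) ltac:(lra) ltac:(lra). have h4 := @Q (2 + vS R) ltac:(lra) ltac:(lra).
  have h5 := @E (vS R) _ (lexx _) ltac:(lra).
  have h6 : vS R * (al R * s) = (12 / 10 * 2 + vS R) * s by rewrite ev; ring.
  nra.
Qed.

Lemma mgf_bound_weaken (R : realType) (x X Y X' Y' : R) n : X <= X' -> Y <= Y' ->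
  mgf_bound x n X Y -> mgf_bound x n X' Y'.
Proof.
move=> hX hY h e i j nij ve cij; apply: le_trans (h e i j nij ve cij) _.
apply: ler_wpM2l; first by apply: Ex_ge0.
by case: ifP.
Qed.

Lemma mgf_bound_large (R : realType) (x C : R) n l : 0 < x -> 1 <= C ->
  mgf_bound x n C C -> mgf_bound x (l + n) (C ^+ (3 ^ l)) (C ^+ (3 ^ l)).
Proof.
move=> x0 C1 h; elim: l => [|l IH]; first by rewrite expn0 expr1.
have D1 : 1 <= C ^+ (3 ^ l) by exact: exprn_ege1.
rewrite addSn expnSr exprM; move: (C ^+ _) D1 IH => D D1 IH.
have D0 : 0 <= D by lra.
have h3 : D ^+ 2 <= D ^+ 3 by rewrite ler_weXn2l.
apply: (@mgf_boundS _ x D D _ _ _ x0 D0 D0 _ _ IH).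
  by rewrite -expr2 -exprS; lra.
have -> : 2 * D * D ^+ 2 = 2 * D ^+ 3 by ring.
by rewrite -mulrA -expr2; lra.
Qed.

Lemma mgf_bound_small (R : realType) (x q : R) n l : 0 < x -> 0 <= q <= 1 ->
  mgf_bound x n q q -> mgf_bound x (l + n) (q ^+ (2 ^ l)) (q ^+ (2 ^ l)).
Proof.
move=> x0 /andP[q0 q1] h; elim: l => [|l IH]; first by rewrite expn0 expr1.
have D1 : q ^+ (2 ^ l) <= 1 by exact: exprn_ile1.
have D0 : 0 <= q ^+ (2 ^ l) by exact: exprn_ge0.
rewrite addSn expnSr exprM; move: (q ^+ _) D0 D1 IH => D D0 D1 IH.
have h3 : D ^+ 3 <= D ^+ 2 by rewrite ler_wiXn2l.
apply: (@mgf_boundS _ x D D _ _ _ x0 D0 D0 _ _ IH).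
  by rewrite -expr2 -exprS; lra.
have -> : 2 * D * D ^+ 2 = 2 * D ^+ 3 by ring.
by rewrite -mulrA -expr2; lra.
Qed.

Lemma mgf_upper (R : realType) m l :
  mgf_bound (expR ((al R ^+ m)^-1 / 108)) (l + m)
    (expR ((3 ^+ l) / 18)) (expR ((3 ^+ l) / 18)).
Proof.
have [a1 a2 a3] := alpha_facts R; have a0 : 0 < al R by lra.
set x := expR _; have x0 : 0 < x by exact: expR_gt0.
have w0 k : 1 <= al R ^+ k by apply: exprn_ege1; lra.
pose s k : R := (108 * al R ^+ (m - k) - 72)^-1.
have sb k : 0 < s k /\ s k <= 1 / 36.
  have h : 36 <= 108 * al R ^+ (m - k) - 72 by have := w0 (m - k)%N; lra.
  by split; [rewrite invr_gt0; lra | rewrite div1r lef_pV2 // posrE; lra].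
have v1 : 9 / 5 < vS R by rewrite /vS; lra.
have v2 : vS R < 2 by rewrite /vS; lra.
have P k : (k <= m)%N -> mgf_bound x k (expR (2 * s k)) (expR (vS R * s k)).
  elim: k => [_|k IH km].
    have hs : (al R ^+ m)^-1 / 108 <= s 0%N.
      rewrite /s subn0 -invfM lef_pV2 ?posrE //; have := w0 m; nra.
    have [s0 _] := sb 0%N.
    have y0 : 0 < (al R ^+ m)^-1 / 108.
      by rewrite divr_gt0 // invr_gt0; have := w0 m; lra.
    apply: mgf_bound0 => //.
      have h : x ^+ 2 <= expR (2 * s 0%N).
        by rewrite -expRM_natl ler_expR; lra.
      have : x <= x ^+ 2 by rewrite ler_eXnr // -expR0 ler_expR ltW.
      lra.
    by rewrite ler_expR; nra.
  have [s0 s1] := sb k.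
  apply: (@mgf_bound_eigen _ x _ _ _ x0 _ _ (IH (ltnW km))); first by rewrite gtr0_norm //; lra.
  rewrite /s -(subnSK km) exprS.
  move: (w0 (m - k.+1)%N); set w := al R ^+ _ => hw.
  have hu : 0 < 108 * (al R * w) - 72 by nra.
  have hu' : 0 < 108 * w - 72 by nra.
  rewrite -[leRHS]mul1r ler_pdivlMr //.
  have u1 : (108 * (al R * w) - 72) * (108 * (al R * w) - 72)^-1 = 1 by rewrite divff // gt_eqF.
  move: u1; set u := _ - 72 in hu *; set v := u^-1 => u1.
  have -> : (al R * v + 72 * v ^+ 2) * (108 * w - 72) = (al R * u + 72) * (108 * w - 72) * v ^+ 2.
    transitivity ((al R * v * (u * v) + 72 * v ^+ 2) * (108 * w - 72)); last by ring.
    by rewrite u1 mulr1.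
  rewrite [leRHS](_ : 1 = u ^+ 2 * v ^+ 2); last by rewrite -exprMn u1 expr1n.
  rewrite ler_wpM2r ?sqr_ge0 // /u.
  have h1 : 0 <= (w - 1) * (al R ^+ 2 - al R - 1) by rewrite mulr_ge0 //; nra.
  lra.
have := P m (leqnn m); rewrite /s subnn expr0 (_ : 108 * 1 - 72 = 36 :> R); last by ring.
move=> h.
have h1 : mgf_bound x m (expR (1 / 18)) (expR (1 / 18)).
  by apply: (mgf_bound_weaken _ _ h); rewrite ler_expR; lra.
have := @mgf_bound_large _ x (expR (1 / 18)) m l x0 _ h1.
rewrite -!expRM_natl natrX mulrA mulr1; apply.
by have := @expR_ge1Dx R (1 / 18); lra.
Qed.

Lemma mgf_lower (R : realType) m l :
  mgf_bound (expR (- (al R ^+ m)^-1)) (l + m)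
    (expR (- (2 ^+ l / 146))) (expR (- (2 ^+ l / 146))).
Proof.
have [a1 a2 a3] := alpha_facts R; have a0 : 0 < al R by lra.
set x := expR _; have x0 : 0 < x by exact: expR_gt0.
have w0 k : 1 <= al R ^+ k by apply: exprn_ege1; lra.
pose s k : R := (2 * al R ^+ (m - k) + 144)^-1.
have sb k : 0 < s k /\ s k <= 1 / 144.
  have h : 144 <= 2 * al R ^+ (m - k) + 144 by have := w0 (m - k)%N; lra.
  by split; [rewrite invr_gt0; lra | rewrite div1r lef_pV2 // posrE; lra].
have v1 : 9 / 5 < vS R by rewrite /vS; lra.
have v2 : vS R < 2 by rewrite /vS; lra.
have P k : (k <= m)%N -> mgf_bound x k (expR (2 * - s k)) (expR (vS R * - s k)).
  elim: k => [_|k IH km].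
    have hs : s 0%N <= (al R ^+ m)^-1 / 2.
      by rewrite /s subn0 -invfM lef_pV2 ?posrE //; have := w0 m; lra.
    have [s0 _] := sb 0%N.
    have x1 : x <= 1.
      by rewrite -expR0 ler_expR oppr_le0 invr_ge0; have := w0 m; lra.
    apply: mgf_bound0 => //.
      have h : x <= expR (2 * - s 0%N) by rewrite ler_expR; lra.
      have : x ^+ 2 <= x by rewrite ler_iXnr // ltW.
      lra.
    by rewrite ler_expR; nra.
  have [s0 s1] := sb k.
  apply: (@mgf_bound_eigen _ x _ _ _ x0 _ _ (IH (ltnW km))); first by rewrite normrN gtr0_norm //; lra.
  rewrite mulrN sqrrN -[leLHS]opprK lerN2 opprD opprK.
  rewrite /s -(subnSK km) exprS.
  move: (w0 (m - k.+1)%N); set w := al R ^+ _ => hw.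
  have hu : 0 < 2 * (al R * w) + 144 by nra.
  have hu' : 0 < 2 * w + 144 by nra.
  rewrite -[leLHS]mul1r ler_pdivrMr //.
  have u1 : (2 * (al R * w) + 144) * (2 * (al R * w) + 144)^-1 = 1 by rewrite divff // gt_eqF.
  move: u1; set u := _ + 144 in hu *; set v := u^-1 => u1.
  have -> : (al R * v - 72 * v ^+ 2) * (2 * w + 144) = (al R * u - 72) * (2 * w + 144) * v ^+ 2.
    transitivity ((al R * v * (u * v) - 72 * v ^+ 2) * (2 * w + 144)); last by ring.
    by rewrite u1 mulr1.
  rewrite [leLHS](_ : 1 = u ^+ 2 * v ^+ 2); last by rewrite -exprMn u1 expr1n.
  rewrite ler_wpM2r ?sqr_ge0 // /u.
  have h1 : 0 <= (w - 1) * (al R ^+ 2 - al R - 1) by rewrite mulr_ge0 //; nra.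
  lra.
have := P m (leqnn m); rewrite /s subnn expr0 (_ : 2 * 1 + 144 = 146 :> R); last by ring.
move=> h.
have h1 : mgf_bound x m (expR (- (1 / 146))) (expR (- (1 / 146))).
  by apply: (mgf_bound_weaken _ _ h); rewrite ler_expR; lra.
have := @mgf_bound_small _ x (expR (- (1 / 146))) m l x0 _ h1.
rewrite -!expRM_natl natrX mulrN mulrA mulr1; apply.
by rewrite expR_ge0 /= expR_le1 oppr_le0 divr_ge0.
Qed.

Lemma size_le_count (R : realType) m l e i j (y : R) : i != j -> valid e -> cn e i j ->
  Ex e (fun c : sg (l + m) => ((size (wk c i j))%:R <= y)%R%:R) <=
  Nn R (l + m) e * expR (y / al R ^+ m - 2 ^+ l / 146).
Proof.
move=> nij ve cij.
have := @mgf_lower R m l e i j nij ve cij; rewrite if_same => h.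
rewrite expRD mulrCA -[leLHS]mul1r.
have -> : 1 * Ex e (fun c : sg (l + m) => ((size (wk c i j))%:R <= y)%R%:R) = 
  expR (y / al R ^+ m) * (expR (- (y / al R ^+ m)) * Ex e (fun c : sg (l + m) => ((size (wk c i j))%:R <= y)%R%:R)).
  by rewrite mulrA -expRD subrr expR0.
rewrite ler_wpM2l ?expR_ge0 //; apply: le_trans h; rewrite -ExMl; apply: ler_Ex => c _.
rewrite -expRM_natl; case: (boolP (_ <= y)) => hy; last by rewrite mulr0 expR_ge0.
rewrite mulr1 ler_expR mulrN lerN2 ler_wpM2r // invr_ge0 exprn_ge0 //.
by have [a1 a2 a3] := alpha_facts R; lra.
Qed.

Lemma size_ge_count (R : realType) m l e i j (y : R) : i != j -> valid e -> cn e i j ->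
  Ex e (fun c : sg (l + m) => (y <= (size (wk c i j))%:R)%R%:R) <=
  Nn R (l + m) e * expR (3 ^+ l / 18 - y / al R ^+ m / 108).
Proof.
move=> nij ve cij.
have := @mgf_upper R m l e i j nij ve cij; rewrite if_same => h.
rewrite expRD mulrA -[leLHS]mulr1.
have -> : Ex e (fun c : sg (l + m) => (y <= (size (wk c i j))%:R)%R%:R) * 1 = 
  (expR (y / al R ^+ m / 108) * Ex e (fun c : sg (l + m) => (y <= (size (wk c i j))%:R)%R%:R)) * expR (- (y / al R ^+ m / 108)).
  by rewrite mulrAC -expRD subrr expR0 mul1r mulr1.
rewrite ler_wpM2r ?expR_ge0 //; apply: le_trans h; rewrite -ExMl; apply: ler_Ex => c _.
rewrite -expRM_natl; case: (boolP (y <= _)) => hy; last by rewrite mulr0 expR_ge0.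
rewrite mulr1 ler_expR mulrA ler_wpM2r // ?ler_wpM2r // invr_ge0 exprn_ge0 //.
by have [a1 a2 a3] := alpha_facts R; lra.
Qed.

(** * Crossings of cells *)

Fixpoint segs (m k : nat) : sg (k + m) -> 'I_3 -> 'I_3 -> seq (seq pt) :=
  match k return sg (k + m) -> 'I_3 -> 'I_3 -> seq (seq pt) with
  | 0 => fun c i j => [:: wk c i j]
  | k'.+1 => fun (c : {ffun 'I_3 -> sg (k' + m)}) i j =>
    let r := third i j in
    let sh l := map (map (psi (k' + m) l)) in
    if dirc c i j then sh i (segs (c i) i j) ++ sh j (segs (c j) i j)
    else sh i (segs (c i) i r) ++ sh r (segs (c r) i j) ++ sh j (segs (c j) r j)
  end.

Lemma flatten_segs m k (c : sg (k + m)) i j : flatten (segs c i j) = wk c i j.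
Proof.
elim: k c i j => [|k IH] c i j; first by rewrite /= cats0.
by rewrite /=; case: ifP => _; rewrite !flatten_cat -!map_flatten !IH.
Qed.

Definition lens m k (c : sg (k + m)) i j : seq nat := map size (segs c i j).

Lemma lensS m k (c : sg (k.+1 + m)) i j : lens c i j =
  let c' : {ffun 'I_3 -> sg (k + m)} := c in let r := third i j in
  if dirc c' i j then lens (c' i) i j ++ lens (c' j) i j
  else lens (c' i) i r ++ lens (c' r) i j ++ lens (c' j) r j.
Proof.
have e l (s : seq (seq pt)) : map size (map (map (psi (k + m) l)) s) = map size s.
  by rewrite -map_comp; apply: eq_map => x /=; rewrite size_map.
by rewrite /lens /=; case: ifP => _; rewrite !map_cat !e.
Qed.

Section Next.
Context {R : realType}.

(* The first of the consecutive durations in [l] that starts at a time at least [s]. *)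
Fixpoint nx (l : seq nat) (s : R) : option nat :=
  if l is g :: l' then if s <= 0 then Some g else nx l' (s - g%:R) else None.

Lemma nx_cat l1 l2 s :
  nx (l1 ++ l2) s = if nx l1 s is Some g then Some g else nx l2 (s - (sumn l1)%:R).
Proof.
elim: l1 s => [|g l IH] s /=; first by rewrite subr0.
by case: ifP => // _; rewrite IH natrD opprD addrA.
Qed.

Definition excess (A : pred nat) (q : R) (o : option nat) : R :=
  if o is Some g then q - (A g)%:R else 0.

Lemma excess_nx_cat A q l1 l2 s : excess A q (nx (l1 ++ l2) s) =
  excess A q (nx l1 s) +
  (if nx l1 s is Some _ then 0 else excess A q (nx l2 (s - (sumn l1)%:R))).
Proof. by rewrite nx_cat; case: (nx l1 s) => [g|] /=; rewrite ?addr0 ?add0r. Qed.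

Lemma ExD n e (f g : sg n -> R) : Ex e (fun c => f c + g c) = Ex e f + Ex e g.
Proof. by rewrite /Ex big_split. Qed.

(* Renewal: the first crossing that starts after a given time has the law of a crossing,
   uniformly in the time. *)
Lemma excess_ge0 (A : pred nat) (q : R) m :
  (forall e i j, i != j -> valid e -> cn e i j ->
     Ex e (fun c : sg m => (A (size (wk c i j)))%:R) <= q * Nn R m e) ->
  forall k e i j s, i != j -> valid e -> cn e i j ->
    0 <= Ex e (fun c : sg (k + m) => excess A q (nx (lens c i j) s)).
Proof.
move=> base; elim=> [|k IH] e i j s nij ve cij.
  rewrite /lens /=; case: (s <= 0) => /=; last by rewrite Ex_const mulr0.
  rewrite (_ : Ex _ _ = q * Nn R m e - Ex e (fun c : sg m => (A (size (wk c i j)))%:R)).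
    by rewrite subr_ge0; exact: base.
  by rewrite mulrC -Ex_const /Ex -sumrB.
case/andP: (third_neq nij) => nki nkj.
have nik : i != third i j by rewrite eq_sym.
pose rest l s (o : R) := if nx l s is Some _ then 0 else o.
rewrite (@Ex_split _ _ _ i j _ (fun a b d => if cnc a i j && cnc d i j
  then excess A q (nx (lens a i j ++ lens d i j) s)
  else excess A q (nx (lens a i (third i j) ++ lens b i j ++ lens d (third i j) j) s))) //; last first.
  by move=> c; rewrite lensS /= /dirc; case: ifP.
rewrite big_seq; apply: sumr_ge0 => t; rewrite configsP => /andP[/eqP ct /and3P[v0 v1 v2]].
have vt l : valid (tri t l) by elim/I3_ind: l.
have rest0 e' l' s' i' j' : i' != j' -> valid e' -> cn e' i' j' ->
    0 <= Ex e' (fun d : sg (k + m) => rest l' s' (excess A q (nx (lens d i' j') (s' - (sumn l')%:R)))).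
  by move=> h1 h2 h3; rewrite /rest; case: (nx _ _) => [_|]; [rewrite Ex_const mulr0 | exact: IH].
have N0 e' : 0 <= Nn R (k + m) e' by apply: Ex_ge0.
case hd : (direct t i j).
  have /andP[d1 d2] := hd.
  rewrite (_ : Ex _ _ = Ex (tri t i) (fun a : sg (k + m) => Ex (tri t (third i j)) (fun b : sg (k + m) =>
     Ex (tri t j) (fun d : sg (k + m) => excess A q (nx (lens a i j) s) +
        rest (lens a i j) s (excess A q (nx (lens d i j) (s - (sumn (lens a i j))%:R))))))); last first.
    apply: eq_Ex => a ha; apply: eq_Ex => b hb; apply: eq_Ex => d hdd.
    by rewrite /cnc ha hdd; move: hd; rewrite /direct => ->; rewrite excess_nx_cat.
  rewrite (_ : Ex _ _ = Ex (tri t i) (fun a : sg (k + m) => excess A q (nx (lens a i j) s)) * (Nn R (k + m) (tri t j) * Nn R (k + m) (tri t (third i j))) +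
     Ex (tri t i) (fun a : sg (k + m) => Ex (tri t (third i j)) (fun b : sg (k + m) =>
     Ex (tri t j) (fun d : sg (k + m) => rest (lens a i j) s (excess A q (nx (lens d i j) (s - (sumn (lens a i j))%:R))))))); last first.
    rewrite -ExMr -ExD; apply: eq_Ex => a _; rewrite mulrA [_ * _ * Nn _ _ _]mulrC -Ex_const -ExD; apply: eq_Ex => b _.
    by rewrite ExD Ex_const mulrC.
  apply: addr_ge0; first by rewrite !mulr_ge0 // IH.
  by apply: Ex_ge0 => a _; apply: Ex_ge0 => b _; apply: rest0.
move: cij; rewrite (cn_comb nij ct) hd /= => /and3P[d1 d2 d3].
rewrite (_ : Ex _ _ = Ex (tri t i) (fun a : sg (k + m) => Ex (tri t (third i j)) (fun b : sg (k + m) =>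
   Ex (tri t j) (fun d : sg (k + m) => excess A q (nx (lens a i (third i j)) s) +
      (rest (lens a i (third i j)) s (excess A q (nx (lens b i j) (s - (sumn (lens a i (third i j)))%:R))) +
       rest (lens a i (third i j)) s (rest (lens b i j) (s - (sumn (lens a i (third i j)))%:R)
        (excess A q (nx (lens d (third i j) j) (s - (sumn (lens a i (third i j)))%:R - (sumn (lens b i j))%:R))))))))); last first.
  apply: eq_Ex => a ha; apply: eq_Ex => b hb; apply: eq_Ex => d hdd.
  rewrite /cnc ha hdd; move: hd; rewrite /direct => ->; rewrite excess_nx_cat /rest.
  by case: (nx (lens a _ _) _) => [g|]; rewrite ?addr0 // excess_nx_cat.
rewrite (_ : Ex _ _ = Ex (tri t i) (fun a : sg (k + m) => excess A q (nx (lens a i (third i j)) s)) * (Nn R (k + m) (tri t j) * Nn R (k + m) (tri t (third i j))) +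
   (Ex (tri t i) (fun a : sg (k + m) => Ex (tri t (third i j)) (fun b : sg (k + m) =>
     rest (lens a i (third i j)) s (excess A q (nx (lens b i j) (s - (sumn (lens a i (third i j)))%:R))))) * Nn R (k + m) (tri t j) +
   Ex (tri t i) (fun a : sg (k + m) => Ex (tri t (third i j)) (fun b : sg (k + m) =>
   Ex (tri t j) (fun d : sg (k + m) => rest (lens a i (third i j)) s (rest (lens b i j) (s - (sumn (lens a i (third i j)))%:R)
        (excess A q (nx (lens d (third i j) j) (s - (sumn (lens a i (third i j)))%:R - (sumn (lens b i j))%:R))))))))); last first.
  rewrite -[X in X + _]ExMr -[X in _ + (X + _)]ExMr -!ExD; apply: eq_Ex => a _.
  rewrite mulrA [_ * _ * Nn _ _ (tri t (third i j))]mulrC -Ex_const -[X in _ + (X + _)]ExMr -!ExD; apply: eq_Ex => b _.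
  by rewrite !ExD !Ex_const; congr (_ + (_ + _)); rewrite mulrC.
apply: addr_ge0; first by rewrite !mulr_ge0 // IH.
apply: addr_ge0.
  by rewrite mulr_ge0 //; apply: Ex_ge0 => a _; apply: rest0.
apply: Ex_ge0 => a _; apply: Ex_ge0 => b _.
rewrite {1}/rest; case: (nx _ _) => [_|]; first by rewrite Ex_const mulr0.
by apply: rest0.
Qed.

Lemma nx_count (A : pred nat) (q : R) m : 0 <= q ->
  (forall e i j, i != j -> valid e -> cn e i j ->
     Ex e (fun c : sg m => (A (size (wk c i j)))%:R) <= q * Nn R m e) ->
  forall k e i j s, i != j -> valid e -> cn e i j ->
    Ex e (fun c : sg (k + m) => (oapp A false (nx (lens c i j) s))%:R) <= q * Nn R (k + m) e.
Proof.
move=> q0 base k e i j s nij ve cij.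
rewrite -subr_ge0 mulrC -Ex_const /Ex -sumrB.
apply: le_trans (@excess_ge0 A q m base k e i j s nij ve cij) _.
apply: ler_Ex => c _; case: (nx _ _) => [g|] //=; by rewrite subr0.
Qed.

End Next.

(** * Geometry of the interpolated path *)

(* Barycentric coordinates: [emb n (a, b)] has coordinates a / 2^n and b / 2^n. *)
Definition bar1 (R : realType) (p : R * R) : R := p.1 - p.2 / Num.sqrt 3.
Definition bar2 (R : realType) (p : R * R) : R := 2 * (p.2 / Num.sqrt 3).
Definition in_cell (R : realType) (A B D : R) (p : R * R) :=
  [/\ A <= bar1 p, B <= bar2 p & bar1 p + bar2 p <= A + B + D].

Lemma sqrt3_facts (R : realType) : 0 < Num.sqrt 3 :> R /\ Num.sqrt 3 ^+ 2 = 3 :> R.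
Proof. by split; [rewrite sqrtr_gt0 | rewrite sqr_sqrtr]. Qed.

Lemma bar_emb (R : realType) n (p : pt) :
  bar1 (emb R n p) = p.1%:R / 2 ^+ n /\ bar2 (emb R n p) = p.2%:R / 2 ^+ n.
Proof.
have [s0 s2] := sqrt3_facts R; have s1 : Num.sqrt 3 != 0 :> R by rewrite gt_eqF.
have e2 : 2 ^+ n != 0 :> R by rewrite expf_neq0.
by rewrite /bar1 /bar2 /emb /=; split; field; rewrite e2 s1.
Qed.

Lemma norm2_bar (R : realType) (p : R * R) :
  norm2 p = Num.sqrt (bar1 p ^+ 2 + bar1 p * bar2 p + bar2 p ^+ 2).
Proof.
have [s0 s2] := sqrt3_facts R; have s1 : Num.sqrt 3 != 0 :> R by rewrite gt_eqF.
rewrite /norm2 /bar1 /bar2; congr Num.sqrt.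
have -> : p.2 ^+ 2 = 3 * (p.2 / Num.sqrt 3) ^+ 2 by rewrite expr_div_n s2; field.
by ring.
Qed.

Lemma bar_sub (R : realType) (p q : R * R) :
  bar1 (subp p q) = bar1 p - bar1 q /\ bar2 (subp p q) = bar2 p - bar2 q.
Proof.
have [s0 _] := sqrt3_facts R; have s1 : Num.sqrt 3 != 0 :> R by rewrite gt_eqF.
by rewrite /bar1 /bar2 /subp /=; split; field.
Qed.

Lemma in_cell_dist (R : realType) (A B D : R) p q : 0 <= D -> in_cell A B D p -> in_cell A B D q ->
  norm2 (subp p q) <= D.
Proof.
move=> D0 [p1 p2 p3] [q1 q2 q3]; have [e1 e2] := bar_sub p q.
rewrite norm2_bar e1 e2 -[leRHS](ger0_norm D0) -sqrtr_sqr ler_wsqrtr //.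
set u := bar1 p - _; set v := bar2 p - _.
have u1 : - D <= u by rewrite /u; lra. have u2 : u <= D by rewrite /u; lra.
have v1 : - D <= v by rewrite /v; lra. have v2 : v <= D by rewrite /v; lra.
have w1 : - D <= u + v by rewrite /u /v; lra. have w2 : u + v <= D by rewrite /u /v; lra.
clearbody u v; clear -D0 u1 u2 v1 v2 w1 w2.
have [hu|hu] := leP 0 u; have [hv|hv] := leP 0 v.
- have : 0 <= u * v by rewrite mulr_ge0.
  have : 0 <= (D - (u + v)) * (D + (u + v)) by rewrite mulr_ge0 //; lra.
  nra.
- have [hw|hw] := leP 0 (u + v).
    have : 0 <= (- v) * (u + v) by rewrite mulr_ge0 //; lra.
    have : 0 <= (D - u) * (D + u) by rewrite mulr_ge0 //; lra.
    nra.
  have : 0 <= u * (- (u + v)) by rewrite mulr_ge0 //; lra.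
  have : 0 <= (D - v) * (D + v) by rewrite mulr_ge0 //; lra.
  nra.
- have [hw|hw] := leP 0 (u + v).
    have : 0 <= (- u) * (u + v) by rewrite mulr_ge0 //; lra.
    have : 0 <= (D - v) * (D + v) by rewrite mulr_ge0 //; lra.
    nra.
  have : 0 <= v * (- (u + v)) by rewrite mulr_ge0 //; lra.
  have : 0 <= (D - u) * (D + u) by rewrite mulr_ge0 //; lra.
  nra.
- have : 0 <= (- u) * (- v) by rewrite mulr_ge0 //; lra.
  have : 0 <= (D - (u + v)) * (D + (u + v)) by rewrite mulr_ge0 //; lra.
  nra.
Qed.

Lemma bar_sum_le_norm2 (R : realType) (p : R * R) h : 0 <= h -> h <= bar1 p + bar2 p ->
  Num.sqrt 3 / 2 * h <= norm2 p.
Proof.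
move=> h0 hp; have [s0 s2] := sqrt3_facts R.
have hh : 0 <= Num.sqrt 3 / 2 * h by rewrite mulr_ge0 // divr_ge0 // ltW.
rewrite norm2_bar -[leLHS](ger0_norm hh) -sqrtr_sqr ler_wsqrtr //.
rewrite exprMn expr_div_n s2.
have h1 : 0 <= (bar1 p + bar2 p - h) * (bar1 p + bar2 p + h) by rewrite mulr_ge0 //; lra.
have := sqr_ge0 (bar1 p - bar2 p); nra.
Qed.

Lemma norm2_triangle (R : realType) (p q r : R * R) :
  norm2 (subp p r) <= norm2 (subp p q) + norm2 (subp q r).
Proof.
have n0 (x : R * R) : 0 <= norm2 x by exact: sqrtr_ge0.
have n2 (x : R * R) : norm2 x ^+ 2 = x.1 ^+ 2 + x.2 ^+ 2.
  by rewrite sqr_sqrtr // addr_ge0 // sqr_ge0.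
rewrite -ler_sqr ?nnegrE ?addr_ge0 // sqrrD !n2.
have h : (p.1 - q.1) * (q.1 - r.1) + (p.2 - q.2) * (q.2 - r.2)
    <= norm2 (subp p q) * norm2 (subp q r).
  apply: le_trans (ler_norm _) _.
  rewrite -ler_sqr ?nnegrE ?mulr_ge0 // real_normK ?num_real // exprMn !n2 /subp /=.
  by have := sqr_ge0 ((p.1 - q.1) * (q.2 - r.2) - (p.2 - q.2) * (q.1 - r.1)); nra.
rewrite mulr2n /subp /= in h *.
lra.
Qed.

Lemma LI_single (R : realType) (x : R * R) t : LI [:: x] t = x.
Proof. by rewrite /LI /=. Qed.

Lemma LI_head (R : realType) (x y : R * R) l t : 0 <= t < 1 ->
  LI (x :: y :: l) t = ((1 - t) * x.1 + t * y.1, (1 - t) * x.2 + t * y.2).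
Proof.
move=> /andP[t0 t1]; have e : Num.truncn t = 0%N.
  by apply/truncn_def; rewrite ?t0 //= t1.
by rewrite /LI e /= subr0.
Qed.

Lemma LI_tail (R : realType) (x y : R * R) l t : 1 <= t ->
  LI (x :: y :: l) t = LI (y :: l) (t - 1).
Proof.
move=> t1; have e : Num.truncn t = (Num.truncn (t - 1)).+1.
  have /truncn_itv/andP[h1 h2] : 0 <= t - 1 by lra.
  apply/truncn_def/andP; move: h1 h2; rewrite -!natr1; lra.
rewrite /LI e /= ltnS; set k := Num.truncn _.
have -> : k.+2%:R - t = k.+1%:R - (t - 1) by rewrite -[k.+2%:R]natr1; lra.
have -> : t - k.+1%:R = t - 1 - k%:R by rewrite -[k.+1%:R]natr1; lra.
by case: l => [|z l].
Qed.

Lemma LI_0 (R : realType) (x : R * R) l : LI (x :: l) 0 = x.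
Proof.
case: l => [|y l]; first exact: LI_single.
by rewrite LI_head ?lexx ?ltr01 // subr0 !mul1r !mul0r !addr0; case: x.
Qed.

Lemma LI_convex (R : realType) (Q : R * R -> Prop) (l : seq (R * R)) x t :
  (forall p q s, Q p -> Q q -> 0 <= s <= 1 ->
     Q ((1 - s) * p.1 + s * q.1, (1 - s) * p.2 + s * q.2)) ->
  (forall p, p \in x :: l -> Q p) -> 0 <= t -> Q (LI (x :: l) t).
Proof.
move=> hQ; elim: l x t => [|y l IH] x t hl t0.
  by rewrite LI_single; apply: hl; rewrite inE.
have [t1|t1] := ltP t 1.
  rewrite LI_head ?t0 //; apply: hQ; rewrite ?t0 ?ltW //; apply: hl; rewrite !inE eqxx ?orbT //.
rewrite LI_tail //; apply: IH; last by rewrite subr_ge0.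
by move=> p hp; apply: hl; rewrite inE hp orbT.
Qed.

Lemma LI_end (R : realType) (x : R * R) l t : (size l)%:R <= t -> LI (x :: l) t = last x l.
Proof.
elim: l x t => [|y l IH] x t ht; first by rewrite LI_single.
move: ht; rewrite /= -natr1 => ht; have := ler0n R (size l) => h0.
by rewrite LI_tail; [rewrite IH //|]; lra.
Qed.

Lemma LI_catl (R : realType) (x : R * R) l1 l2 t : 0 <= t <= (size l1)%:R ->
  LI (x :: l1 ++ l2) t = LI (x :: l1) t.
Proof.
elim: l1 x t => [|y l IH] x t /andP[t0 ht].
  have -> : t = 0 by apply/eqP; rewrite eq_le t0 ht.
  by rewrite !LI_0.
have [t1|t1] := ltP t 1; first by rewrite !LI_head ?t0.
by rewrite !LI_tail // IH //; move: ht; rewrite /= -natr1; lra.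
Qed.

Lemma LI_catr (R : realType) (x : R * R) l1 l2 t : (size l1)%:R <= t ->
  LI (x :: l1 ++ l2) t = LI (last x l1 :: l2) (t - (size l1)%:R).
Proof.
elim: l1 x t => [|y l IH] x t; first by rewrite subr0.
rewrite /= -natr1 => ht; have := ler0n R (size l) => h0.
rewrite LI_tail; last by lra.
rewrite IH; last by lra.
by congr LI; lra.
Qed.

Definition near_cell (R : realType) (D : R) (s : seq (R * R)) :=
  exists A B, forall p, p \in s -> in_cell A B D p.

Fixpoint chain (R : realType) (D : R) (x : R * R) (gs : seq (seq (R * R))) : Prop :=
  if gs is g :: gs' then near_cell D (x :: g) /\ chain D (last x g) gs' else True.

Lemma in_cell_convex (R : realType) (A B D : R) p q s :
  in_cell A B D p -> in_cell A B D q -> 0 <= s <= 1 ->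
  in_cell A B D ((1 - s) * p.1 + s * q.1, (1 - s) * p.2 + s * q.2).
Proof.
move=> [p1 p2 p3] [q1 q2 q3] /andP[s0 s1].
set r := (_, _).
have e1 : bar1 r = (1 - s) * bar1 p + s * bar1 q by rewrite /bar1 /r /=; ring.
have e2 : bar2 r = (1 - s) * bar2 p + s * bar2 q by rewrite /bar2 /r /=; ring.
have t0 : 0 <= 1 - s by lra.
have m (a b : R) : a <= b -> (1 - s) * a <= (1 - s) * b by exact: ler_wpM2l.
have m' (a b : R) : a <= b -> s * a <= s * b by exact: ler_wpM2l.
by rewrite /in_cell e1 e2; split;
  [have := m _ _ p1; have := m' _ _ q1|have := m _ _ p2; have := m' _ _ q2
  |have := m _ _ p3; have := m' _ _ q3]; lra.
Qed.

Lemma near_cell_LI (R : realType) (D : R) x g t t' : 0 <= D -> near_cell D (x :: g) ->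
  0 <= t -> 0 <= t' -> norm2 (subp (LI (x :: g) t) (LI (x :: g) t')) <= D.
Proof.
move=> D0 [A [B h]] t0 t0'; have P u : 0 <= u -> in_cell A B D (LI (x :: g) u).
  by move=> u0; apply: (LI_convex (Q := in_cell A B D)) => // p q s; exact: in_cell_convex.
by apply: (@in_cell_dist _ A B); [|exact: P|exact: P].
Qed.

(* If the first crossing that starts after time [a] is not over by time [b], then between
   [a] and [b] the curve meets at most two consecutive cells. *)
Lemma increment_le (R : realType) (D : R) x gs a b : 0 <= D -> chain D x gs -> 0 <= a <= b ->
  (forall g, nx (map size gs) a = Some g -> b - a < g%:R) ->
  norm2 (subp (LI (x :: flatten gs) b) (LI (x :: flatten gs) a)) <= 2 * D.
Proof.
move=> D0; elim: gs x a b => [|g gs IH] x a b.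
  move=> _ _ _; rewrite /= !LI_single /norm2 /subp /= !subrr expr0n /= addr0 sqrtr0.
  by rewrite mulr_ge0.
move=> [hg hgs] /andP[a0 ab] /=; set n := size g.
have [al0|al0] := leP a 0.
  move=> /(_ _ erefl) hb; rewrite !LI_catl; try (rewrite -/n; lra).
  by apply: (le_trans (near_cell_LI _ hg _ _)) => //; lra.
have [na|na] := leP n%:R a.
  move=> h; rewrite !LI_catr //; last by rewrite -/n; lra.
  by apply: IH => //; [lra | move=> g' /h; lra].
have [bn|bn] := leP b n%:R.
  move=> _; rewrite !LI_catl; try (rewrite -/n; lra).
  by apply: (le_trans (near_cell_LI _ hg _ _)) => //; lra.
move=> h; rewrite (@LI_catl _ x g _ a) ?(@LI_catr _ x g _ b) -/n; try lra.
apply: (le_trans (norm2_triangle _ (last x g) _)).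
rewrite mulr_natl mulr2n; apply: lerD; last first.
  by rewrite -(@LI_end _ x g n%:R) //; apply: near_cell_LI => //; rewrite ?ler0n //; lra.
case: gs h hgs {IH} => [|g' gs] h hgs /=.
  by rewrite LI_single /norm2 /subp /= !subrr expr0n /= addr0 sqrtr0.
move: h => /= /(_ (size g')); rewrite ifT; last by lra.
move=> /(_ erefl) hb; case: hgs => hg' _.
rewrite LI_catl; last by lra.
rewrite -[X in subp _ X](@LI_0 _ (last x g) g').
by apply: near_cell_LI => //; lra.
Qed.

Lemma far_after_first (R : realType) (D : R) x g gs a :
  (forall p, p \in last x g :: flatten gs -> D <= bar1 p + bar2 p) ->
  (size g)%:R <= a -> D <= bar1 (LI (x :: flatten (g :: gs)) a) + bar2 (LI (x :: flatten (g :: gs)) a).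
Proof.
move=> h ha; rewrite /= LI_catr //.
apply: (LI_convex (Q := fun p => D <= bar1 p + bar2 p)) => //; last by lra.
move=> p q s p1 q1 /andP[s0 s1]; set r := (_, _).
have -> : bar1 r = (1 - s) * bar1 p + s * bar1 q by rewrite /bar1 /r /=; ring.
have -> : bar2 r = (1 - s) * bar2 p + s * bar2 q by rewrite /bar2 /r /=; ring.
have t0 : 0 <= 1 - s by lra.
have := ler_wpM2l t0 p1; have := ler_wpM2l s0 q1; lra.
Qed.

Definition near_celln (D : nat) (s : seq pt) := exists A B : nat, forall p, p \in s ->
  [/\ A <= p.1, B <= p.2 & p.1 + p.2 <= A + B + D]%N.

Fixpoint chainn (D : nat) (x : pt) (gs : seq (seq pt)) : Prop :=
  if gs is g :: gs' then near_celln D (x :: g) /\ chainn D (last x g) gs' else True.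

Lemma chainn_cat D x g1 g2 :
  chainn D x g1 -> chainn D (last x (flatten g1)) g2 -> chainn D x (g1 ++ g2).
Proof.
elim: g1 x => //= g g1 IH x [h1 h2]; rewrite last_cat => h3; split=> //; exact: IH.
Qed.

Lemma chainn_psi D n i x gs : chainn D x gs -> chainn D (psi n i x) (map (map (psi n i)) gs).
Proof.
elim: gs x => //= g gs IH x [[A [B h]] h2]; rewrite last_map; split; last exact: IH.
rewrite -map_cons.
exists (if i == o1 then A + 2 ^ n else A)%N, (if i == o2 then B + 2 ^ n else B)%N.
move=> _ /mapP[p /h [pA pB pD] ->].
by move: pA pB pD; clear; elim/I3_ind: i; rewrite /psi /=; split; lia.
Qed.

Lemma wk_near n (c : sg n) e i j : ty c = Some e -> i != j -> cn e i j ->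
  near_celln (2 ^ n) (corner n i :: wk c i j).
Proof.
move=> tc nij cij; have [p _ _] := wk_saw tc nij cij; exists 0%N, 0%N => y hy.
by split=> //; apply: path_dec_inV (inV_corner n i) p hy.
Qed.

Lemma last_segs m k (c : sg (k + m)) e i j : ty c = Some e -> i != j -> cn e i j ->
  last (corner (k + m) i) (flatten (segs c i j)) = corner (k + m) j.
Proof. by move=> tc nij cij; rewrite flatten_segs; have [] := wk_saw tc nij cij. Qed.

Lemma segs_chain m k (c : sg (k + m)) e i j : ty c = Some e -> i != j -> cn e i j ->
  chainn (2 ^ m) (corner (k + m) i) (segs c i j).
Proof.
elim: k c e i j => [|k IH] c e i j tc nij cij.
  by split=> //; apply: wk_near tc nij cij.
have [t [ht ct]] := ty_comb tc; pose c' : {ffun 'I_3 -> sg (k + m)} := c.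
have L l p q : p != q -> cn (tri t l) p q ->
   last (psi (k + m) l (corner (k + m) p)) (flatten (map (map (psi (k + m) l)) (segs (c' l) p q)))
   = psi (k + m) q (corner (k + m) l).
  by move=> npq h; rewrite -map_flatten last_map (last_segs (ht l) npq h) psi_mid.
have hd : dirc c' i j = direct t i j by rewrite /dirc /cnc !ht.
rewrite -[corner _ i]/(corner (k + m).+1 i) -psi_corner /= -/c' hd; case: ifP => [/andP[d1 d2]|nd].
  apply: chainn_cat; first by apply: chainn_psi; exact: IH (ht i) nij d1.
  by rewrite L //; apply: chainn_psi; exact: IH (ht j) nij d2.
move: cij; rewrite (cn_comb nij ct) nd /= => /and3P[d1 d2 d3].
case/andP: (third_neq nij) => nki nkj; have nik : i != third i j by rewrite eq_sym.
apply: chainn_cat; first by apply: chainn_psi; exact: IH (ht i) nik d1.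
rewrite L //; apply: chainn_cat; first by apply: chainn_psi; exact: IH (ht _) nij d2.
by rewrite L //; apply: chainn_psi; exact: IH (ht j) nkj d3.
Qed.

Lemma segs_far m k (c : sg (k + m)) e j : ty c = Some e -> o0 != j -> cn e o0 j ->
  exists g gs, segs c o0 j = g :: gs /\ forall p, p \in last (corner (k + m) o0) g :: flatten gs ->
    (2 ^ m <= p.1 + p.2)%N.
Proof.
elim: k c e j => [|k IH] c e j tc nij cij.
  exists (wk c o0 j), [::]; split=> // p.
  have [_ -> _] := wk_saw tc nij cij; rewrite inE => /eqP ->.
  by move: nij; clear; elim/I3_ind: j => // _; rewrite /corner /= ?addn0 ?add0n.
have [t [ht ct]] := ty_comb tc; pose c' : {ffun 'I_3 -> sg (k + m)} := c.
have hd : dirc c' o0 j = direct t o0 j by rewrite /dirc /cnc !ht.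
have far l p s : l != o0 -> p \in map (psi (k + m) l) s -> (2 ^ m <= p.1 + p.2)%N.
  move=> nl /mapP[q _ ->].
  have h : (2 ^ m <= 2 ^ (k + m))%N by rewrite leq_exp2l // leq_addl.
  by move: nl; elim/I3_ind: l => // _; rewrite /psi /=; lia.
have nj : j != o0 by rewrite eq_sym.
have id0 (s : seq (seq pt)) : map (map (psi (k + m) o0)) s = s.
  by rewrite (eq_map (g := id)) ?map_id // => x; rewrite /= (eq_map (g := id)) ?map_id.
rewrite [segs _ _ _]/= -/c' hd; case: ifP => [/andP[d1 d2]|nd].
  have [g [gs [e1 h1]]] := IH _ _ _ (ht o0) nij d1.
  rewrite id0 e1; eexists; eexists; split; first by rewrite cat_cons.
  move=> p; rewrite flatten_cat -cat_cons mem_cat => /orP[]; first exact: h1.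
  by rewrite -map_flatten; exact: far.
move: cij; rewrite (cn_comb nij ct) nd /= => /and3P[d1 d2 d3].
case/andP: (third_neq nij) => nki nkj; have nik : o0 != third o0 j by rewrite eq_sym.
have [g [gs [e1 h1]]] := IH _ _ _ (ht o0) nik d1.
rewrite id0 e1; eexists; eexists; split; first by rewrite cat_cons.
move=> p; rewrite !flatten_cat -cat_cons !mem_cat => /or3P[]; first exact: h1.
  by rewrite -map_flatten; exact: far.
by rewrite -map_flatten; exact: far.
Qed.

Lemma chain_emb (R : realType) n D x gs : chainn D x gs ->
  chain (D%:R / 2 ^+ n) (emb R n x) (map (map (emb R n)) gs).
Proof.
elim: gs x => //= g gs IH x [[A [B h]] h2]; rewrite last_map; split; last exact: IH.
rewrite -map_cons; exists (A%:R / 2 ^+ n), (B%:R / 2 ^+ n) => _ /mapP[p /h [pA pB pD] ->].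
have [e1 e2] := bar_emb R n p; have p0 : 0 <= (2 ^+ n : R)^-1 by rewrite invr_ge0 exprn_ge0.
rewrite /in_cell e1 e2 -!mulrDl -!natrD; split; by rewrite ler_wpM2r // ler_nat.
Qed.

Lemma XnE (R : realType) m k (c : sg (k + m)) t : ty c = Some TT ->
  Xn (k + m) (dec c) t = LI (emb R (k + m) (corner (k + m) o0) ::
     flatten (map (map (emb R (k + m))) (segs c o0 o1))) (al R ^+ (k + m) * t).
Proof.
move=> tc; rewrite /Xn.
have := walk_tree tc; rewrite /o0 /o1 => ->.
by rewrite -map_flatten flatten_segs.
Qed.

Lemma cell_size (R : realType) m k : (2 ^ m)%:R / 2 ^+ (k + m) = (2 ^+ k)^-1 :> R.
Proof.
rewrite natrX exprD invfM mulrCA divff ?mulr1 // expf_neq0 //.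
Qed.

Lemma map_size_emb (R : realType) n (gs : seq (seq pt)) :
  map size (map (map (emb R n)) gs) = map size gs.
Proof. by rewrite -map_comp; apply: eq_map => g /=; rewrite size_map. Qed.

Lemma Xn_increment (R : realType) m k (c : sg (k + m)) (s t t' : R) : ty c = Some TT ->
  0 <= s -> 0 <= t' <= t ->
  ~~ oapp (fun g => g%:R <= al R ^+ (k + m) * t) false (nx (lens c o0 o1) (al R ^+ (k + m) * s)) ->
  norm2 (subp (Xn (k + m) (dec c) (s + t')) (Xn (k + m) (dec c) s)) <= 2 * (2 ^+ k)^-1.
Proof.
move=> tc s0 /andP[t0 tt'] hn; rewrite !XnE // -(cell_size _ m k).
have [a1 a2 a3] := alpha_facts R.
have a0 : 0 < al R ^+ (k + m) by apply: exprn_gt0; lra.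
have hat : al R ^+ (k + m) * t' <= al R ^+ (k + m) * t by rewrite ler_wpM2l // ltW.
have hat0 : 0 <= al R ^+ (k + m) * t' by rewrite mulr_ge0 // ltW.
have has0 : 0 <= al R ^+ (k + m) * s by rewrite mulr_ge0 // ltW.
apply: increment_le.
- by rewrite divr_ge0 // exprn_ge0.
- by apply: chain_emb; exact: segs_chain tc _ _.
- by rewrite mulrDr; lra.
- move=> g; rewrite map_size_emb mulrDr => hg; move: hn; rewrite /lens hg /= -ltNge; lra.
Qed.

Lemma Xn_far (R : realType) m k (c : sg (k + m)) (t t' : R) : ty c = Some TT ->
  0 <= t <= t' ->
  ~~ oapp (fun g => al R ^+ (k + m) * t <= g%:R) false (nx (lens c o0 o1) (0 : R)) ->
  Num.sqrt 3 / 2 * (2 ^+ k)^-1 <= norm2 (Xn (k + m) (dec c) t').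
Proof.
move=> tc /andP[t0 tt'] hn; rewrite XnE //; apply: bar_sum_le_norm2.
  by rewrite invr_ge0 exprn_ge0.
have [a1 a2 a3] := alpha_facts R.
have a0 : 0 < al R ^+ (k + m) by apply: exprn_gt0; lra.
have hat : al R ^+ (k + m) * t <= al R ^+ (k + m) * t' by rewrite ler_wpM2l // ltW.
have [g [gs [eg hfar]]] := segs_far tc (isT : o0 != o1) (isT : cn TT o0 o1).
move: hn; rewrite /lens eg /= lexx /= -ltNge => hn.
apply: far_after_first; last by rewrite size_map; lra.
move=> p; rewrite last_map -map_flatten -map_cons => /mapP[q /hfar hq ->].
have [-> ->] := bar_emb R (k + m) q.
rewrite -mulrDl -natrD -(cell_size R m k) ler_wpM2r ?invr_ge0 ?exprn_ge0 // ler_nat //.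
Qed.

Lemma Xn_bounded (R : realType) n (H : edges) (t : R) : spanning_tree n H -> 0 <= t ->
  in_cell 0 0 1 (Xn n H t).
Proof.
move=> /spanning_treeP[c tc <-] t0; rewrite /Xn.
have -> := walk_tree tc; rewrite map_cons.
have [a1 a2 a3] := alpha_facts R.
apply: (LI_convex (Q := in_cell 0 0 1)).
- by move=> p q s; exact: in_cell_convex.
- rewrite -map_cons => _ /mapP[q hq ->].
  have [p _ _] := wk_saw tc (isT : o0 != o1) (isT : cn TT o0 o1).
  have hV := path_dec_inV (inV_corner n o0) p hq.
  have [e1 e2] := bar_emb R n q; have p0 : 0 < (2 ^+ n : R) by rewrite exprn_gt0.
  rewrite /in_cell e1 e2 !divr_ge0 ?exprn_ge0 //; split=> //.
  by rewrite !add0r -mulrDl ler_pdivrMr // mul1r -natrD -natrX ler_nat.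
- by rewrite mulr_ge0 // exprn_ge0 //; lra.
Qed.

(** * Uniform spanning trees *)

Definition eventually_in (Omega : Type) (E : nat -> set Omega) : set Omega :=
  \bigcup_N \bigcap_(n in [set n | (N <= n)%N]) E n.

Lemma measurable_eventually_in (d : measure_display) (Omega : measurableType d) (E : nat -> set Omega) :
  (forall n, measurable (E n)) -> measurable (eventually_in E).
Proof. by move=> mE; apply: bigcup_measurable => N _; apply: bigcap_measurableType => n _. Qed.

Lemma eventually_in_le (R : realType) (d : measure_display) (Omega : measurableType d)
    (P : probability Omega R) (E : nat -> set Omega) (q : \bar R) :
  (forall n, measurable (E n)) -> (forall n, (P (E n) <= q)%E) -> (P (eventually_in E) <= q)%E.
Proof.
move=> mE hE; pose G N := \bigcap_(n in [set n | (N <= n)%N]) E n.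
have mG N : measurable (G N) by apply: bigcap_measurableType => n _.
have h : (P \o G) n @[n --> \oo] --> P (\bigcup_N G N).
  apply: nondecreasing_cvg_mu => //; first by apply: bigcup_measurable.
  by move=> m n mn; apply/subsetPset => w hw j /= nj; apply: hw => /=; exact: leq_trans nj.
rewrite /eventually_in -/G -(cvg_lim (@ereal_hausdorff R) h).
apply: lime_le; first by apply/cvg_ex; exists (P (\bigcup_N G N)).
apply: nearW => n /=; apply: le_trans (hE n); apply: le_measure; rewrite ?inE //.
by move=> w; apply => /=.
Qed.

Section UniformTrees.
Context {R : realType} {d : measure_display} {Omega : measurableType d}.
Context (P : probability Omega R) (T : nat -> Omega -> edges).
Hypothesis treeT : forall n w, spanning_tree n (T n w).
Hypothesis measT : forall n t, measurable (T n @^-1` [set t]).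
Hypothesis unifT : forall n t1 t2, spanning_tree n t1 -> spanning_tree n t2 ->
  P (T n @^-1` [set t1]) = P (T n @^-1` [set t2]).

Definition tree_event n (B : pred (sg n)) : set Omega :=
  [set w | exists c, [/\ ty c = Some TT, B c & T n w = dec c]].

Lemma tree_eventE n (B : pred (sg n)) : let r := [seq c <- enum (sg n) | (ty c == Some TT) && B c] in
  tree_event B = \bigcup_(c in [set` r]) (T n @^-1` [set dec c]).
Proof.
move=> r; apply/seteqP; split=> [w [c [tc bc e]]|w [c + e]].
  by exists c => //=; rewrite /= mem_filter tc eqxx bc mem_enum.
by rewrite /= mem_filter => /andP[/andP[/eqP tc bc] _]; exists c.
Qed.

Lemma measurable_tree_event n (B : pred (sg n)) : measurable (tree_event B).
Proof. by rewrite tree_eventE; apply: fin_bigcup_measurable => // c _; exact: measT. Qed.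

Lemma tree_event_prob n : exists p : R, 0 <= p /\ forall B : pred (sg n),
  P (tree_event B) = (p * Ex TT (fun c : sg n => (B c)%:R))%:E.
Proof.
have [H HT] : exists H, spanning_tree n H by exists (T n point); exact: treeT.
exists (fine (P (T n @^-1` [set H]))); split; first by rewrite fine_ge0.
move=> B; rewrite tree_eventE; set r := [seq _ <- _ | _].
rewrite measure_fin_bigcup //; last first.
- by move=> c1 c2 _ _ [w [/= e1 e2]]; apply: dec_injective; rewrite -e1 -e2.
- rewrite -fsbig_seq; last by rewrite filter_uniq // enum_uniq.
  transitivity ((\sum_(c <- r) (fine (P (T n @^-1` [set H])))%:E)%E).
    apply: eq_big_seq => c; rewrite mem_filter => /andP[/andP[/eqP tc _] _].
    rewrite fineK ?fin_num_measure //; apply: unifT => //.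
    by apply/spanning_treeP; exists c.
  rewrite sumEFin; congr EFin; rewrite big_const_seq count_predT iter_addr_0 -mulr_natr; congr (_ * _).
  rewrite /Ex -sum1_size natr_sum big_filter big_enum_cond /=.
  rewrite [RHS](bigID (fun c => B c)) /= [X in _ + X]big1 ?addr0; last by move=> c /andP[_ /negPf ->].
  by apply: eq_big => [c|c /andP[_ ->]]; rewrite ?inE.
Qed.

Lemma tree_event_le n (B : pred (sg n)) q : 0 <= q ->
  Ex TT (fun c : sg n => (B c)%:R) <= q * Nn R n TT -> (P (tree_event B) <= q%:E)%E.
Proof.
move=> q0 hB; have [p [p0 hp]] := tree_event_prob n.
have h1 : p * Nn R n TT <= 1.
  have : (P (@tree_event n predT) <= 1)%E by apply: probability_le1; exact: measurable_tree_event.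
  by rewrite hp lee_fin.
rewrite hp lee_fin; apply: (@le_trans _ _ (p * (q * Nn R n TT))); first by rewrite ler_wpM2l.
by rewrite mulrCA -[leRHS]mulr1 ler_wpM2l.
Qed.

Definition curve_limit (X : Omega -> R -> R * R) (w : Omega) := forall e : R, 0 < e ->
  exists N, forall n, (N <= n)%N -> forall t : R, 0 <= t ->
    norm2 (subp (Xn n (T n w) t) (X w t)) <= e.

Lemma norm2_sym (p q : R * R) : norm2 (subp p q) = norm2 (subp q p).
Proof. by rewrite /norm2 /subp /= -(opprB p.1) -(opprB p.2) !sqrrN. Qed.

Lemma norm2_tri (p q : R * R) : norm2 p <= norm2 q + norm2 (subp p q).
Proof.
have e0 (x : R * R) : subp x (0, 0) = x by rewrite /subp !subr0; case: x.
by have := norm2_triangle p q (0, 0); rewrite !e0 addrC.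
Qed.

Lemma increment_event X k l s t : 0 <= s -> 0 <= t -> exists Bd : set Omega,
  [/\ measurable Bd, (P Bd <= (expR (al R ^+ (k + l) * t - 2 ^+ l / 146))%:E)%E &
   forall w, curve_limit X w -> ~ Bd w -> forall t', 0 <= t' <= t ->
     norm2 (subp (X w (s + t')) (X w s)) <= 2 * (2 ^+ k)^-1].
Proof.
move=> s0 t0; set q := expR _.
pose B m (c : sg (k + (l + m))) := oapp (fun g => g%:R <= al R ^+ (k + (l + m)) * t) false
   (nx (lens c o0 o1) (al R ^+ (k + (l + m)) * s)).
exists (eventually_in (fun m => tree_event (@B m))); split.
- by apply: measurable_eventually_in => m; exact: measurable_tree_event.
- apply: eventually_in_le => m; first exact: measurable_tree_event.
  apply: tree_event_le; first exact: expR_ge0.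
  apply: (@nx_count R (fun g => g%:R <= al R ^+ (k + (l + m)) * t)); rewrite ?expR_ge0 // => e i j nij ve cij.
  apply: (le_trans (size_le_count m l _ nij ve cij)).
  have -> : al R ^+ (k + (l + m)) * t / al R ^+ m = al R ^+ (k + l) * t.
    rewrite addnA exprD [LHS]mulrAC mulfK // expf_neq0 //.
    by have [a1 _ _] := alpha_facts R; rewrite gt_eqF //; lra.
  by rewrite mulrC.
- move=> w cw nB t' tt'; apply/ler_addgt0Pr => e e0.
  have [N hN] := cw (e / 2) (divr_gt0 e0 (ltr0n _ 2)).
  have [m [hm nEm]] : exists m, (N <= m)%N /\ ~ tree_event (@B m) w.
    apply/not_existsP => hh; apply: nB; exists N => // m /= hm.
    by have := hh m; rewrite not_andP => -[//|/contrapT].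
  have hn : (N <= k + (l + m))%N by lia.
  have /spanning_treeP[c tc ec] := treeT (k + (l + m)) w.
  have nb : ~~ B m c by apply/negP => bc; apply: nEm; exists c.
  have h := @Xn_increment R (l + m) k c s t t' tc s0 tt' nb.
  have t'0 : 0 <= s + t' by case/andP: tt' => ? _; rewrite addr_ge0.
  have h1 := hN _ hn _ t'0; have h2 := hN _ hn _ s0.
  rewrite ec in h.
  have h3 := norm2_triangle (X w (s + t')) (Xn (k + (l + m)) (T (k + (l + m)) w) (s + t')) (X w s).
  have h4 := norm2_triangle (Xn (k + (l + m)) (T (k + (l + m)) w) (s + t')) (Xn (k + (l + m)) (T (k + (l + m)) w) s) (X w s).
  rewrite norm2_sym in h1; lra.
Qed.

Lemma far_event X k l t : 0 <= t -> exists Bd : set Omega,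
  [/\ measurable Bd, (P Bd <= (expR (3 ^+ l / 18 - al R ^+ (k + l) * t / 108))%:E)%E &
   forall w, curve_limit X w -> ~ Bd w -> forall t', t <= t' ->
     Num.sqrt 3 / 2 * (2 ^+ k)^-1 <= norm2 (X w t')].
Proof.
move=> t0; set q := expR _.
pose B m (c : sg (k + (l + m))) := oapp (fun g => al R ^+ (k + (l + m)) * t <= g%:R) false
   (nx (lens c o0 o1) (0 : R)).
exists (eventually_in (fun m => tree_event (@B m))); split.
- by apply: measurable_eventually_in => m; exact: measurable_tree_event.
- apply: eventually_in_le => m; first exact: measurable_tree_event.
  apply: tree_event_le; first exact: expR_ge0.
  apply: (@nx_count R (fun g => al R ^+ (k + (l + m)) * t <= g%:R)); rewrite ?expR_ge0 // => e i j nij ve cij.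
  apply: (le_trans (size_ge_count m l _ nij ve cij)).
  have -> : al R ^+ (k + (l + m)) * t / al R ^+ m = al R ^+ (k + l) * t.
    rewrite addnA exprD [LHS]mulrAC mulfK // expf_neq0 //.
    by have [a1 _ _] := alpha_facts R; rewrite gt_eqF //; lra.
  by rewrite mulrC.
- move=> w cw nB t' tt'; apply/ler_addgt0Pr => e e0.
  have [N hN] := cw e e0.
  have [m [hm nEm]] : exists m, (N <= m)%N /\ ~ tree_event (@B m) w.
    apply/not_existsP => hh; apply: nB; exists N => // m /= hm.
    by have := hh m; rewrite not_andP => -[//|/contrapT].
  have hn : (N <= k + (l + m))%N by lia.
  have /spanning_treeP[c tc ec] := treeT (k + (l + m)) w.
  have nb : ~~ B m c by apply/negP => bc; apply: nEm; exists c.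
  have h := @Xn_far R (l + m) k c t t' tc (introT andP (conj t0 tt')) nb.
  have h1 := hN _ hn _ (le_trans t0 tt'); rewrite ec in h.
  have := norm2_tri (Xn (k + (l + m)) (T (k + (l + m)) w) t') (X w t'); lra.
Qed.

Lemma increment_le1 X w s t : curve_limit X w -> 0 <= s -> 0 <= t -> norm2 (subp (X w s) (X w t)) <= 1.
Proof.
move=> cw s0 t0; apply/ler_addgt0Pr => e e0.
have [N hN] := cw (e / 2) (divr_gt0 e0 (ltr0n _ 2)).
have h1 := hN _ (leqnn N) _ s0; have h2 := hN _ (leqnn N) _ t0.
have h := in_cell_dist (@ler01 R) (Xn_bounded (treeT N w) s0) (Xn_bounded (treeT N w) t0).
have h3 := norm2_triangle (X w s) (Xn N (T N w) s) (X w t).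
have h4 := norm2_triangle (Xn N (T N w) s) (Xn N (T N w) t) (X w t).
rewrite norm2_sym in h1; lra.
Qed.

End UniformTrees.

(** * Exponents *)

Lemma pow_sandwich (R : realType) (a x : R) : 1 < a -> 1 <= x ->
  exists n, x <= a ^+ n <= a * x.
Proof.
move=> a1 x1; have a0 : 0 < a by lra.
have ex : exists n, x <= a ^+ n.
  have b0 : 0 < a - 1 by lra.
  have bern n : 1 + n%:R * (a - 1) <= a ^+ n.
    elim: n => [|n IH]; first by rewrite mul0r addr0 expr0.
    rewrite exprS -natr1; have := ler_wpM2l (ltW a0) IH.
    by have := mulr_ge0 (ler0n R n) (sqr_ge0 (a - 1)); lra.
  exists (Num.truncn (x / (a - 1))).+1; apply: le_trans (bern _).
  have : x / (a - 1) < (Num.truncn (x / (a - 1))).+1%:R by exact: truncnS_gt.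
  rewrite ltr_pdivrMr //; lra.
case: (ex_minnP ex) => n hn hmin; exists n; rewrite hn /=.
case: n hn hmin => [|n] hn hmin; first by rewrite expr0; nra.
rewrite exprS ler_wpM2l //; first lra.
by rewrite leNgt; apply/negP => /ltW /hmin; rewrite ltnn.
Qed.

Lemma powRX (R : realType) (a r : R) n : 0 <= a -> (a ^+ n) `^ r = (a `^ r) ^+ n.
Proof.
by move=> a0; rewrite -powR_mulrn // powRAC -powR_mulrn // powR_ge0.
Qed.

Lemma powR_invl (R : realType) (x r : R) : 0 <= x -> x^-1 `^ r = (x `^ r)^-1.
Proof. by move=> x0; rewrite -(powR_inv1 x0) powRAC powR_inv1 // powR_ge0. Qed.

Lemma exp_vs_power (R : realType) N (y : R) : 0 <= y -> y ^+ N.+1 * expR (- y) <= N.+1%:R ^+ N.+1.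
Proof.
move=> y0; have N0 : 0 < N.+1%:R :> R by rewrite ltr0n.
have : (y / N.+1%:R) ^+ N.+1 <= expR y.
  have -> : expR y = expR (y / N.+1%:R) ^+ N.+1.
    by rewrite -expRM_natl mulrCA divff ?mulr1 // gt_eqF.
  rewrite ler_pXn2r ?nnegrE ?expR_ge0 ?divr_ge0 //.
  by apply: le_trans (expR_ge1Dx _); rewrite lerDr.
rewrite expr_div_n ler_pdivrMr ?exprn_gt0 // => h.
rewrite expRN ler_pdivrMr ?expR_gt0 // mulrC; lra.
Qed.

Section Exponents.
Context {R : realType}.
Local Notation gl := (gamma_l R).
Local Notation gr := (gamma_r R).

Lemma ln_alpha_gt0 : 0 < ln (al R).
Proof. by have [a1 _ _] := alpha_facts R; apply: ln_gt0; lra. Qed.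

Lemma gamma_l_bounds : 0 < gl < 1.
Proof.
have [a1 _ _] := alpha_facts R; have h := ln_alpha_gt0; rewrite /gamma_l.
have l2 : 0 < ln 2 :> R by apply: ln_gt0; rewrite ltr1n.
rewrite divr_gt0 //= ltr_pdivrMr // mul1r ltr_ln ?posrE //; lra.
Qed.

Lemma gamma_r_gt1 : 1 < gr.
Proof.
have [a1 a2 _] := alpha_facts R; have h := ln_alpha_gt0; rewrite /gamma_r.
by rewrite ltr_pdivlMr // mul1r ltr_ln ?posrE //; lra.
Qed.

Lemma alpha_gl : al R `^ gl = 2.
Proof.
have [a1 a2 _] := alpha_facts R; have h := ln_alpha_gt0.
rewrite /powR gt_eqF; last by lra.
by rewrite /gamma_l divfK ?gt_eqF // lnK // posrE.
Qed.

Lemma alpha_half_gl : (al R / 2) `^ gl = 2 `^ (1 - gl).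
Proof.
have [a1 a2 _] := alpha_facts R.
rewrite powRM ?invr_ge0 //; last by lra.
rewrite alpha_gl powRB ?powRr1 //; last by apply/implyP => _; rewrite pnatr_eq0.
by congr (_ * _); rewrite -powR_inv1 // -powRrM mulN1r powRN.
Qed.

Lemma three_alpha_gl : (3 / al R) `^ gl = 3 `^ (gl * (1 - gr^-1)).
Proof.
have [a1 a2 _] := alpha_facts R; have g1 := gamma_r_gt1; have h := ln_alpha_gt0.
have e3 : 3 `^ gr^-1 = al R.
  rewrite /powR pnatr_eq0 /= /gamma_r invf_div divfK ?lnK ?posrE //; first lra.
  by rewrite gt_eqF // ln_gt0 // ltr1n.
rewrite (mulrC gl (1 - gr^-1)) [RHS]powRrM; congr (_ `^ gl).
rewrite powRB ?powRr1 ?e3 //; by apply/implyP => _; rewrite pnatr_eq0.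
Qed.

Lemma pow2_alpha n : (al R ^+ n) `^ gl = 2 ^+ n.
Proof. by have [a1 _ _] := alpha_facts R; rewrite powRX ?alpha_gl //; lra. Qed.

Lemma le_powR (a b r : R) : 0 <= r -> 0 <= a -> a <= b -> a `^ r <= b `^ r.
Proof. by move=> r0 a0 ab; apply: ge0_ler_powR; rewrite // ?nnegrE //; lra. Qed.

(* The scale [n] of a time [t], at which the typical displacement is [2 ^- n]. *)
Lemma time_scale (t : R) : 0 < t <= 1 -> exists n, [/\ t^-1 <= al R ^+ n <= al R * t^-1,
  (2 ^+ n)^-1 <= t `^ gl & t `^ gl <= 2 * (2 ^+ n)^-1].
Proof.
move=> /andP[t0 t1]; have [a1 _ _] := alpha_facts R; have /andP[g0 _] := gamma_l_bounds.
have [|//|n /andP[h1 h2]] := @pow_sandwich R (al R) t^-1; first lra.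
  by rewrite invf_ge1.
have a0 : 0 < al R by lra.
have p0 : 0 < al R ^+ n by exact: exprn_gt0.
exists n; rewrite h1 h2; split=> //.
  rewrite -pow2_alpha -[leRHS]invrK -(powR_invl _ (ltW t0)) lef_pV2 ?posrE ?powR_gt0 ?invr_gt0 //.
  by apply: le_powR => //; [exact: ltW | rewrite invr_ge0 ltW].
rewrite -pow2_alpha -(powR_invl _ (ltW p0)) -[X in X * _]alpha_gl -powRM ?invr_ge0; [|exact: ltW|exact: ltW].
apply: le_powR; [exact: ltW|exact: ltW|].
by rewrite ler_pdivlMr // mulrC -ler_pdivlMr.
Qed.

End Exponents.

Lemma measurable_norm2 (R : realType) (d : measure_display) (Omega : measurableType d)
  (f g : Omega -> R) (p : R) : measurable_fun setT f -> measurable_fun setT g ->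
  measurable_fun setT (fun w => norm2 (f w, g w) `^ p : R).
Proof.
move=> mf mg.
apply: (measurableT_comp (measurable_powR p)).
rewrite (_ : (fun w => _) = (fun w => (f w ^+ 2 + g w ^+ 2) `^ 2^-1)).
  apply: (measurableT_comp (measurable_powR 2^-1)).
  by apply: measurable_funD; apply: measurable_funX.
by apply/funext => w; rewrite powR12_sqrt // addr_ge0 ?sqr_ge0.
Qed.

Lemma integral_step_le (R : realType) (d : measure_display) (Omega : measurableType d)
  (P : probability Omega R) (B : nat -> set Omega) (a q : nat -> R) (c : R) K :
  0 <= c -> (forall m, 0 <= a m) -> (forall m, measurable (B m)) ->
  (forall m, (m < K)%N -> (P (B m) <= (q m)%:E)%E) ->
  (\int[P]_w (c + \sum_(m < K) a m * \1_(B m) w)%:E <= (c + \sum_(m < K) a m * q m)%:E)%E.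
Proof.
move=> c0 a0 mB; elim: K => [|K IH] hB.
  rewrite (_ : (fun w => _) = cst (c%:E)); last by apply/funext => w; rewrite big_ord0 addr0.
  rewrite integral_cst // big_ord0 addr0 -[leRHS]mule1.
  by apply: lee_wpmul2l; [rewrite lee_fin | exact: probability_le1].
have m1 m : measurable_fun setT (fun w => (a m * \1_(B m) w : R)).
  by apply: measurable_funM => //; exact: measurable_indic.
have i0 m w : 0 <= a m * \1_(B m) w by rewrite mulr_ge0 // indicE.
rewrite (_ : (fun w => _) = (fun w => (c + \sum_(m < K) a m * \1_(B m) w)%:E + (a K * \1_(B K) w)%:E)%E); last first.
  by apply/funext => w; rewrite big_ord_recr /= -EFinD addrA.
rewrite ge0_integralD //=; last 4 first.
- by move=> w _; rewrite lee_fin addr_ge0 // sumr_ge0.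
- apply/measurable_EFinP; apply: measurable_funD => //.
  by apply: measurable_sum => m; exact: m1.
- by move=> w _; rewrite lee_fin.
- by apply/measurable_EFinP; exact: m1.
have -> : c + \sum_(m < K.+1) a m * q m = (c + \sum_(m < K) a m * q m) + a K * q K.
  by rewrite big_ord_recr /= addrA.
rewrite EFinD; apply: leeD.
  by apply: IH => m mK; apply: hB; exact: ltnW.
under eq_integral do rewrite EFinM.
rewrite ge0_integralZl //=; last 2 first.
- by apply/measurable_EFinP; exact: measurable_indic.
- by rewrite lee_fin.
rewrite integral_indic // setIT EFinM; apply: lee_wpmul2l; first by rewrite lee_fin.
exact: hB.
Qed.

(** * Moments *)

Lemma moment_series_bounded (R : realType) (p : R) : 0 < p -> exists S : R, 0 <= S /\
  forall K, \sum_(m < K) (2 ^+ m.+1) `^ p * expR (- (2 ^+ m / 146)) <= S.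
Proof.
move=> p0; pose N := (Num.truncn p).+1.
have pN : p <= N%:R by apply: ltW; exact: truncnS_gt.
pose D : R := 2 ^+ N * (N.+1%:R * 146) ^+ N.+1.
have D0 : 0 <= D by rewrite mulr_ge0 ?exprn_ge0 // mulr_ge0.
have bnd m : (2 ^+ m.+1) `^ p * expR (- (2 ^+ m / 146)) <= D * (1 / 2) ^+ m.
  have h := @exp_vs_power R N (2 ^+ m / 146) (divr_ge0 (exprn_ge0 m (ler0n _ 2)) (ler0n _ 146)).
  have p2 : 0 < 2 ^+ m :> R by exact: exprn_gt0.
  have h1 : (2 ^+ m.+1) `^ p <= 2 ^+ N * (2 ^+ m) ^+ N :> R.
    have -> : 2 ^+ N * (2 ^+ m) ^+ N = (2 ^+ m.+1) `^ N%:R :> R.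
      by rewrite powR_mulrn ?exprn_ge0 // exprS exprMn.
    apply: ler_powR => //.
    by rewrite exprn_ege1 // ler1n.
  apply: (le_trans (ler_wpM2r (expR_ge0 _) h1)).
  rewrite /D -[leLHS]mulrA -[leRHS]mulrA ler_wpM2l ?exprn_ge0 //.
  move: h; rewrite expr_div_n => h.
  have h2 : (2 ^+ m) ^+ N.+1 * expR (- (2 ^+ m / 146)) <= (N.+1%:R * 146) ^+ N.+1 :> R.
    rewrite exprMn -ler_pdivrMr ?exprn_gt0 //; apply: le_trans h.
    by rewrite mulrAC.
  rewrite expr_div_n expr1n div1r ler_pdivlMr //; apply: le_trans h2.
  by rewrite exprSr mulrAC.
exists (D * 2); split; first by rewrite mulr_ge0.
move=> K; apply: (@le_trans _ _ (\sum_(m < K) D * (1 / 2) ^+ m)); first by apply: ler_sum => m _.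
rewrite -mulr_sumr ler_wpM2l //.
suff -> : \sum_(m < K) (1 / 2) ^+ m = 2 - 2 * (1 / 2) ^+ K :> R.
  by rewrite lerBlDr lerDl mulr_ge0 // exprn_ge0.
elim: K => [|K IH]; first by rewrite big_ord0 expr0; lra.
by rewrite big_ord_recr /= IH exprS; lra.
Qed.

Section Moments.
Context {R : realType} {d : measure_display} {Omega : measurableType d}.
Context (P : probability Omega R) (T : nat -> Omega -> edges) (X : Omega -> R -> R * R).
Hypothesis treeT : forall n w, spanning_tree n (T n w).
Hypothesis measT : forall n t, measurable (T n @^-1` [set t]).
Hypothesis unifT : forall n t1 t2, spanning_tree n t1 -> spanning_tree n t2 ->
  P (T n @^-1` [set t1]) = P (T n @^-1` [set t2]).
Hypothesis measX1 : forall t, measurable_fun setT (fun w => (X w t).1).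
Hypothesis measX2 : forall t, measurable_fun setT (fun w => (X w t).2).
Hypothesis convX : {ae P, forall w, curve_limit T X w}.

Lemma moment_lower (p : R) : 0 < p -> exists C9 : R, 0 < C9 /\ forall t, 0 <= t <= 1 ->
  ((C9 * t `^ (p * gamma_l R))%:E <= \int[P]_w ((norm2 (X w t)) `^ p)%:E)%E.
Proof.
move=> p0; have [a1 a2 _] := alpha_facts R; have /andP[g0 g1] := @gamma_l_bounds R.
have [||j0 /andP[hj0 _]] := @pow_sandwich R (al R) 114; [lra|lra|].
have [s0 _] := sqrt3_facts R.
have i0 n : 0 < (2 ^+ n)^-1 :> R by rewrite invr_gt0 exprn_gt0.
pose r0 : R := Num.sqrt 3 / 4 * (2 ^+ j0)^-1.
have r00 : 0 < r0 by rewrite mulr_gt0 // divr_gt0.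
exists (r0 `^ p / 2); split; first by rewrite divr_gt0 // powR_gt0.
move=> t /andP[t0 t1].
move: t0; rewrite le_eqVlt => /predU1P[<-|t0].
  rewrite powR0 ?mulr0; last by rewrite mulf_neq0 ?gt_eqF.
  by apply: integral_ge0 => w _; rewrite lee_fin powR_ge0.
have [|K [/andP[K1 _] K2 K3]] := @time_scale R t; first by rewrite t0.
have [Bd [mB PB hB]] := @far_event _ _ _ P T treeT measT unifT X (K + j0) 0 t (ltW t0).
pose r : R := Num.sqrt 3 / 2 * (2 ^+ (K + j0))^-1.
have hr : r0 * t `^ gamma_l R <= r.
  rewrite /r /r0 exprD invfM; have := i0 j0; move: (_ ^-1) => u u0.
  have : t `^ gamma_l R * (Num.sqrt 3 * u) <= 2 * (2 ^+ K)^-1 * (Num.sqrt 3 * u).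
    by rewrite ler_wpM2r // mulr_ge0 // ltW.
  lra.
have Phalf : (P Bd <= (1 / 2)%:E)%E.
  apply: (le_trans PB); rewrite lee_fin.
  have h1 : 114 <= al R ^+ (K + j0 + 0) * t.
    rewrite addn0 exprD mulrAC; apply: (le_trans hj0).
    rewrite -[leLHS]mul1r ler_wpM2r //; first by rewrite exprn_ge0 //; lra.
    by rewrite -ler_pdivrMr // div1r.
  have : expR (3 ^+ 0 / 18 - al R ^+ (K + j0 + 0) * t / 108) <= expR (-1 : R).
    by rewrite ler_expR expr0; lra.
  move=> /le_trans; apply.
  rewrite expRN div1r lef_pV2 ?posrE ?expR_gt0 //.
  by have := @expR_ge1Dx R 1; lra.
have Pc : (1 / 2 <= fine (P (~` Bd)))%R.
  rewrite probability_setC // fineB ?fin_num_measure //= ?fin_numE //.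
  have : fine (P Bd) <= 1 / 2 by rewrite -lee_fin fineK ?fin_num_measure.
  lra.
have mC : measurable (~` Bd) by exact: measurableC.
apply: (@le_trans _ _ (\int[P]_w ((r `^ p)%:E * (\1_(~` Bd) w)%:E)%E)%E).
  rewrite ge0_integralZl //=; last 2 first.
  - by apply/measurable_EFinP; exact: measurable_indic.
  - by rewrite lee_fin powR_ge0.
  rewrite integral_indic // setIT.
  apply: (@le_trans _ _ ((r `^ p)%:E * P (~` Bd))%E); last exact: lexx.
  rewrite -[P (~` Bd)]fineK ?fin_num_measure // -EFinM lee_fin.
  have h2 : r0 `^ p * t `^ (p * gamma_l R) <= r `^ p.
    rewrite [p * _]mulrC powRrM -powRM ?powR_ge0 //; last exact: ltW.
    by apply: le_powR => //; [exact: ltW | rewrite mulr_ge0 ?powR_ge0 // ltW].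
  have h3 : 0 <= r `^ p by exact: powR_ge0.
  have h4 := ler_wpM2l h3 Pc; lra.
apply: ae_ge0_le_integral => //=.
- by move=> w _; rewrite mule_ge0 // lee_fin ?powR_ge0 // indicE.
- by apply: emeasurable_funM => //; apply/measurable_EFinP; exact: measurable_indic.
- by move=> w _; rewrite lee_fin powR_ge0.
- apply/measurable_EFinP.
  have := measurable_norm2 p (measX1 t) (measX2 t).
  by under eq_fun do rewrite -surjective_pairing.
- move: convX; apply: filterS => w cw _.
  rewrite -EFinM lee_fin; have [wB|nB] := pselect (Bd w).
    by rewrite indicE memNset ?mulr0 ?powR_ge0 //; apply.
  rewrite indicE mem_set // mulr1; apply: le_powR; first exact: ltW.
    by rewrite mulr_ge0 ?divr_ge0 ?ltW.
  exact: hB.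
Qed.

Lemma moment_upper (p : R) : 0 < p -> exists C10 : R, 0 < C10 /\ forall s t, 0 <= s -> 0 <= t <= 1 ->
  (\int[P]_w ((norm2 (subp (X w (s + t)) (X w s))) `^ p)%:E <= (C10 * t `^ (p * gamma_l R))%:E)%E.
Proof.
move=> p0; have [a1 a2 _] := alpha_facts R; have /andP[g0 g1] := @gamma_l_bounds R.
have [S [S0 hS]] := moment_series_bounded p0.
exists (2 `^ p * (1 + expR (al R) * S)); split.
  by rewrite mulr_gt0 ?powR_gt0 // ltr_wpDr // mulr_ge0 // expR_ge0.
move=> s t s0 /andP[t0 t1].
have i0 n : 0 < (2 ^+ n)^-1 :> R by rewrite invr_gt0 exprn_gt0.
move: t0; rewrite le_eqVlt => /predU1P[<-|t0].
  rewrite addr0 powR0 ?mulr0; last by rewrite mulf_neq0 ?gt_eqF.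
  rewrite integral0_eq // => w _; rewrite /norm2 /subp /= !subrr expr0n /= addr0 sqrtr0.
  by rewrite powR0 // gt_eqF.
have [|K [/andP[K1 K4] K2 K3]] := @time_scale R t; first by rewrite t0.
have /choice[B hB] m := @increment_event _ _ _ P T treeT measT unifT X (K - m) m s t s0 (ltW t0).
pose a m : R := (2 * (2 ^+ K)^-1) `^ p * (2 ^+ m.+1) `^ p.
pose c : R := (2 * (2 ^+ K)^-1) `^ p.
pose q m : R := expR (al R) * expR (- (2 ^+ m / 146)).
have b0 : 0 <= 2 * (2 ^+ K)^-1 :> R by rewrite mulr_ge0 // ltW.
have mB m : measurable (B m) by case: (hB m).
have c0 : 0 <= c by exact: powR_ge0.
have a0 m : 0 <= a m by rewrite mulr_ge0 // powR_ge0.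
have hq m : (m < K)%N -> (P (B m) <= (q m)%:E)%E.
  move=> mK; case: (hB m) => _ h _; apply: (le_trans h); rewrite lee_fin /q -expRD ler_expR.
  rewrite lerD2r subnK; last exact: ltnW.
  by rewrite -ler_pdivlMr.
apply: (@le_trans _ _ (\int[P]_w (c + \sum_(m < K) a m * \1_(B m) w)%:E)%E).
  apply: ae_ge0_le_integral => //=.
  - by move=> w _; rewrite lee_fin powR_ge0.
  - apply/measurable_EFinP; apply: measurable_norm2.
      by apply: measurable_funB.
    by apply: measurable_funB.
  - by move=> w _; rewrite lee_fin addr_ge0 // sumr_ge0 // => m _; rewrite mulr_ge0 // indicE.
  - apply/measurable_EFinP; apply: measurable_funD => //.
    by apply: measurable_sum => m; apply: measurable_funM => //; exact: measurable_indic.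
  - move: convX; apply: filterS => w cw _; rewrite lee_fin.
    set Z := norm2 _; have Z0 : 0 <= Z by exact: sqrtr_ge0.
    suff H j : (j <= K)%N -> Z <= 2 * (2 ^+ K)^-1 * 2 ^+ j -> Z `^ p <= c + \sum_(m < j) a m * \1_(B m) w.
      apply: (H K) => //; rewrite mulfVK ?expf_neq0 //.
      by have := @increment_le1 R _ Omega T treeT X w (s + t) s cw (addr_ge0 s0 (ltW t0)) s0; rewrite -/Z; lra.
    elim: j => [_|j IH jK].
      by rewrite expr0 mulr1 big_ord0 addr0 => h; apply: le_powR => //; exact: ltW.
    move=> h; rewrite big_ord_recr /= addrA.
    have su0 : 0 <= \sum_(m < j) a m * \1_(B m) w.
      by apply: sumr_ge0 => m _; rewrite mulr_ge0 // indicE.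
    have [wB|wB] := pselect (B j w).
      rewrite indicE mem_set // mulr1.
      have : Z `^ p <= a j.
        rewrite /a -powRM ?exprn_ge0 //; apply: le_powR => //; exact: ltW.
      lra.
    rewrite indicE memNset // mulr0 addr0; apply: IH; first exact: ltnW.
    case: (hB j) => _ _ /(_ w cw wB t); rewrite (ltW t0) lexx => /(_ isT); rewrite -/Z => hz.
    apply: (le_trans hz); rewrite -mulrA ler_wpM2l //.
    rewrite -{2}(subnK (ltnW jK)) exprD invfM divfK ?expf_neq0 //.
apply: (le_trans (@integral_step_le R d Omega P B a q c K c0 a0 mB hq)); rewrite lee_fin.
have -> : c + \sum_(m < K) a m * q m = c * (1 + expR (al R) * \sum_(m < K) (2 ^+ m.+1) `^ p * expR (- (2 ^+ m / 146))).
  rewrite mulrDr mulr1; congr (_ + _); rewrite !mulr_sumr; apply: eq_bigr => m _.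
  by rewrite /a /q /c; ring.
have hc : c <= 2 `^ p * t `^ (p * gamma_l R).
  rewrite /c powRM ?invr_ge0 ?exprn_ge0 //.
  rewrite ler_wpM2l ?powR_ge0 // [p * _]mulrC powRrM; exact: (le_powR (ltW p0) (ltW (i0 K)) K2).
rewrite mulrAC; apply: ler_pM => //.
  by rewrite addr_ge0 // mulr_ge0 ?expR_ge0 // sumr_ge0 // => m _; rewrite mulr_ge0 ?powR_ge0 ?expR_ge0.
by rewrite lerD2l ler_wpM2l ?expR_ge0.
Qed.

End Moments.

(** * Almost sure behaviour *)

Lemma borel_cantelli_log (R : realType) (d : measure_display) (Omega : measurableType d)
  (P : probability Omega R) (B : nat -> set Omega) :
  (forall j, measurable (B j)) ->
  (forall j, (P (B j) <= (expR (- (2 * ln j.+2%:R)))%:E)%E) ->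
  {ae P, forall w, exists J, forall j, (J <= j)%N -> ~ B j w}.
Proof.
move=> mB hB; exists (lim_sup_set B); split.
- by apply: bigcap_measurable => // n _; apply: bigcup_measurable.
- apply: lim_sup_set_cvg0 => //; apply: (@le_lt_trans _ _ 1%E); last exact: ltry.
  apply: lime_le; first by apply: is_cvg_nneseries => n _ _.
  apply: nearW => n.
  suff : (\sum_(0 <= i < n) P (B i) <= (1 - n.+1%:R^-1)%:E)%E.
    by move=> /le_trans; apply; rewrite lee_fin gerBl invr_ge0.
  elim: n => [|n IH]; first by rewrite big_geq // invr1 subrr.
  rewrite big_nat_recr //=; apply: (le_trans (leeD IH (hB n))).
  rewrite -EFinD lee_fin expRN.
  have e : expR (2 * ln n.+2%:R) = n.+2%:R ^+ 2 :> R.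
    by rewrite expRM_natl lnK // posrE.
  rewrite e.
  have n1 : 0 < n.+1%:R :> R by []. have n2 : 0 < n.+2%:R :> R by [].
  have e2 : n.+2%:R = n.+1%:R + 1 :> R by rewrite natr1.
  suff h : (n.+2%:R ^+ 2)^-1 <= n.+1%:R^-1 - n.+2%:R^-1 :> R.
    move: h; set x := n.+1%:R^-1; set y := (_ ^+ 2)^-1; set z := n.+2%:R^-1.
    by clearbody x y z; lra.
  have -> : n.+1%:R^-1 - n.+2%:R^-1 = (n.+1%:R * n.+2%:R)^-1 :> R.
    move: n1 n2; rewrite e2; move: (n.+1%:R) => a ha hb; field.
    by rewrite !gt_eqF.
  by rewrite lef_pV2 ?posrE ?mulr_gt0 ?exprn_gt0 // expr2 ler_wpM2r // ler_nat.
- move=> w /= h n _; apply: contrapT => hn; apply: h; exists n => j nj Bj.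
  by apply: hn; exists j.
Qed.

Section Exponents2.
Context {R : realType}.
Local Notation gl := (gamma_l R).
Local Notation gr := (gamma_r R).

Lemma ln2_ge (x : R) : 36 <= x -> 1 <= x * ln 2.
Proof.
move=> hx; suff h : 1 / 36 <= ln 2 :> R by nra.
rewrite -ler_expR lnK ?posrE //.
by apply: (le_trans (@expR_le_quad R (1 / 36) _)); lra.
Qed.

Lemma ln_ge_ln2 j : ln 2 <= ln j.+2%:R :> R.
Proof. by rewrite ler_ln ?posrE // ler_nat. Qed.

Lemma log_scale J : exists delta : R, 0 < delta /\ forall t, 0 < t < delta ->
  exists n, [/\ (J <= n)%N, (al R ^+ n.+1)^-1 <= t <= (al R ^+ n)^-1,
    (2 ^+ n.+1)^-1 <= t `^ gl, t `^ gl <= 2 * (2 ^+ n.+1)^-1 &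
    0 < ln (n.+3%:R : R) <= 2 * ln (ln t^-1)].
Proof.
have [a1 a2 _] := alpha_facts R; have a0 : 0 < al R by lra.
have p0 n : 0 < al R ^+ n by exact: exprn_gt0.
set a := ln (al R); have la : 0 < a by exact: ln_alpha_gt0.
have [J1 hJ1] : exists J1 : nat, 4 <= J1%:R * a ^+ 2.
  exists (Num.truncn (4 / a ^+ 2)).+1.
  by rewrite -ler_pdivrMr ?exprn_gt0 //; apply: ltW; exact: truncnS_gt.
have [J2 [J2J J2J1]] : exists J2, (J < J2)%N /\ (J1 < J2)%N.
  by exists (maxn J J1).+1; rewrite !ltnS leq_maxl leq_maxr.
exists (al R ^+ J2.+1)^-1; split; first by rewrite invr_gt0.
move=> t /andP[t0 td].
have p1 : 1 <= al R ^+ J2.+1 by apply: exprn_ege1; lra.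
have t1 : t <= 1 by apply: (le_trans (ltW td)); rewrite invf_le1.
have [|n' [/andP[h1 h2] h3 h4]] := @time_scale R t; first by rewrite t0.
have hn' : (J2.+1 < n')%N.
  rewrite -(@ltr_eXn2l _ (al R)); last by lra.
  by apply: lt_le_trans h1; rewrite -[al R ^+ _]invrK ltf_pV2 ?posrE ?invr_gt0.
case: n' h1 h2 h3 h4 hn' => // n h1 h2 h3 h4 hn; exists n.
have hn2 : al R ^+ n <= t^-1 by move: h2; rewrite exprS ler_pM2l.
split=> //.
- by move: hn J2J; clear; lia.
- rewrite -[t in _ <= t <= _]invrK !lef_pV2 ?posrE ?invr_gt0 // h1 /=.
  by rewrite hn2.
- have l3 : 0 < ln n.+3%:R :> R by rewrite ln_gt0 // ltr1n.
  rewrite l3 /=.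
  have hl : n%:R * a <= ln t^-1.
    by rewrite mulr_natl -lnXn // ler_ln ?posrE ?invr_gt0.
  have nJ : J1%:R <= n%:R :> R by rewrite ler_nat; move: hn J2J1; clear; lia.
  have n1 : 1 <= n%:R :> R by rewrite ler1n; move: hn; clear; lia.
  have na0 : 0 < n%:R * a by rewrite mulr_gt0 //; lra.
  have l0 : 0 < ln t^-1 by lra.
  have -> : 2 * ln (ln t^-1) = ln (ln t^-1 ^+ 2) by rewrite lnXn // mulr_natl.
  rewrite ler_ln ?posrE ?exprn_gt0 //.
  apply: (@le_trans _ _ ((n%:R * a) ^+ 2)); last first.
    by rewrite ler_pXn2r ?nnegrE // ltW.
  have e3 : n.+3%:R = n%:R + 3 :> R by rewrite -addn3 natrD.
  have h5 : J1%:R * a ^+ 2 <= n%:R * a ^+ 2 by rewrite ler_wpM2r // sqr_ge0.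
  have h6 : n%:R * 4 <= n%:R * (n%:R * a ^+ 2) by rewrite ler_wpM2l //; lra.
  rewrite e3 exprMn expr2 -mulrA; lra.
Qed.

End Exponents2.

Section LocalBehaviour.
Context {R : realType} {d : measure_display} {Omega : measurableType d}.
Context (P : probability Omega R) (T : nat -> Omega -> edges) (X : Omega -> R -> R * R).
Hypothesis treeT : forall n w, spanning_tree n (T n w).
Hypothesis measT : forall n t, measurable (T n @^-1` [set t]).
Hypothesis unifT : forall n t1 t2, spanning_tree n t1 -> spanning_tree n t2 ->
  P (T n @^-1` [set t1]) = P (T n @^-1` [set t2]).
Hypothesis convX : {ae P, forall w, curve_limit T X w}.
Local Notation gl := (gamma_l R).
Local Notation gr := (gamma_r R).

Lemma fast_event (A s : R) j : A = 292 -> 0 <= s -> exists (Bd : set Omega) (m : nat),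
  [/\ measurable Bd, (P Bd <= (expR (- (2 * ln j.+2%:R)))%:E)%E,
      2 ^+ m <= (A * al R) `^ gl * (4 * A * ln j.+2%:R) `^ (1 - gl) :> R &
      forall w, curve_limit T X w -> ~ Bd w -> forall t, 0 <= t <= (al R ^+ j)^-1 ->
        norm2 (subp (X w (s + t)) (X w s)) <= 2 * (2 ^+ m * (2 ^+ j)^-1)].
Proof.
move=> hA s0; have A0 : 0 < A by lra.
have [a1 a2 _] := alpha_facts R; have /andP[g0 g1] := @gamma_l_bounds R.
have a0 : 0 < al R by lra.
have p0 n : 0 < al R ^+ n by exact: exprn_gt0.
have Aal : 0 <= A * al R by rewrite mulr_ge0 // ltW.
have L1 : 1 <= 2 * A * ln j.+2%:R :> R.
  by apply: (le_trans (@ln2_ge R (2 * A) _)); [lra | apply: ler_wpM2l (ln_ge_ln2 _); lra].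
have [|l /andP[l1 l2]] := @pow_sandwich R 2 _ _ L1; first by lra.
have x1 : 1 <= A * (al R / 2) ^+ l.
  have h : 1 <= (al R / 2) ^+ l by apply: exprn_ege1; lra.
  by have := ler_wpM2l (ltW A0) h; lra.
have [|m /andP[m1 m2]] := @pow_sandwich R (al R) _ _ x1; first by lra.
have hm : 2 ^+ m <= (A * al R) `^ gl * (4 * A * ln j.+2%:R) `^ (1 - gl) :> R.
  rewrite -pow2_alpha.
  apply: (@le_trans _ _ (((A * al R) * (al R / 2) ^+ l) `^ gl)).
    apply: le_powR; [exact: ltW|exact: ltW|]; apply: (le_trans m2).
    by rewrite le_eqVlt; apply/orP; left; apply/eqP; ring.
  have h0 : 0 <= al R / 2 by lra.
  rewrite powRM ?exprn_ge0 //.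
  rewrite ler_wpM2l ?powR_ge0 // powRX // alpha_half_gl -powRX //.
  apply: le_powR; [lra|exact: exprn_ge0|lra].
have [mj|jm] := leqP m j; last first.
  exists set0, m; split=> //; first by rewrite measure0 lee_fin expR_ge0.
  move=> w cw _ t /andP[t0 _].
  have h := @increment_le1 R _ Omega T treeT X w (s + t) s cw (addr_ge0 s0 t0) s0.
  have : 1 <= 2 ^+ m * (2 ^+ j)^-1 :> R.
    by rewrite ler_pdivlMr ?exprn_gt0 // mul1r ler_eXn2l ?ltr1n // ltnW.
  lra.
have tj : 0 <= (al R ^+ j)^-1 by rewrite invr_ge0 ltW.
have [Bd [mB PB hB]] := @increment_event _ _ _ P T treeT measT unifT X (j - m) l s _ s0 tj.
exists Bd, m; split=> //.
  apply: (le_trans PB); rewrite lee_fin ler_expR.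
  have h1 : al R ^+ (j - m + l) * (al R ^+ j)^-1 <= 2 ^+ l / A.
    rewrite ler_pdivrMr // -{2}(subnK mj) !exprD [leRHS]mulrCA ler_wpM2l ?(ltW (p0 _)) //.
    rewrite mulrAC ler_pdivlMr //; apply: le_trans (ler_wpM2l (exprn_ge0 l (ler0n R 2)) m1).
    have e2 : 2 ^+ l * (al R ^+ l / 2 ^+ l) = al R ^+ l by rewrite mulrC divfK // expf_neq0.
    by rewrite expr_div_n [leRHS]mulrCA e2 mulrC.
  by rewrite hA in h1 l1; lra.
move=> w cw nB t ht; apply: (le_trans (hB w cw nB t ht)); rewrite ler_wpM2l //.
by rewrite -{2}(subnK mj) exprD invfM mulrCA divff ?mulr1 // expf_neq0.
Qed.

Lemma slow_event (A : R) j : A = 12 -> exists (Bd : set Omega) (m : nat),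
  [/\ measurable Bd, (P Bd <= (expR (- (2 * ln j.+2%:R)))%:E)%E,
      2 ^+ m <= (A * al R) `^ gl * (9 * A * ln j.+2%:R) `^ (gl * (1 - gr^-1)) :> R &
      forall w, curve_limit T X w -> ~ Bd w -> forall t, (al R ^+ j)^-1 <= t ->
        Num.sqrt 3 / 2 * (2 ^+ m * 2 ^+ j)^-1 <= norm2 (X w t)].
Proof.
move=> hA; have A0 : 0 < A by lra.
have [a1 a2 _] := alpha_facts R; have /andP[g0 g1] := @gamma_l_bounds R.
have r1 := @gamma_r_gt1 R.
have a0 : 0 < al R by lra.
have p0 n : 0 < al R ^+ n by exact: exprn_gt0.
have Aal : 0 <= A * al R by rewrite mulr_ge0 // ltW.
have L1 : 1 <= 3 * A * ln j.+2%:R :> R.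
  by apply: (le_trans (@ln2_ge R (3 * A) _)); [lra | apply: ler_wpM2l (ln_ge_ln2 _); lra].
have [|l /andP[l1 l2]] := @pow_sandwich R 3 _ _ L1; first by lra.
have q1 : 1 <= 3 / al R by rewrite ler_pdivlMr //; lra.
have x1 : 1 <= A * (3 / al R) ^+ l.
  have h : 1 <= (3 / al R) ^+ l by apply: exprn_ege1.
  by have := ler_wpM2l (ltW A0) h; lra.
have [|m /andP[m1 m2]] := @pow_sandwich R (al R) _ _ x1; first by lra.
have b0 : 0 <= gl * (1 - gr^-1).
  by rewrite mulr_ge0 ?(ltW g0) // subr_ge0 invf_le1 ?ltW //; lra.
have hm : 2 ^+ m <= (A * al R) `^ gl * (9 * A * ln j.+2%:R) `^ (gl * (1 - gr^-1)) :> R.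
  rewrite -pow2_alpha.
  apply: (@le_trans _ _ (((A * al R) * (3 / al R) ^+ l) `^ gl)).
    apply: le_powR; [exact: ltW|exact: ltW|]; apply: (le_trans m2).
    by rewrite le_eqVlt; apply/orP; left; apply/eqP; ring.
  have h0 : 0 <= 3 / al R by lra.
  rewrite powRM ?exprn_ge0 //.
  rewrite ler_wpM2l ?powR_ge0 // powRX // three_alpha_gl -powRX //.
  by apply: le_powR; [exact: b0|exact: exprn_ge0|lra].
have tj : 0 <= (al R ^+ j)^-1 by rewrite invr_ge0 ltW.
have [Bd [mB PB hB]] := @far_event _ _ _ P T treeT measT unifT X (j + m) l _ tj.
exists Bd, m; split=> //.
  apply: (le_trans PB); rewrite lee_fin ler_expR.
  have h1 : A * 3 ^+ l <= al R ^+ (j + m + l) * (al R ^+ j)^-1.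
    rewrite ler_pdivlMr // -addnA exprD mulrC ler_wpM2l ?(ltW (p0 _)) // exprD.
    apply: le_trans (ler_wpM2r (ltW (p0 l)) m1).
    by rewrite expr_div_n -mulrA divfK // gt_eqF.
  by rewrite hA in h1 l1; lra.
by move=> w cw nB t ht; have := hB w cw nB t ht; rewrite exprD [_ ^+ j * _]mulrC.
Qed.

Lemma limsup_bound : exists C11 : R, 0 < C11 /\ forall s, 0 <= s ->
  {ae P, forall w, forall e : R, 0 < e -> exists2 delta : R, 0 < delta &
     forall t : R, 0 < t < delta ->
       norm2 (subp (X w (s + t)) (X w s))
         / (t `^ gl * (ln (ln t^-1)) `^ (1 - gl)) <= C11 + e}.
Proof.
have [a1 a2 _] := alpha_facts R; have /andP[g0 g1] := @gamma_l_bounds R.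
have [A hA] : exists A : R, A = 292 by exists 292.
have A0 : 0 < A by lra.
exists (4 * (A * al R) `^ gl * (8 * A) `^ (1 - gl)); split.
  by rewrite !mulr_gt0 ?powR_gt0 // mulr_gt0 //; lra.
move=> s s0; have /choice[B /choice[m hB]] j := @fast_event A s j hA s0.
have mB j : measurable (B j) by case: (hB j).
have PB j : (P (B j) <= (expR (- (2 * ln j.+2%:R)))%:E)%E by case: (hB j).
move: convX (borel_cantelli_log mB PB); apply: filterS2 => w cw [J hJ] e e0.
have [delta [d0 hd]] := @log_scale R J; exists delta => // t ht.
have [n [Jn /andP[t1 t2] h3 h4 /andP[l1 l2]]] := hd t ht.
have t0 : 0 < t by case/andP: ht.
have [_ _ hm hw] := hB n.
have hz := hw w cw (hJ n Jn) t; rewrite (ltW t0) t2 in hz; have {}hz := hz isT.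
have L0 : 0 < ln (ln t^-1) by lra.
rewrite ler_pdivrMr; last by rewrite mulr_gt0 // powR_gt0.
apply: (le_trans hz).
have hl : ln n.+2%:R <= 2 * ln (ln t^-1).
  by apply: le_trans l2; rewrite ler_ln ?posrE // ler_nat.
have ln0 : 0 <= ln n.+2%:R :> R by rewrite ln_ge0 // ler1n.
have hm' : 2 ^+ m n <= (A * al R) `^ gl * ((8 * A) `^ (1 - gl) * ln (ln t^-1) `^ (1 - gl)).
  apply: (le_trans hm); rewrite ler_wpM2l ?powR_ge0 // -powRM; [|lra|exact: ltW].
  by apply: le_powR; have := ler_wpM2l (ltW A0) hl; have := mulr_ge0 (ltW A0) ln0; lra.
have h2 : (2 ^+ n)^-1 <= 2 * t `^ gl.
  have -> : (2 ^+ n)^-1 = 2 * (2 ^+ n.+1)^-1 :> R.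
    by rewrite exprS invfM mulrA divff ?mul1r.
  by rewrite ler_wpM2l.
have h5 : 2 ^+ m n * (2 ^+ n)^-1 <= (A * al R) `^ gl * ((8 * A) `^ (1 - gl) * ln (ln t^-1) `^ (1 - gl)) * (2 * t `^ gl).
  by apply: ler_pM; [exact: exprn_ge0|rewrite invr_ge0 exprn_ge0|exact: hm'|exact: h2].
have e1 : 0 <= e * (t `^ gl * ln (ln t^-1) `^ (1 - gl)).
  by rewrite mulr_ge0 ?mulr_ge0 ?powR_ge0 // ltW.
lra.
Qed.

Lemma liminf_bound : exists C12 : R, 0 < C12 /\
  {ae P, forall w, forall e : R, 0 < e -> exists2 delta : R, 0 < delta &
     forall t : R, 0 < t < delta ->
       C12 - e <= norm2 (X w t)
         / (t `^ gl * (ln (ln t^-1)) `^ (- (gl * (1 - gr^-1))))}.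
Proof.
have [a1 a2 _] := alpha_facts R; have /andP[g0 g1] := @gamma_l_bounds R.
have r1 := @gamma_r_gt1 R; have [s30 _] := sqrt3_facts R.
have b0 : 0 <= gl * (1 - gr^-1).
  by rewrite mulr_ge0 ?(ltW g0) // subr_ge0 invf_le1 ?ltW //; lra.
have [A hA] : exists A : R, A = 12 by exists 12.
have A0 : 0 < A by lra.
pose D := (A * al R) `^ gl * (18 * A) `^ (gl * (1 - gr^-1)).
have D0 : 0 < D.
  have Aal : 0 < A * al R by rewrite mulr_gt0 //; lra.
  by rewrite mulr_gt0 ?powR_gt0 //; lra.
exists (Num.sqrt 3 / 4 / D); split; first by rewrite !divr_gt0.
have /choice[B /choice[m hB]] j := @slow_event A j hA.
have mB j : measurable (B j) by case: (hB j).
have PB j : (P (B j) <= (expR (- (2 * ln j.+2%:R)))%:E)%E by case: (hB j).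
move: convX (borel_cantelli_log mB PB); apply: filterS2 => w cw [J hJ] e e0.
have [delta [d0 hd]] := @log_scale R J; exists delta => // t ht.
have [n [Jn /andP[t1 t2] h3 h4 /andP[l1 l2]]] := hd t ht.
have t0 : 0 < t by case/andP: ht.
have [_ _ hm hw] := hB n.+1.
have hz := hw w cw (hJ n.+1 (leqW Jn)) t t1.
have L0 : 0 < ln (ln t^-1) by lra.
rewrite powRN; set U := ln (ln t^-1) `^ _.
have U0 : 0 < U by exact: powR_gt0.
set V := t `^ gl in h3 h4 *; have V0 : 0 < V by exact: powR_gt0.
rewrite ler_pdivlMr; last by rewrite mulr_gt0 ?invr_gt0.
apply: le_trans hz.
have hm' : 2 ^+ m n.+1 <= D * U.
  apply: (le_trans hm); rewrite /D -[leRHS]mulrA ler_wpM2l ?powR_ge0 // /U -powRM; [|lra|exact: ltW].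
  have ln0 : 0 <= ln n.+3%:R :> R by lra.
  apply: le_powR; first exact: b0.
    by have := mulr_ge0 (ltW A0) ln0; lra.
  by have := ler_wpM2l (ltW A0) l2; lra.
have DU0 : 0 < D * U by exact: mulr_gt0.
apply: (@le_trans _ _ (Num.sqrt 3 / 4 / D * (V * U^-1))).
  rewrite ler_wpM2r //; last by lra.
  by rewrite mulr_ge0 ?invr_ge0 ?(ltW V0) ?(ltW U0).
rewrite [(2 ^+ m _ * _)^-1]invfM.
have h5 : (D * U)^-1 <= (2 ^+ m n.+1)^-1 by rewrite lef_pV2 ?posrE ?exprn_gt0.
have h6 : (D * U)^-1 * V <= (2 ^+ m n.+1)^-1 * (2 * (2 ^+ n.+1)^-1).
  by apply: ler_pM; [rewrite invr_ge0 ltW|exact: ltW|exact: h5|exact: h4].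
rewrite invfM in h6.
have h7 := ler_wpM2l (ltW s30) h6; lra.
Qed.

End LocalBehaviour.

Theorem mainTheorem13 (R : realType) (d : measure_display) (Omega : measurableType d)
  (P : probability Omega R)
  (T : nat -> Omega -> set (pt * pt)) (X : Omega -> R -> R * R) :
  (* (T_n) is a consistent sequence of uniform spanning trees *)
  (forall n w, spanning_tree n (T n w)) ->
  (forall n t, measurable (T n @^-1` [set t])) ->
  (forall n t1 t2, spanning_tree n t1 -> spanning_tree n t2 ->
     P (T n @^-1` [set t1]) = P (T n @^-1` [set t2])) ->
  (forall n w, Tr n (T n.+1 w) = T n w) ->
  (* X is a random curve, the a.s. uniform limit of X_n on [0, oo) *)
  (forall t, measurable_fun setT (fun w => (X w t).1)) ->
  (forall t, measurable_fun setT (fun w => (X w t).2)) ->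
  {ae P, forall w, forall e : R, 0 < e -> exists N, forall n, (N <= n)%N ->
     forall t : R, 0 <= t -> norm2 (subp (Xn n (T n w) t) (X w t)) <= e} ->
  (* (a) *)
  (forall p : R, 0 < p -> exists C9 C10 : R, [/\ 0 < C9, 0 < C10 &
     forall s t : R, 0 <= s -> 0 <= t <= 1 ->
       ((C9 * t `^ (p * gamma_l R))%:E
          <= \int[P]_w ((norm2 (X w t)) `^ p)%:E)%E /\
       (\int[P]_w ((norm2 (subp (X w (s + t)) (X w s))) `^ p)%:E
          <= (C10 * t `^ (p * gamma_l R))%:E)%E]) /\
  (* (b) *)
  (exists C11 C12 : R, [/\ 0 < C11, 0 < C12 &
     forall s : R, 0 <= s ->
       {ae P, forall w,
         (* limsup_{t \searrow 0} ... <= C11 *)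
         (forall e : R, 0 < e -> exists2 delta : R, 0 < delta &
            forall t : R, 0 < t < delta ->
              norm2 (subp (X w (s + t)) (X w s))
                / (t `^ gamma_l R * (ln (ln t^-1)) `^ (1 - gamma_l R))
              <= C11 + e) /\
         (* liminf_{t \searrow 0} ... >= C12 *)
         (forall e : R, 0 < e -> exists2 delta : R, 0 < delta &
            forall t : R, 0 < t < delta ->
              C12 - e <=
              norm2 (X w t)
                / (t `^ gamma_l R *
                   (ln (ln t^-1)) `^ (- (gamma_l R * (1 - (gamma_r R)^-1)))))}]).
Proof.
move=> treeT measT unifT _ measX1 measX2 convX; split.
  move=> p p0; have [C9 [C90 hC9]] := moment_lower treeT measT unifT measX1 measX2 convX p0.
  have [C10 [C100 hC10]] := moment_upper treeT measT unifT measX1 measX2 convX p0.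
  by exists C9, C10; split=> // s t s0 t01; split; [exact: hC9 | exact: hC10].
have [C11 [C110 hC11]] := limsup_bound treeT measT unifT convX.
have [C12 [C120 hC12]] := liminf_bound treeT measT unifT convX.
exists C11, C12; split=> // s s0.
by move: (hC11 s s0) hC12; apply: filterS2 => w h1 h2; split.
Qed.
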